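(* Given a set $R$ of requests on a bidirected tree $T$ in which every pair of opposite arcs $\{(u,v),(v,u)\}$ contains the emission arc or the reception arc of some request of $R$, one can compute the clique number $\omega(R,T)$ of $\mathcal{I}(R,T)$ in $O(|R|^{4.5})$ time.
   Context: A bidirected tree $T$ is a digraph obtained from a finite undirected tree by replacing each edge $uv$ by the two arcs $(u,v)$ and $(v,u)$. A request in $T$ is a directed path in $T$ with at least one arc. For a directed path $r$, $s_r$ is its first vertex, $t_r$ its last vertex, $s_r^+$ its second vertex, $t_r^-$ its penultimate vertex; its emission arc is $(s_r,s_r^+)$ and its reception arc is $(t_r^-,t_r)$. $T[x,y]$ denotes the unique directed path from $x$ to $y$ in $T$. A request $r$ interferes on $r'$ if $T[s_r,t_{r'}]$ has first arc the emission arc of $r$ and last arc the reception arc of $r'$; two requests interfere if one interferes on the other. The interference graph $\mathcal{I}(R,T)$ has vertex set $R$ and an edge between two distinct requests iff they interfere; $\omega(R,T)$ is its clique number. *)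

(* Defs.v *)
From mathcomp Require Import all_boot all_order all_algebra.
From mathcomp Require Import all_classical all_reals all_analysis.

Set Implicit Arguments.
Unset Strict Implicit.
Unset Printing Implicit Defensive.

(* A symmetric relation [e] stands both for an undirected graph and for the
   digraph having the two arcs (u,v) and (v,u) for every edge uv. *)
Definition tree (V : finType) (e : rel V) : Prop :=
  [/\ 0 < #|V|, symmetric e, irreflexive e, (forall x y, connect e x y)
    & forall c : seq V, ucycle e c -> size c <= 2].

(* [(x, p)] is the vertex sequence [x :: p]; it has [size p] arcs. *)
Definition vseq (V : Type) : Type := (V * seq V)%type.

Definition verts (V : Type) (r : vseq V) : seq V := r.1 :: r.2.
Definition source (V : Type) (r : vseq V) : V := r.1.
Definition target (V : Type) (r : vseq V) : V := last r.1 r.2.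

Definition dipath (V : finType) (e : rel V) (r : vseq V) : bool :=
  path e r.1 r.2 && uniq (verts r).

Definition request (V : finType) (e : rel V) (r : vseq V) : bool :=
  dipath e r && (0 < size r.2).

Definition arcs (V : Type) (r : vseq V) : seq (V * V) := zip (verts r) r.2.

(* [None] exactly when the path has no arc, i.e. never on a request. *)
Definition first_arc (V : Type) (r : vseq V) : option (V * V) :=
  ohead (arcs r).
Definition last_arc (V : Type) (r : vseq V) : option (V * V) :=
  ohead (rev (arcs r)).

Definition emission (V : Type) (r : vseq V) := first_arc r.
Definition reception (V : Type) (r : vseq V) := last_arc r.

(* The default value [(x, [::])] is irrelevant when [e] is connected. *)
Definition tree_path (V : finType) (e : rel V) (x y : V) : vseq V :=
  xget ((x, [::]) : vseq V)
    (fun r : vseq V => [/\ dipath e r, source r = x & target r = y]).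

Definition interferes_on (V : finType) (e : rel V) (r r' : vseq V) : bool :=
  (first_arc (tree_path e (source r) (target r')) == emission r) &&
  (last_arc (tree_path e (source r) (target r')) == reception r').

Definition interfere (V : finType) (e : rel V) (r r' : vseq V) : bool :=
  interferes_on e r r' || interferes_on e r' r.

(* The vertex type [seq_sub rs] is the finite type of the elements of [rs]. *)
Definition interference_graph (V : finType) (e : rel V) (rs : seq (vseq V)) :
    rel (seq_sub rs) :=
  fun r r' => (r != r') && interfere e (val r) (val r').

Definition is_clique (T : finType) (g : rel T) (K : {set T}) : bool :=
  [forall x in K, forall y in K, (x != y) ==> g x y].

Definition clique_number (T : finType) (g : rel T) : nat :=
  \max_(K : {set T} | is_clique g K) #|K|.

Definition omega (V : finType) (e : rel V) (rs : seq (vseq V)) : nat :=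
  clique_number (interference_graph e (rs := rs)).

Definition every_edge_used (V : finType) (e : rel V) (rs : seq (vseq V)) :
    Prop :=
  forall u v, e u v -> exists2 r, r \in rs &
    [\/ emission r = Some (u, v), emission r = Some (v, u),
        reception r = Some (u, v) | reception r = Some (v, u)].

(* [es] lists every edge of [e] exactly once, in some order, each with some
   orientation. *)
Definition edge_list (V : finType) (e : rel V) (es : seq (V * V)) : Prop :=
  [/\ forall u v, e u v = ((u, v) \in es) || ((v, u) \in es),
      uniq es
    & forall u v, (u, v) \in es -> (v, u) \notin es].

Definition encode_edge (n : nat) (a : 'I_n * 'I_n) : seq nat :=
  [:: val a.1; val a.2].

Definition encode_request (n : nat) (r : vseq 'I_n) : seq nat :=
  size (verts r) :: [seq val x | x <- verts r].

(* The number of edges is not written, as it is [n.-1] for a tree. *)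
Definition encode_instance (n : nat) (es : seq ('I_n * 'I_n))
    (rs : seq (vseq 'I_n)) : seq nat :=
  n :: size rs :: flatten [seq encode_edge a | a <- es] ++
                  flatten [seq encode_request r | r <- rs].

(* Machine words have [w] bits. The machine has registers (finitely many occur
   in a given program) and a memory addressed by words. Each evaluated operator
   or operand, each executed command and each evaluation of a guard costs one
   unit of time. *)

Inductive binop := Add | Sub | Mul | Div | Lt | Eq.

Inductive expr :=
| Cst of nat
| Reg of nat
| Read of expr
| Bin of binop & expr & expr.

Inductive cmd :=
| Skip
| Assign of nat & expr
| Write of expr & expr
| Seq of cmd & cmd
| If of expr & cmd & cmd
| While of expr & cmd.

Record state := State { regs : nat -> nat; mem : nat -> nat }.

Definition update (f : nat -> nat) (i v : nat) : nat -> nat :=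
  fun j => if j == i then v else f j.

(* [Add] and [Mul] are modulo [2 ^ w]; [Sub] is truncated at 0. *)
Definition binop_eval (w : nat) (o : binop) (a b : nat) : nat :=
  match o with
  | Add => (a + b) %% 2 ^ w
  | Sub => a - b
  | Mul => (a * b) %% 2 ^ w
  | Div => a %/ b
  | Lt => a < b
  | Eq => a == b
  end.

Fixpoint expr_eval (w : nat) (s : state) (x : expr) : nat :=
  match x with
  | Cst c => c %% 2 ^ w
  | Reg i => regs s i
  | Read a => mem s (expr_eval w s a)
  | Bin o a b => binop_eval w o (expr_eval w s a) (expr_eval w s b)
  end.

Fixpoint expr_cost (x : expr) : nat :=
  match x with
  | Cst _ | Reg _ => 1
  | Read a => (expr_cost a).+1
  | Bin _ a b => (expr_cost a + expr_cost b).+1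
  end.

(* [exec w c s t s']: with [w]-bit words, [c] started in state [s] halts in
   state [s'] after [t] units of time. *)
Inductive exec (w : nat) : cmd -> state -> nat -> state -> Prop :=
| ExecSkip s : exec w Skip s 1 s
| ExecAssign i x s :
    exec w (Assign i x) s (expr_cost x).+1
      (State (update (regs s) i (expr_eval w s x)) (mem s))
| ExecWrite a x s :
    exec w (Write a x) s (expr_cost a + expr_cost x).+1
      (State (regs s) (update (mem s) (expr_eval w s a) (expr_eval w s x)))
| ExecSeq c1 c2 s1 t1 s2 t2 s3 :
    exec w c1 s1 t1 s2 -> exec w c2 s2 t2 s3 ->
    exec w (Seq c1 c2) s1 (t1 + t2).+1 s3
| ExecIf x c1 c2 s t s' :
    exec w (if expr_eval w s x != 0 then c1 else c2) s t s' ->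
    exec w (If x c1 c2) s (expr_cost x + t).+1 s'
| ExecWhileStop x c s :
    expr_eval w s x = 0 -> exec w (While x c) s (expr_cost x).+1 s
| ExecWhileStep x c s1 t1 s2 t2 s3 :
    expr_eval w s1 x != 0 -> exec w c s1 t1 s2 -> exec w (While x c) s2 t2 s3 ->
    exec w (While x c) s1 (expr_cost x + t1 + t2).+1 s3.

Definition initial_state (input : seq nat) : state :=
  State (fun=> 0) (nth 0 input).

(* The result is read in register 0. *)
Definition computes_within (w : nat) (c : cmd) (input : seq nat)
    (bound result : nat) : Prop :=
  exists t s, [/\ exec w c (initial_state input) t s, t <= bound
                & regs s 0 = result].

(* Main.v *)
(* Removing the edge of an arc (u, v) leaves a half-tree, the side of v. Write
   E_r and F_r for the half-trees of the emission and reception arcs of r; then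
   F_r is contained in E_r, and r interferes on r' iff E_r contains t_r' and F_r'
   misses s_r. Hence in a clique the sets E_r meet pairwise, and so do the
   complements of the sets F_r; by the Helly property of subtrees some x lies in
   all the E_r and some y in none of the F_r.

   Conversely fix x and y and let R_xy be the requests with x in E_r and y not in
   F_r. List the vertices starting with the path from y to x and inserting every
   further vertex right after its neighbour. For r in R_xy, the complement of E_r
   and F_r are then disjoint intervals of the list; two requests for which these
   intervals come in the same order interfere. So R_xy is the union of two
   cliques, and its complement graph G is bipartite. By Koenig's theorem, applied
   to the double cover of G (which needs no 2-colouring of G to be known), the
   clique number of R_xy is |R_xy| - M / 2 for a maximum matching of size M.

   For fixed x, let y run through a list of the vertices in which each vertex was
   inserted right after its neighbour. A half-tree is a cyclic interval of that
   list, so a request leaves R_xy at most twice, and repairing the matching when y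
   moves takes O(|R|) augmenting path searches in all, each of cost O(|R|^2). As
   the tree has at most 2|R| edges, the total cost is O(|R|^4). *)

Require Import Defs.
From mathcomp Require Import all_boot all_order all_algebra.
From mathcomp Require Import all_classical all_reals all_analysis.
From mathcomp Require Import zify.
Import numFieldNormedType.Exports.
(* Again, as [Add] and the like are shadowed by the imports above. *)
Import Defs.
Set Implicit Arguments.
Unset Strict Implicit.
Unset Printing Implicit Defensive.

(** * Lists of vertices *)

(** The obstacle is to turn an amortised count into a worst-case bound on a word machine. The
    program uses bounded loops of fewer than [D] turns each, so its time is a constant times
    [D ^ depth]. Separate loops over x, over y and over the augmentations, around a search of depth
    2, would give depth 5. The loops over y and over the augmentations are therefore merged into one
    loop of steps: each step makes one search and then either augments or moves y, and a potential
    shows that O(n + m) steps suffice. The depth is then 4. The modulus [D] is n + m + 2, so that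
    vertices, request indices and their successors stay below it and a [D] by [D] table holds the
    input. The program computes no path of the tree. A half-tree changes only across its own edge,
    so its value at a new vertex follows from the value at a neighbour, and the tables are filled
    while the list of vertices grows. The lists that start with the path from y to x occur only in
    the proof; the program keeps a single list, grown from vertex 0, for all x. *)

Definition second (V : Type) (r : vseq V) : V := nth r.1 r.2 0.
Definition penult (V : Type) (r : vseq V) : V := nth r.1 (verts r) (size r.2).-1.

Section Insertion.
Variable (T : eqType).
Implicit Types (c : pred T) (s : seq T).

Definition same_edge (u v a b : T) : bool :=
  ((a == u) && (b == v)) || ((a == v) && (b == u)).

Lemma same_edgeC u v a b : same_edge u v a b = same_edge a b u v.
Proof.
by rewrite /same_edge [a == u]eq_sym [b == v]eq_sym [a == v]eq_sym [b == u]eq_sym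
  [(v == a) && _]andbC.
Qed.

Lemma same_edge_sym u v a b : same_edge u v a b = same_edge u v b a.
Proof. by rewrite /same_edge orbC [(b == _) && _]andbC [(b == _) && (a == _)]andbC. Qed.

Lemma same_edgeP u v a b :
  reflect ((a = u /\ b = v) \/ (a = v /\ b = u)) (same_edge u v a b).
Proof.
by apply: (iffP orP) => -[] => [/andP[/eqP-> /eqP->]|/andP[/eqP-> /eqP->]|
  [-> ->]|[-> ->]]; rewrite ?eqxx; auto.
Qed.


Fixpoint insert_after (u v : T) s :=
  if s is a :: s' then
    if a == u then a :: v :: s' else a :: insert_after u v s'
  else [::].

Fixpoint changes c s :=
  if s is a :: s' then
    (if s' is b :: _ then (c a != c b : nat) else 0) + changes c s'
  else 0.

Lemma mem_insert_after u v s : u \in s -> insert_after u v s =i v :: s.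
Proof.
move=> us z; elim: s us => //= a s IH; rewrite inE.
have [-> _|ne /=] := eqVneq a u; first by rewrite !inE orbCA.
by move=> us; rewrite inE IH // !inE orbCA.
Qed.

Lemma uniq_insert_after u v s : u \in s -> v \notin s -> uniq s ->
  uniq (insert_after u v s).
Proof.
elim: s => //= a s IH; rewrite !inE negb_or => us /andP[va vs] /andP[as_ us'].
case: eqVneq us => [_ _|ne /= us]; rewrite /= ?inE ?vs ?us' ?andbT.
  by rewrite negb_or as_ eq_sym va.
by rewrite IH // andbT mem_insert_after // inE negb_or eq_sym va.
Qed.

Lemma size_insert_after u v s : u \in s -> size (insert_after u v s) = (size s).+1.
Proof.
elim: s => //= a s IH; rewrite inE eq_sym; case: eqVneq => //= _ us.
by rewrite IH.
Qed.

Lemma head_insert_after x0 u v s : head x0 (insert_after u v s) = head x0 s.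
Proof. by case: s => //= a s; case: ifP. Qed.

(** The new entry repeats the value of its left neighbour. *)
Lemma changes_insert_same c u v s : c u = c v ->
  changes c (insert_after u v s) = changes c s.
Proof.
move=> cuv; elim: s => //= a s IH; case: eqVneq => [->|_] /=.
  by rewrite cuv eqxx; case: s {IH} => //=.
rewrite IH; congr (_ + _); case: s {IH} => //= b s; by case: ifP.
Qed.

Lemma changes_const c s : {in s &, forall a b, c a = c b} -> changes c s = 0.
Proof.
elim: s => //= a s IH H; rewrite IH ?addn0; last first.
  by move=> x y xs ys; apply: H; rewrite inE ?xs ?ys orbT.
by case: s {IH} H => //= b s H; rewrite (H a b) ?eqxx ?inE ?eqxx ?orbT.
Qed.

(** A single deviating entry has at most two neighbours. *)
Lemma changes_insert_const c u v s : {in s &, forall a b, c a = c b} ->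
  changes c (insert_after u v s) <= 2.
Proof.
elim: s => //= a s IH H.
have H' : {in s &, forall a b, c a = c b}.
  by move=> x y xs ys; apply: H; rewrite inE ?xs ?ys orbT.
case: eqVneq => [E|_] /=.
  rewrite (changes_const H') addn0; case: {IH H' H} s => [|b s]; first by case: eqP.
  by do 2!case: eqP.
have -> : (if insert_after u v s is b :: _ then (c a != c b : nat) else 0) = 0.
  case: s {IH H'} H => //= b s H; have cab : c a = c b by apply: H; rewrite !inE eqxx ?orbT.
  by case: ifP => _; rewrite cab eqxx.
exact: IH.
Qed.

Lemma changes_sum x0 c s : changes c s =
  \sum_(0 <= i < (size s).-1) (c (nth x0 s i) != c (nth x0 s i.+1)).
Proof.
elim: s => [|a [|b s] IH] /=; rewrite ?big_nil // .
by rewrite big_nat_recl //; congr (_ + _); exact: IH.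
Qed.

Lemma changes_between (c : nat -> bool) i j : i <= j -> c i != c j ->
  0 < \sum_(i <= k < j) (c k != c k.+1).
Proof.
move=> ij; rewrite -(subnKC ij); elim: (j - i) => [|d IH]; first by rewrite addn0 eqxx.
move=> ne; rewrite addnS big_nat_recr ?leq_addr //=.
case: (eqVneq (c i) (c (i + d))) => [E|/IH]; last by move=> h; rewrite ltn_addr.
by rewrite addnS E in ne; rewrite ne addn1.
Qed.

(** A gap between two members of [c] costs two changes, and a third one occurs before the first of
    them when the list starts outside [c]. Thus a cyclic interval becomes a genuine interval once
    the list is cut at a suitable head. *)
Lemma changes_convex x0 c s i j k : changes c s <= (if c (head x0 s) then 1 else 2) ->
  i <= j -> j <= k -> k < size s -> c (nth x0 s i) -> c (nth x0 s k) -> c (nth x0 s j).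
Proof.
rewrite (changes_sum x0) => le ij jk ks ci ck; apply/negPn/negP => cj.
move: le; rewrite -nth0.
have n1 : k <= (size s).-1 by case: (size s) ks.
rewrite (big_cat_nat (n := i)) ?(leq_trans ij (leq_trans jk n1)) //=.
rewrite (big_cat_nat (m := i) (n := j)) ?(leq_trans jk n1) //= (big_cat_nat (m := j) (n := k)) //=.
have := @changes_between (fun i => c (nth x0 s i)) _ _ ij; rewrite ci (negbTE cj) => /(_ isT).
have := @changes_between (fun i => c (nth x0 s i)) _ _ jk; rewrite ck (negbTE cj) => /(_ isT).
have := @changes_between (fun i => c (nth x0 s i)) _ _ (leq0n i); rewrite ci.
by case: (c (nth x0 s 0)) => /= [_|/(_ isT)]; lia.
Qed.

End Insertion.

(** * Half-trees and interference *)

Section HalfTrees.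
Variables (V : finType) (e : rel V).
Hypothesis tree_e : tree e.

Let e_sym : symmetric e. Proof. by case: tree_e. Qed.
Let e_irr : irreflexive e. Proof. by case: tree_e. Qed.
Let e_conn x y : connect e x y. Proof. by case: tree_e. Qed.

Definition side (u v : V) : pred V :=
  connect (fun a b => e a b && ~~ same_edge u v a b) v.

Lemma side_head u v : side u v v.
Proof. exact: connect0. Qed.

(** Otherwise a simple path from [v] to [u] avoiding the edge would close up into a cycle; the tree
    condition leaves room only for the deleted edge itself. *)
Lemma side_tail u v : e u v -> side u v u = false.
Proof.
move=> euv; apply/negP => /connectP[p0 pth0 eqt].
case/shortenP: pth0 eqt => p pth up _ eqt.
have pe : path e v p by apply: sub_path pth => a b /andP[].
case: tree_e => _ _ _ _ /(_ (v :: p)).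
rewrite /ucycle up andbT /= rcons_path pe -eqt euv => /(_ isT).
case: p pth up eqt pe => [|a [|b p]] //=.
  by move=> _ _ uv; rewrite uv e_irr in euv.
by rewrite andbT => + _ eqt _ _; rewrite eqt /same_edge !eqxx orbT andbF.
Qed.

(** This local description determines a half-tree from its value at one vertex. Both the proofs
    below and the program rely on it. *)
Lemma side_edge u v a b : e u v -> e a b ->
  (side u v a != side u v b) = same_edge u v a b.
Proof.
move=> euv eab; case: (boolP (same_edge u v a b)) => [|nab].
  by case/orP=> /andP[/eqP-> /eqP->]; rewrite side_head side_tail.
apply/negbTE; rewrite negbK; apply/eqP; apply/idP/idP => sd;
  apply: (connect_trans sd); apply: connect1; first by rewrite eab.
by rewrite e_sym eab same_edge_sym.
Qed.

(** Global facts on half-trees are reduced by this to checks across a single edge. *)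
Lemma edge_const (T : eqType) (f : V -> T) :
  (forall a b, e a b -> f a = f b) -> forall x y, f x = f y.
Proof.
move=> fe x y; case/connectP: (e_conn x y) => p pth ->.
elim: p x pth => //= a p IH x /andP[exa pth].
by rewrite (fe _ _ exa) -IH.
Qed.

(** Both half-trees change across the same edge only, so their exclusive or is constant, and it is
    true at [u]. *)
Lemma side_opp u v a : e u v -> side v u a = ~~ side u v a.
Proof.
move=> euv; have evu : e v u by rewrite e_sym.
suff: side v u a (+) side u v a by case: (side v u a); case: (side u v a).
rewrite -(@edge_const _ (fun a => side v u a (+) side u v a) _ u).
  by rewrite side_head side_tail.
move=> b c ebc; have := side_edge euv ebc; have := side_edge evu ebc.
rewrite /same_edge orbC => <-.
by do 4!case: (side _ _ _).
Qed.

Lemma side_const u v u' v' a b : e u v -> e u' v' -> ~~ same_edge u v u' v' ->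
  side u' v' u = false -> side u' v' a -> side u' v' b -> side u v a = side u v b.
Proof.
move=> euv euv' neq su.
suff H z : side u' v' z -> side u v z = side u v v' by move=> /H-> /H->.
(* Flattening [side u v] beyond the edge u'v' changes it across no edge. *)
pose d z := (if side u' v' z then side u v v' else side u v z) (+) side u v z.
have dc : forall x y, d x = d y.
  apply: edge_const => x y exy; rewrite /d.
  have := side_edge euv exy; have := side_edge euv' exy.
  have [/same_edgeP E|nE] := boolP (same_edge u v x y).
    have sv : side u' v' v = false.
      apply/negbTE/negP => sv; have := side_edge euv' euv.
      by rewrite su sv same_edgeC (negbTE neq).
    by case: E => -[-> ->]; rewrite su sv !addbb.
  case: (boolP (same_edge u' v' x y)) => [/same_edgeP E|_].
    have := side_edge euv euv'; rewrite (negbTE neq) => /negbFE/eqP E2.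
    by case: E => -[-> ->]; rewrite side_head (side_tail euv') E2 !addbb.
  by move/negbFE/eqP-> => /negbFE/eqP->.
move=> sz; have := dc z u; rewrite /d sz su addbb.
by case: (side u v z); case: (side u v v').
Qed.

Lemma Helly_sides (I : finType) (K : {set I}) (u v : I -> V) (i0 : I) :
  i0 \in K -> (forall i, i \in K -> e (u i) (v i)) ->
  (forall i j, i \in K -> j \in K -> exists z, side (u i) (v i) z && side (u j) (v j) z) ->
  exists x, forall i, i \in K -> side (u i) (v i) x.
Proof.
move=> iK eK meet.
(* The head of the arc of a smallest half-tree lies in all of them. *)
pose sz i := #|[pred z | side (u i) (v i) z]|.
case: (arg_minnP sz iK) => i Ki min.
exists (v i) => j Kj; apply/negPn/negP => nj.
have [z /andP[zi zj]] := meet _ _ Ki Kj.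
case: (boolP (same_edge (u i) (v i) (u j) (v j))) => [/same_edgeP[[E1 E2]|[E1 E2]]|ne].
- by rewrite E2 side_head in nj.
- by move: zj; rewrite E1 E2 side_opp ?zi ?eK.
have uj : side (u j) (v j) (u i) = false.
  have := side_edge (eK _ Kj) (eK _ Ki); rewrite (negbTE nj) same_edgeC (negbTE ne).
  by case: side.
(* Half-tree j does not contain the edge of i, so it lies on one side of that edge, namely the side
   of the common vertex [z]. It is contained in half-tree i and misses [v i]. *)
have: sz j < sz i.
  apply: proper_card; apply/properP; split.
    apply/fintype.subsetP => a; rewrite !inE => aj.
    by rewrite (side_const (eK _ Ki) (eK _ Kj) ne uj aj zj).
  by exists (v i); rewrite !inE ?side_head.
by rewrite ltnNge min.
Qed.

(* A simple path leaving [u] by [uv] never comes back through that edge. *)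
Lemma first_arc_side r u v : dipath e r -> source r = u -> e u v ->
  (first_arc r == Some (u, v)) = side u v (target r).
Proof.
case: r => x [|y p]; rewrite /dipath /source /target /first_arc /= => + <-.
  by move=> _ /side_tail ->.
case/andP=> /andP[exy pth] /and3P[xyp yp up] exv.
have cst (c : bool) : side x v y = c -> side x v (last y p) = c.
  elim: p y {exy up yp} pth xyp => //= z p IH y /andP[eyz pth].
  rewrite !inE !negb_or => /and3P[xy xz xp] sy.
  apply: (IH z pth); first by rewrite inE negb_or xz.
  have := side_edge exv eyz; rewrite sy /same_edge [y == x]eq_sym [z == x]eq_sym.
  rewrite (negbTE xy) (negbTE xz) andbF.
  by case: c {sy IH}; case: side.
have := side_edge exv exy; rewrite (side_tail exv) /same_edge eqxx /=.
have -> : (x == v) = false by apply/negP => /eqP E; rewrite E e_irr in exv.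
rewrite orbF; case E: (side x v y); rewrite (cst _ E) /= => /esym.
  by move/eqP->; rewrite eqxx.
by move=> /negP nyv; apply/eqP => -[] /eqP.
Qed.

Lemma last_arc_rcons (x : V) p a b :
  last_arc (x, rcons (rcons p a) b) = Some (a, b).
Proof.
rewrite /last_arc /arcs /verts /=.
suff -> : zip (x :: rcons (rcons p a) b) (rcons (rcons p a) b)
  = rcons (zip (x :: rcons p a) (rcons p a)) (a, b) by rewrite rev_rcons.
elim: p x => //= c p IH x; by rewrite -IH.
Qed.

(** A simple path meets its end [v] only once, so all its vertices before [v] lie on the same side
    of the edge as the source. *)
Lemma last_arc_side r u v : dipath e r -> target r = v -> e u v ->
  (last_arc r == Some (u, v)) = ~~ side u v (source r).
Proof.
case: r => x p; rewrite /dipath /target /source /= => + + euv.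
case/lastP: p => [_ /= <-|q w]; first by rewrite side_head.
rewrite last_rcons rcons_path mem_rcons => dp wv; subst w.
have -> : last_arc (x, rcons q v) = Some (last x q, v).
  by case/lastP: q dp => [//|q a] _; rewrite last_arc_rcons last_rcons.
case/andP: dp => /andP[pth elv].
rewrite inE negb_or rcons_uniq => /andP[/andP[xv xq] /andP[vq _]].
have -> : side u v x = side u v (last x q).
  elim: q x pth xv {xq elv} vq => //= y q IH x /andP[exy pth] xv.
  rewrite inE negb_or => /andP[vy vq]; rewrite -(IH y) // 1?eq_sym //.
  have := side_edge euv exy; rewrite /same_edge (negbTE xv).
  by rewrite [y == v]eq_sym (negbTE vy) andbF => /negbFE/eqP.
have := side_edge euv elv; rewrite side_head /same_edge eqxx andbT.
have -> : (v == u) = false by apply/negP => /eqP E; rewrite E e_irr in euv.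
rewrite andbF orbF => _.
case E: (last x q == u); first by move/eqP: E => ->; rewrite side_tail //= eqxx.
have := side_edge euv elv; rewrite side_head /same_edge E.
have -> : (v == u) = false by apply/negP => /eqP E'; rewrite E' e_irr in euv.
rewrite andbF /= => /negbFE/eqP ->.
by apply/eqP => -[/eqP]; rewrite E.
Qed.

(** While a vertex is missing, connectedness provides an edge leaving the list, and its outer end is
    inserted after the inner one. *)
Lemma grow (P : seq V -> Prop) l0 w : w \in l0 -> P l0 ->
  (forall l u v, P l -> u \in l -> v \notin l -> e u v -> P (insert_after u v l)) ->
  exists2 l, P l & forall v, v \in l.
Proof.
move=> + + step; have [n] := ubnP #|[pred v | v \notin l0]|.
elim: n l0 => // n IH l lt_n wl Pl.
case: (pickP [pred p : V * V | [&& e p.1 p.2, p.1 \in l & p.2 \notin l]]) => [[u v]|no].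
  case/and3P=> /= euv ul vl; apply: (IH (insert_after u v l)); last exact: step.
    rewrite -ltnS; apply: leq_trans lt_n; rewrite ltnS; apply: proper_card; apply/properP; split.
      apply/fintype.subsetP => z; rewrite !inE mem_insert_after // inE negb_or.
      by case/andP.
    by exists v; rewrite !inE ?vl // mem_insert_after // inE eqxx.
  by rewrite mem_insert_after // inE wl orbT.
exists l => // v; rewrite (@edge_const _ (fun z => z \in l) _ v w) // => a b eab.
have := no (a, b); have := no (b, a); rewrite /= eab [e b a]e_sym eab /=.
by do 2!case: (_ \in l).
Qed.

(* A list of distinct vertices starting with [y], built from the path from [y] to
   [x] by inserting leaves next to their neighbour: half-trees of its subtree are
   cyclic intervals, and those that separate [x] from [y] are cut only once. *)
Definition spread (x y : V) (l : seq V) :=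
  [/\ uniq l, x \in l, head y l = y & forall a b, e a b ->
   {in l &, forall z t, side a b z = side a b t} \/
   [/\ a \in l, b \in l, changes (side a b) l <= 2
     & side a b x != side a b y -> changes (side a b) l <= 1]].

Lemma spread_head x y l : spread x y l -> y \in l.
Proof. by case=> _; case: l => //= a l _ ->; rewrite inE eqxx. Qed.

(** For an edge other than uv the new vertex copies the value of its neighbour. The edge uv had an
    end outside [l], so its half-tree was constant there, in particular equal at [x] and [y], and
    one insertion creates at most two changes. *)
Lemma spread_insert x y l u v : spread x y l -> u \in l -> v \notin l -> e u v ->
  spread x y (insert_after u v l).
Proof.
move=> sl ul vl euv; have yl := spread_head sl; case: sl => ul' xl hl H.
have mi := mem_insert_after v ul.
split; first exact: uniq_insert_after.
- by rewrite mi inE xl orbT.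
- by rewrite head_insert_after.
move=> a b eab; have := side_edge eab euv; case: (H a b eab) => [cst|[al bl le2 le1]].
  case: (boolP (same_edge a b u v)) => [/same_edgeP E _|_ /negbFE/eqP suv].
    right; rewrite !mi !inE changes_insert_const //; split=> //.
    - by case: E => -[? ?]; subst; rewrite ?ul ?eqxx ?orbT.
    - by case: E => -[? ?]; subst; rewrite ?ul ?eqxx ?orbT.
    by rewrite (cst x y) ?eqxx.
  left=> z t; rewrite !mi !inE => /orP[/eqP->|zl] /orP[/eqP->|tl] //; rewrite -?suv; exact: cst.
case: (boolP (same_edge a b u v)) => [/same_edgeP E|_ /negbFE/eqP suv].
  by case: E => -[? ?]; subst; rewrite ?al ?bl in vl.
by right; rewrite !mi !inE al bl !orbT changes_insert_same.
Qed.

(** Along a simple path a half-tree changes only where the path crosses its edge, hence at most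
    once. *)
Lemma spread_path y p : path e y p -> uniq (y :: p) -> spread (last y p) y (y :: p).
Proof.
move=> pth un; split=> //; first exact: mem_last.
move=> a b eab.
have H : {in y :: p &, forall z t, side a b z = side a b t} \/
   [/\ a \in y :: p, b \in y :: p & changes (side a b) (y :: p) <= 1].
  elim: p y pth un => [|z p IH] y.
    by move=> _ _; left=> z t; rewrite !inE => /eqP-> /eqP->.
  rewrite [path _ _ _]/= [uniq _]/= => /andP[eyz pth] /andP[yzp up].
  have := side_edge eab eyz; case: (IH z pth up) => [cst|[az bz le1]].
    case: (boolP (same_edge a b y z)) => [/same_edgeP E _|_ /negbFE/eqP yz].
      right; split; try by case: E => -[? ?]; subst; rewrite !inE ?eqxx ?orbT.
      by rewrite [changes _ _]/= -/(changes (side a b) (z :: p)) changes_const // addn0; case: eqP.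
    left=> t w; rewrite !(in_cons y) => /orP[/eqP->|tl] /orP[/eqP->|wl] //; rewrite ?yz;
      by apply: cst => //; rewrite inE eqxx.
  case: (boolP (same_edge a b y z)) => [/same_edgeP E _|_ /negbFE/eqP yz].
    by case: E => -[? ?]; subst; rewrite ?az ?bz in yzp.
  right; rewrite !(in_cons y) az bz !orbT; split=> //.
  by rewrite [changes _ _]/= -/(changes (side a b) (z :: p)) yz eqxx.
case: H => [cst|[al bl le]]; [by left|right; split=> //]; exact: leq_trans le _.
Qed.

Lemma spread_exists x y : exists2 l, spread x y l & forall v, v \in l.
Proof.
case/connectP: (e_conn y x) => p0 pth0 ->; case/shortenP: pth0 => p pth up _.
apply: (@grow (spread (last y p) y) (y :: p) y); first by rewrite inE eqxx.
  exact: spread_path.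
by move=> l u v sl ul vl euv; apply: spread_insert.
Qed.

Lemma spread_changes x y l a b : spread x y l -> e a b ->
  changes (side a b) l <= 2.
Proof. by case=> _ _ _ H /H[/changes_const->|[]]. Qed.

(** The input does not record the number of edges, so the program reads n - 1 of them. In the
    induction each inserted vertex brings exactly one edge into the list. *)
Lemma card_edge_list es : edge_list e es -> size es = #|V|.-1.
Proof.
case=> eE ues nsym; pose inside (l : seq V) := count [pred a : V * V | (a.1 \in l) && (a.2 \in l)] es.
case: (tree_e) => /card_gt0P[w _] _ _ _ _.
have [] := @grow (fun l => spread w w l /\ (inside l).+1 = size l) [:: w] w.
- by rewrite inE eqxx.
- split; first exact: (@spread_path w [::]).
  rewrite /inside (@eq_in_count _ _ pred0) ?count_pred0 // => -[a b] ab /=.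
  rewrite !inE; apply/negP => /andP[/eqP aw /eqP bw]; subst.
  by have := e_irr w; rewrite eE ab.
- move=> l u v [sl cl] ul vl euv; split; first exact: spread_insert.
  rewrite size_insert_after // -cl; congr S.
  have mi := mem_insert_after v ul.
  (* The edge uv is not inside [l], so its half-tree is constant there and misses [b] as it misses
     [u]. The edge from [v] to [b] then crosses it, and must be uv. *)
  have nb b : e v b -> b \in l -> b = u.
    move=> evb bl; case: sl => _ _ _ /(_ u v euv)[cst|[_]]; last by rewrite (negbTE vl).
    have := side_edge euv evb; rewrite (cst b u) // side_head side_tail //.
    by move/esym/same_edgeP => [[E1 E2]|[]] //; rewrite -E1 (negbTE vl) in ul.
  have -> : inside (insert_after u v l) = inside l + count (pred2 (u, v) (v, u)) es.
    rewrite /inside -count_predUI.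
    rewrite [X in _ = _ + X](@eq_count _ _ pred0) ?count_pred0 ?addn0.
      apply: eq_in_count => -[a b] ab; rewrite /= !mi !inE !xpair_eqE.
      have eab : e a b by rewrite eE ab.
      case: (eqVneq a v) => [E|nav]; case: (eqVneq b v) => [E'|nbv] /=; subst.
      + by rewrite e_irr in eab.
      + rewrite (negbTE vl) /= [v == u]eq_sym /=.
        apply/idP/idP => [bl|]; first by rewrite (nb b) ?eqxx ?orbT.
        by case/orP=> [/andP[_ /eqP E]|/eqP->] //.
      + rewrite (negbTE vl) !andbF !andbT /= orbF ?andbT.
        apply/idP/eqP => [al|->] //; apply: nb => //; by rewrite e_sym.
      + by rewrite andbF /= orbF.
    move=> [a b] /=; rewrite !xpair_eqE; apply/negP => /andP[/andP[al bl]].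
    by case/orP=> /andP[/eqP ? /eqP ?]; subst; rewrite ?al ?bl in vl.
  have : e u v := euv; rewrite eE.
  have uv : (u, v) != (v, u).
    by rewrite xpair_eqE; apply/negP => /andP[/eqP E _]; rewrite E (negbTE vl) in ul.
  have -> : count (pred2 (u, v) (v, u)) es = ((u, v) \in es) + ((v, u) \in es).
    rewrite -!count_uniq_mem // -count_predUI [X in _ + X](@eq_count _ _ pred0).
      by rewrite count_pred0 addn0.
    by move=> z /=; apply/negP => /andP[/eqP-> E]; rewrite E in uv.
  case: (boolP ((u, v) \in es)) => [/nsym/negbTE->|_ /= ->]; by rewrite ?addn1 ?addn0 ?add0n ?addn1.
move=> l [sl cl] all_l.
have -> : #|V| = size l.
  case: sl => ul _ _ _; rewrite -(card_uniqP ul); apply: eq_card => v.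
  by rewrite all_l.
by rewrite -cl /= /inside (@eq_count _ _ predT) ?count_predT // => a; rewrite /= !all_l.
Qed.


(** * Half-trees of the emission and reception arcs of a request *)

Definition E_side (r : vseq V) : pred V := side (source r) (second r).
Definition F_side (r : vseq V) : pred V := side (penult r) (target r).

Lemma request_arcs r : request e r ->
  [/\ e (source r) (second r), e (penult r) (target r),
      emission r = Some (source r, second r) &
      reception r = Some (penult r, target r)].
Proof.
case: r => x p /andP[/andP[/= pth _]]; case: p pth => //= y p /andP[exy pth] _.
rewrite /penult /target /reception /=; split=> //.
  case/lastP: p pth => //= q z; rewrite size_rcons rcons_path last_rcons => /andP[_].
  have -> : nth x (verts (x, y :: rcons q z)) (size q).+1 = nth x (rcons (y :: q) z) (size q) by [].
  by rewrite (last_nth x) nth_rcons ltnSn.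
case/lastP: p pth => //= q z _; rewrite size_rcons last_rcons.
rewrite -rcons_cons.
case/lastP: q => [//|q a]; rewrite -rcons_cons last_arc_rcons size_rcons /=.
by rewrite !nth_rcons size_rcons ltnSn ltnn eqxx.
Qed.

Lemma E_target r : request e r -> E_side r (target r).
Proof.
move=> rr; have [exy _ em _] := request_arcs rr.
rewrite /E_side -first_arc_side //; first by rewrite -em.
by case/andP: rr.
Qed.

Lemma F_source r : request e r -> F_side r (source r) = false.
Proof.
move=> rr; have [_ exy _ em] := request_arcs rr.
apply/negbTE; rewrite /F_side -last_arc_side //; first by rewrite -em.
by case/andP: rr.
Qed.

Lemma E_source r : request e r -> E_side r (source r) = false.
Proof. by case/request_arcs => exy _ _ _; apply: side_tail. Qed.

Lemma F_target r : F_side r (target r).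
Proof. exact: side_head. Qed.

(** F_r misses s_r, so it does not contain the emission edge (unless the two edges coincide) and
    stays on one side of it, the side of t_r. *)
Lemma F_sub_E r z : request e r -> F_side r z -> E_side r z.
Proof.
move=> rr Fz; have [es et _ _] := request_arcs rr.
case: (boolP (same_edge (source r) (second r) (penult r) (target r))).
  case/same_edgeP=> -[E1 E2]; move: Fz; rewrite /F_side /E_side E1 E2 //.
  by have := E_source rr; rewrite -E2 E_target.
move=> ne; rewrite /E_side (side_const es et ne (F_source rr) Fz (F_target r)).
exact: E_target.
Qed.

Lemma tree_pathP x y : [/\ dipath e (tree_path e x y),
  source (tree_path e x y) = x & target (tree_path e x y) = y].
Proof.
rewrite /tree_path; case: xgetP => // H.
case/connectP: (e_conn x y) => p0 pth0 ly; case/shortenP: pth0 ly => p pth up _ ly.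
by case: (H (x, p)); split; rewrite /dipath /source /target ?pth ?up.
Qed.

Lemma interferes_onE r r' : request e r -> request e r' ->
  interferes_on e r r' = E_side r (target r') && ~~ F_side r' (source r).
Proof.
move=> rr rr'; have [e1 _ em _] := request_arcs rr; have [_ e2 _ re] := request_arcs rr'.
have [dp sp tp] := tree_pathP (source r) (target r').
rewrite /interferes_on em re (first_arc_side dp sp e1) (last_arc_side dp tp e2).
by rewrite tp sp.
Qed.

Lemma interferes_on_refl r : request e r -> interferes_on e r r.
Proof. by move=> rr; rewrite interferes_onE // E_target // F_source. Qed.

(** Used in contrapositive form: if [r] does not interfere on [r'], some vertex lies in F_r' but not
    in E_r. *)
Lemma interferes_on_witness r r' : request e r -> request e r' ->
  (forall z, F_side r' z -> E_side r z) -> interferes_on e r r'.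
Proof.
move=> rr rr' FE; rewrite interferes_onE // FE ?F_target //=.
by apply/negP => /FE; rewrite E_source.
Qed.

Lemma clique_sides (I : finType) (K : {set I}) (rq : I -> vseq V) :
  (forall i, i \in K -> request e (rq i)) ->
  {in K &, forall i j, interfere e (rq i) (rq j)} ->
  exists x y, forall i, i \in K -> E_side (rq i) x && ~~ F_side (rq i) y.
Proof.
move=> rK iK; case: (set_0Vmem K) => [->|[i0 i0K]].
  by case: tree_e => /card_gt0P[x _] _ _ _ _; exists x, x => i; rewrite inE.
have ar i (Ki : i \in K) := request_arcs (rK i Ki).
have [||x Hx] := @Helly_sides _ K (fun i => source (rq i)) (fun i => second (rq i)) i0 i0K.
- by move=> i /ar[].
- move=> i j Ki Kj; case/orP: (iK _ _ Ki Kj); rewrite interferes_onE ?rK // => /andP[h _].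
    by exists (target (rq j)); rewrite [side _ _ _]h; apply: E_target; apply: rK.
  by exists (target (rq i)); rewrite andbC [side _ _ _]h; apply: E_target; apply: rK.
(* The complement of a half-tree is the half-tree of the reversed arc, so the Helly property also
   applies to the complements of the F_r. *)
have [||y Hy] := @Helly_sides _ K (fun i => target (rq i)) (fun i => penult (rq i)) i0 i0K.
- by move=> i /ar[] _; rewrite e_sym.
- move=> i j Ki Kj; have [_ ei _ _] := ar _ Ki; have [_ ej _ _] := ar _ Kj.
  case/orP: (iK _ _ Ki Kj); rewrite interferes_onE ?rK // => /andP[_ h].
    exists (source (rq i)); rewrite (side_opp _ ei) (side_opp _ ej).
    by apply/andP; split; [rewrite [side _ _ _]F_source ?rK|].
  exists (source (rq j)); rewrite (side_opp _ ei) (side_opp _ ej).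
  by apply/andP; split; [|rewrite [side _ _ _]F_source ?rK].
exists x, y => i Ki; rewrite [E_side _ _]Hx //=.
have [_ ei _ _] := ar _ Ki.
by have := Hy _ Ki; rewrite (side_opp _ ei).
Qed.

(* In a list spread from [y] with [x] on its first path, both the complement of
   [E_side r] and [F_side r] are intervals; they are disjoint, so one of them
   precedes the other, and which one does tells the two classes apart. *)
Lemma two_cliques x y : exists P : pred (vseq V), forall r r',
  request e r -> request e r' -> E_side r x -> E_side r' x ->
  ~~ F_side r y -> ~~ F_side r' y -> P r = P r' -> interfere e r r'.
Proof.
have [l sl all_l] := spread_exists x y.
pose n i := nth y l i; have nE z : exists2 i, i < size l & n i = z.
  by exists (index z l); rewrite ?index_mem // /n nth_index.
pose P1 r := forall i j, i < size l -> j < size l -> ~~ E_side r (n i) -> F_side r (n j) -> i < j.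
pose P2 r := forall i j, i < size l -> j < size l -> ~~ E_side r (n i) -> F_side r (n j) -> j < i.
have P12 r : request e r -> E_side r x -> ~~ F_side r y -> ~ P1 r -> P2 r.
  move=> rr xE yF nP1 i j il jl iE jF; have [es et _ _] := request_arcs rr.
  case: sl => ul xl hl H.
  (* If y itself lies outside E_r, the emission arc separates x from y and its half-trees change
     only once along the list; otherwise two changes are affordable. *)
  have cE a b c : a <= b -> b <= c -> c < size l -> ~~ E_side r (n a) ->
      ~~ E_side r (n c) -> ~~ E_side r (n b).
    rewrite /E_side -!(side_opp _ es); apply: changes_convex; rewrite hl.
    have sE : e (second r) (source r) by rewrite e_sym.
    case: (H _ _ sE) => [cst|[_ _ le2 le1]]; first by rewrite changes_const.
    move: le1; rewrite (side_opp x es) [side _ _ x]xE.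
    by case: (side _ _ y) => // [h]; apply: h.
  have cF a b c : a <= b -> b <= c -> c < size l -> F_side r (n a) ->
      F_side r (n c) -> F_side r (n b).
    apply: changes_convex; rewrite hl (negbTE yF).
    by case: (H _ _ et) => [cst|[]]; first by rewrite changes_const.
  have dis k : ~~ E_side r (n k) -> F_side r (n k) -> False.
    by move=> h /(F_sub_E rr); rewrite (negbTE h).
  (* Pairs in both orders would put a point of one interval between two points of the other, against
     disjointness. *)
  rewrite ltnNge; apply/negP => ij; apply: nP1 => i' j' il' jl' iE' jF'.
  rewrite ltnNge; apply/negP => ji'.
  case: (leqP i' j) => h.
    by apply: (dis i') => //; apply: (cF j' i' j).
  by apply: (dis j) => //; apply: (cE i j i') => //; apply: ltnW.
exists (fun r => `[< P1 r >]) => r r' rr rr' xr xr' yr yr' PP.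
 apply/negPn/negP; rewrite negb_or => /andP[n1 n2].
(* If neither interferes, there are [z1] in F_r' outside E_r and [z2] in F_r outside E_r'. Intervals
   in the same order for [r] and [r'] would put each of [z1], [z2] before the other. *)
have [z1 z1F z1E] : exists2 z, F_side r' z & ~~ E_side r z.
  case: (boolP [exists z, F_side r' z && ~~ E_side r z]) => [/existsP[z /andP[]]|/existsPn no].
    by exists z.
  case/negP: n1; apply: interferes_on_witness => // z Fz.
  by have := no z; rewrite Fz negbK.
have [z2 z2F z2E] : exists2 z, F_side r z & ~~ E_side r' z.
  case: (boolP [exists z, F_side r z && ~~ E_side r' z]) => [/existsP[z /andP[]]|/existsPn no].
    by exists z.
  case/negP: n2; apply: interferes_on_witness => // z Fz.
  by have := no z; rewrite Fz negbK.
have [i il iE] := nE z1; have [j jl jE] := nE z2; subst z1 z2.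
have [p1|np1] := pselect (P1 r).
  have p1' : P1 r' by move: PP; rewrite (asboolT p1) => /esym/asboolP.
  by have := ltn_trans (p1 _ _ il jl z1E z2F) (p1' _ _ jl il z2E z1F); rewrite ltnn.
have p1' : ~ P1 r' by move=> p1'; apply: np1; apply/asboolP; move: PP; rewrite (asboolT p1').
have := ltn_trans (P12 _ rr xr yr np1 _ _ il jl z1E z2F)
  (P12 _ rr' xr' yr' p1' _ _ jl il z2E z1F).
by rewrite ltnn.
Qed.

(** Each request accounts for at most two edges. This bounds the size of the tree, hence [D], in
    terms of the number of requests. *)
Lemma size_edge_list es rs : edge_list e es -> all (request e) rs ->
  every_edge_used e rs -> size es <= (size rs).*2.
Proof.
case=> eE ues nsym /allP arq used.
pose orient a b := if (a, b) \in es then (a, b) else (b, a).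
pose arcs := [seq orient (source r) (second r) | r <- rs] ++
  [seq orient (penult r) (target r) | r <- rs].
have -> : (size rs).*2 = size arcs by rewrite size_cat !size_map addnn.
apply: uniq_leq_size ues _ => -[a b] ab.
have oab : orient a b = (a, b) by rewrite /orient ab.
have oba : orient b a = (a, b) by rewrite /orient (negbTE (nsym _ _ ab)).
have eab : e a b by rewrite eE ab.
have [r rrs] := used _ _ eab; have [_ _ em re] := request_arcs (arq _ rrs).
rewrite mem_cat; case; rewrite ?em ?re => -[E1 E2]; apply/orP; [left|left|right|right];
  apply/mapP; exists r => //; by rewrite E1 E2 ?oab ?oba.
Qed.
End HalfTrees.

(** * Bounded-loop programs *)

(* A small language of bounded loops over variables and square tables, all of
   whose values are smaller than a modulus [D]. *)
Inductive hexpr :=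
| HC of nat
| HV of nat
| HT of nat & hexpr & hexpr
| HB of binop & hexpr & hexpr.

Inductive hcmd :=
| HSkip
| HSet of nat & hexpr
| HPut of nat & hexpr & hexpr & hexpr
| HSeq of hcmd & hcmd
| HIf of hexpr & hcmd & hcmd
| HFor of nat & nat & hcmd.

Record hstate := HState { hvar : nat -> nat; htab : nat -> nat -> nat -> nat }.

(** The modulus [D] replaces [2 ^ w], which makes the meaning of a program independent of the word
    length. *)
Definition hop (D : nat) (o : binop) (a b : nat) : nat :=
  match o with
  | Add => (a + b) %% D
  | Sub => a - b
  | Mul => (a * b) %% D
  | Div => a %/ b
  | Lt => a < b
  | Eq => a == b
  end.

Fixpoint heval (D : nat) (h : hstate) (x : hexpr) : nat :=
  match x with
  | HC c => c
  | HV v => hvar h v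
  | HT q i j => htab h q (heval D h i) (heval D h j)
  | HB o a b => hop D o (heval D h a) (heval D h b)
  end.

Definition setv (h : hstate) (x a : nat) : hstate :=
  HState (update (hvar h) x a) (htab h).

Definition put (h : hstate) (q i j a : nat) : hstate :=
  HState (hvar h) (fun q' => if q' == q then
    fun i' j' => if (i' == i) && (j' == j) then a else htab h q i' j'
    else htab h q').

Fixpoint run (D : nat) (c : hcmd) (h : hstate) : hstate :=
  match c with
  | HSkip => h
  | HSet x e => setv h x (heval D h e)
  | HPut q i j e => put h q (heval D h i) (heval D h j) (heval D h e)
  | HSeq c1 c2 => run D c2 (run D c1 h)
  | HIf e c1 c2 => if heval D h e != 0 then run D c1 h else run D c2 h
  | HFor x b c =>
      iter (hvar h b) (fun h1 => let h2 := run D c h1 in setv h2 x (hvar h2 x).+1)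
        (setv h x 0)
  end.

Fixpoint assigned (c : hcmd) : seq nat :=
  match c with
  | HSet x _ => [:: x]
  | HSeq c1 c2 | HIf _ c1 c2 => assigned c1 ++ assigned c2
  | HFor x _ c => x :: assigned c
  | _ => [::]
  end.

Fixpoint written (c : hcmd) : seq nat :=
  match c with
  | HPut q _ _ _ => [:: q]
  | HSeq c1 c2 | HIf _ c1 c2 => written c1 ++ written c2
  | HFor _ _ c => written c
  | _ => [::]
  end.

Definition nb_tables := 20.

(** Constants below 3 are values for every modulus [D] of at least 3. *)
Fixpoint wf_expr (x : hexpr) : bool :=
  match x with
  | HC c => c < 3
  | HV _ => true
  | HT q i j => [&& q < nb_tables, wf_expr i & wf_expr j]
  | HB _ a b => wf_expr a && wf_expr b
  end.

(** The body of a loop may assign neither the counter nor the bound, so the compiled [While], which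
    rereads both at each turn, makes as many turns as the bound had on entry. *)
Fixpoint wf (c : hcmd) : bool :=
  match c with
  | HSkip => true
  | HSet _ e => wf_expr e
  | HPut q i j e => [&& q < nb_tables, wf_expr i, wf_expr j & wf_expr e]
  | HSeq c1 c2 => wf c1 && wf c2
  | HIf e c1 c2 => [&& wf_expr e, wf c1 & wf c2]
  | HFor x b c => [&& x \notin assigned c, b \notin x :: assigned c & wf c]
  end.

Lemma run_var D c h x : x \notin assigned c -> hvar (run D c h) x = hvar h x.
Proof.
elim: c h => [|y e|q i j e|c1 IH1 c2 IH2|e c1 IH1 c2 IH2|y b c IH] h //=.
- by rewrite inE /update => /negbTE ->.
- by rewrite mem_cat negb_or => /andP[n1 n2]; rewrite IH2 ?IH1.
- by rewrite mem_cat negb_or => /andP[n1 n2]; case: ifP => _; rewrite ?IH2 ?IH1.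
rewrite inE negb_or => /andP[/negbTE ny nc].
have : hvar (setv h y 0) x = hvar h x by rewrite /= /update ny.
by elim: (hvar h b) (setv h y 0) => //= k IHk h1 E; rewrite /update ny IH // IHk.
Qed.

Lemma run_tab D c h q : q \notin written c -> htab (run D c h) q = htab h q.
Proof.
elim: c h => [|y e|p i j e|c1 IH1 c2 IH2|e c1 IH1 c2 IH2|y b c IH] h //=.
- by rewrite inE => /negbTE ->.
- by rewrite mem_cat negb_or => /andP[n1 n2]; rewrite IH2 ?IH1.
- by rewrite mem_cat negb_or => /andP[n1 n2]; case: ifP => _; rewrite ?IH2 ?IH1.
move=> nc; have : htab (setv h y 0) q = htab h q by [].
by elim: (hvar h b) (setv h y 0) => //= k IHk h1 E; rewrite IH // IHk.
Qed.

Definition frame (c : hcmd) (h h' : hstate) : Prop :=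
  (forall x, x \notin assigned c -> hvar h' x = hvar h x) /\
  (forall q, q \notin written c -> htab h' q = htab h q).

Lemma run_frame D c h : frame c h (run D c h).
Proof. by split=> [x|q]; [apply: run_var|apply: run_tab]. Qed.

(** The frame handed to each turn spares the invariant from mentioning anything that the loop leaves
    alone. *)
Lemma for_ind D (P : nat -> hstate -> Prop) x b c h N :
  x \notin assigned c -> hvar h b = N -> P 0 (setv h x 0) ->
  (forall i h1, i < N -> hvar h1 x = i -> frame (HFor x b c) h h1 -> P i h1 ->
     P i.+1 (setv (run D c h1) x i.+1)) ->
  P N (run D (HFor x b c) h).
Proof.
move=> xc <- P0 PS /=.
suff H k : k <= hvar h b -> let h' := iter k (fun h1 => let h2 := run D c h1 in
    setv h2 x (hvar h2 x).+1) (setv h x 0) in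
    [/\ P k h', hvar h' x = k & frame (HFor x b c) h h'].
  by case: (H _ (leqnn _)).
elim: k => [|k IH] lek /=.
  split=> //; first by rewrite /update eqxx.
  by split=> //= y; rewrite inE negb_or /update => /andP[/negbTE->].
have [Pk xk [fv ft]] := IH (ltnW lek).
rewrite /update eqxx run_var // xk; split=> //; first exact: PS.
split=> [y|q] nc /=; last by rewrite run_tab // ft.
have := nc; rewrite /= inE negb_or /update => /andP[/negbTE-> yc].
by rewrite run_var // fv.
Qed.

(** * Compilation to the word machine *)

Section Compilation.
Variables (D w : nat).
Hypotheses (D_ge3 : 3 <= D) (D_small : nb_tables * D * D <= 2 ^ w).

Let D_gt0 : 0 < D. Proof. by apply: leq_trans D_ge3. Qed.

(* Variable [x] lives in register [x.+1], register 0 holds [D], and table [q] has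
   its entry [(i, j)] at address [(q * D + i) * D + j]. *)
Definition mod_expr (x : expr) : expr :=
  Bin Sub x (Bin Mul (Bin Div x (Reg 0)) (Reg 0)).

Definition addr_expr (q : nat) (i j : expr) : expr :=
  Bin Add (Bin Mul (Bin Add (Bin Mul (Cst q) (Reg 0)) i) (Reg 0)) j.

(** [mod_expr] evaluates its operand twice; for a fixed program this affects only the constant
    factor. *)
Fixpoint compile_expr (x : hexpr) : expr :=
  match x with
  | HC c => Cst c
  | HV v => Reg v.+1
  | HT q i j => Read (addr_expr q (compile_expr i) (compile_expr j))
  | HB o a b =>
      let x := Bin o (compile_expr a) (compile_expr b) in
      if o is (Add | Mul) then mod_expr x else x
  end.

Fixpoint compile (c : hcmd) : cmd :=
  match c with
  | HSkip => Skip
  | HSet x e => Assign x.+1 (compile_expr e)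
  | HPut q i j e =>
      Write (addr_expr q (compile_expr i) (compile_expr j)) (compile_expr e)
  | HSeq c1 c2 => Seq (compile c1) (compile c2)
  | HIf e c1 c2 => If (compile_expr e) (compile c1) (compile c2)
  | HFor x b c =>
      Seq (Assign x.+1 (Cst 0))
        (While (Bin Lt (Reg x.+1) (Reg b.+1))
          (Seq (compile c) (Assign x.+1 (Bin Add (Reg x.+1) (Cst 1)))))
  end.

Fixpoint depth (c : hcmd) : nat :=
  match c with
  | HSeq c1 c2 | HIf _ c1 c2 => maxn (depth c1) (depth c2)
  | HFor _ _ c => (depth c).+1
  | _ => 0
  end.

(** The coefficient of [D ^ depth c] in the time bound, not a running time. A loop multiplies the
    power by [D]; its own overhead is at most 10 D + 7, which the 20 covers. *)
Fixpoint cost (c : hcmd) : nat :=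
  match c with
  | HSkip => 1
  | HSet _ e => (expr_cost (compile_expr e)).+1
  | HPut q i j e => (expr_cost (addr_expr q (compile_expr i) (compile_expr j)) +
      expr_cost (compile_expr e)).+1
  | HSeq c1 c2 => (cost c1 + cost c2).+1
  | HIf e c1 c2 => (expr_cost (compile_expr e) + (cost c1 + cost c2)).+1
  | HFor _ _ c => cost c + 20
  end.

Definition rep (s : state) (h : hstate) : Prop :=
  [/\ regs s 0 = D, forall x, regs s x.+1 = hvar h x,
      forall q i j, q < nb_tables -> i < D -> j < D ->
        mem s ((q * D + i) * D + j) = htab h q i j,
      forall x, hvar h x < D
    & forall q i j, htab h q i j < D].

Lemma heval_lt h x : (forall v, hvar h v < D) -> (forall q i j, htab h q i j < D) ->
  wf_expr x -> heval D h x < D.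
Proof.
move=> hvD htD; elim: x => [c|v|q i IHi j IHj|o a IHa b IHb] //=.
  by move=> c3; apply: leq_trans D_ge3.
case/andP=> /IHa{}IHa /IHb{}IHb; case: o => /=; rewrite ?ltn_mod //.
- by apply: leq_ltn_trans IHa; rewrite leq_subr.
- by apply: leq_ltn_trans IHa; rewrite leq_div.
- exact: leq_ltn_trans (leq_b1 _) (ltnW D_ge3).
- exact: leq_ltn_trans (leq_b1 _) (ltnW D_ge3).
Qed.

Let addr_lt q i j : q < nb_tables -> i < D -> j < D ->
  (q * D + i) * D + j < 2 ^ w.
Proof.
move=> qQ iD jD; apply: leq_trans D_small.
apply: (@leq_trans ((q * D + i).+1 * D)); first by rewrite mulSn addnC ltn_add2r.
rewrite leq_mul2r; apply/orP; right.
by apply: (@leq_trans (q.+1 * D)); rewrite ?leq_mul2r ?qQ ?orbT // mulSn addnC ltn_add2r.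
Qed.

Let D_lt : D < 2 ^ w.
Proof.
have -> : D = (0 * D + 1) * D + 0 by rewrite mul0n add0n mul1n addn0.
by apply: addr_lt => //; apply: leq_trans D_ge3.
Qed.

Lemma eval_mod_expr s x : regs s 0 = D -> expr_eval w s x < 2 ^ w ->
  expr_eval w s (mod_expr x) = expr_eval w s x %% D.
Proof.
move=> sD lt; rewrite /= sD modn_small; last by apply: leq_ltn_trans lt; rewrite leq_divM.
by rewrite {1}(divn_eq (expr_eval w s x) D) addKn.
Qed.

Lemma eval_addr_expr s q x y i j : regs s 0 = D -> q < nb_tables ->
  expr_eval w s x = i -> expr_eval w s y = j -> i < D -> j < D ->
  expr_eval w s (addr_expr q x y) = (q * D + i) * D + j.
Proof.
move=> sD qQ ex ey iD jD; have lt := addr_lt qQ iD jD.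
have lt1 : (q * D + i) * D < 2 ^ w by apply: leq_ltn_trans lt; rewrite leq_addr.
have lt2 : q * D + i < 2 ^ w.
  by apply: leq_ltn_trans lt1; rewrite -{1}[_ + i]muln1 leq_mul2l D_gt0 orbT.
have lt3 : q * D < 2 ^ w by apply: leq_ltn_trans lt2; rewrite leq_addr.
have lt4 : q < 2 ^ w by apply: leq_ltn_trans lt3; rewrite -{1}[q]muln1 leq_mul2l D_gt0 orbT.
by rewrite /= sD ex ey (modn_small lt4) (modn_small lt3) (modn_small lt2)
  (modn_small lt1) (modn_small lt).
Qed.

Lemma compile_exprP s h x : rep s h -> wf_expr x ->
  expr_eval w s (compile_expr x) = heval D h x.
Proof.
(* Sums and products of two values below [D] do not overflow a word before they are reduced: 2 D and
   D * D are themselves addresses of table entries. *)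
move=> [sD sv st hvD htD]; have D2 : D + D < 2 ^ w /\ D * D < 2 ^ w.
  split.
    have -> : D + D = (0 * D + 2) * D + 0 by rewrite addn0 add0n mul2n addnn.
    by apply: addr_lt => //; apply: leq_trans D_ge3.
  have -> : D * D = (1 * D + 0) * D + 0 by rewrite mul1n !addn0.
  by apply: addr_lt.
elim: x => [c|v|q i IHi j IHj|o a IHa b IHb] /=.
- by move=> c3; rewrite modn_small //; apply: leq_trans (ltnW D_lt); apply: leq_trans D_ge3.
- by rewrite sv.
- case/and3P=> qQ wi wj; have iD := heval_lt hvD htD wi; have jD := heval_lt hvD htD wj.
  by rewrite -st // -(eval_addr_expr sD qQ (IHi wi) (IHj wj)).
case/andP=> wa wb; have aD := heval_lt hvD htD wa; have bD := heval_lt hvD htD wb.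
have pw : 0 < 2 ^ w by rewrite expn_gt0.
case: o; rewrite ?eval_mod_expr //= ?ltn_mod // IHa // IHb //.
  by rewrite (@modn_small _ (2 ^ w)) //; apply: ltn_trans D2.1; lia.
rewrite (@modn_small _ (2 ^ w)) //; apply: leq_ltn_trans D2.2.
by apply: leq_mul; apply: ltnW.
Qed.

Lemma addr_inj q i j q' i' j' : i < D -> j < D -> i' < D -> j' < D ->
  (q * D + i) * D + j = (q' * D + i') * D + j' -> [/\ q = q', i = i' & j = j'].
Proof.
move=> iD jD iD' jD' E.
have Ej : j = j' by move: (congr1 (modn^~ D) E); rewrite !modnMDl !modn_small.
have E1 : q * D + i = q' * D + i'.
  by move: (congr1 (divn^~ D) E); rewrite !divnMDl // !divn_small // !addn0.
have Ei : i = i' by move: (congr1 (modn^~ D) E1); rewrite !modnMDl !modn_small.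
by split=> //; move: (congr1 (divn^~ D) E1); rewrite !divnMDl // !divn_small // !addn0.
Qed.

Lemma rep_setv s h x a : rep s h -> a < D ->
  rep (State (update (regs s) x.+1 a) (mem s)) (setv h x a).
Proof.
move=> [sD sv st hvD htD] aD; split=> //= y; rewrite /update ?eqSS;
  by case: ifP.
Qed.

Lemma rep_put s h q i j a : rep s h -> q < nb_tables -> i < D -> j < D -> a < D ->
  rep (State (regs s) (update (mem s) ((q * D + i) * D + j) a)) (put h q i j a).
Proof.
move=> [sD sv st hvD htD] qQ iD jD aD; split=> //=; last first.
  by move=> q' i' j'; case: ifP => // _; case: ifP.
move=> q' i' j' qQ' iD' jD'; rewrite /update.
case: (eqVneq q' q) => [->|nq]; last first.
  by case: eqP => [/addr_inj[]// /eqP|_]; [rewrite (negbTE nq)|exact: st].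
case: eqP => [/addr_inj[]// _ -> ->|ne]; first by rewrite !eqxx.
case: ifP => [/andP[/eqP Ei /eqP Ej]|_]; first by rewrite Ei Ej in ne.
exact: st.
Qed.

Lemma compileP c s h : wf c -> rep s h ->
  exists t s', [/\ exec w (compile c) s t s', t <= cost c * D ^ depth c
    & rep s' (run D c h)].
Proof.
have Dpow d : 0 < D ^ d by rewrite expn_gt0 D_gt0.
have le_pow d d' k k' : d <= d' -> k <= k' -> k * D ^ d <= k' * D ^ d'.
  by move=> dd kk; apply: leq_mul => //; rewrite leq_pexp2l.
elim: c s h => [|x e|q i j e|c1 IH1 c2 IH2|e c1 IH1 c2 IH2|x b c IH] s h /=.
- by move=> _ rs; exists 1, s; split=> //; constructor.
- move=> we rs; have [sD sv st hvD htD] := rs; do 2!eexists; split; first by constructor.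
    by rewrite expn0 muln1.
  rewrite (compile_exprP rs we); apply: rep_setv => //; exact: heval_lt.
- case/and4P=> qQ wi wj we rs; have [sD sv st hvD htD] := rs.
  do 2!eexists; split; first by constructor.
    by rewrite expn0 muln1.
  rewrite (compile_exprP rs we) (eval_addr_expr sD qQ (compile_exprP rs wi) (compile_exprP rs wj)).
  - by apply: rep_put => //; exact: heval_lt.
  - exact: heval_lt.
  - exact: heval_lt.
- case/andP=> w1 w2 rs; have [t1 [s1 [e1 le1 rs1]]] := IH1 _ _ w1 rs.
  have [t2 [s2 [e2 le2 rs2]]] := IH2 _ _ w2 rs1.
  exists (t1 + t2).+1, s2; split=> //; first exact: ExecSeq e1 e2.
  rewrite mulSn mulnDl -addn1 addnC leq_add ?Dpow // leq_add //.
    by apply: leq_trans le1 _; apply: le_pow; rewrite ?leq_maxl.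
  by apply: leq_trans le2 _; apply: le_pow; rewrite ?leq_maxr.
- case/and3P=> we w1 w2 rs; have E := compile_exprP rs we.
  have [t [s' [ex le rs']]] : exists t s', [/\
      exec w (if heval D h e != 0 then compile c1 else compile c2) s t s',
      t <= (cost c1 + cost c2) * D ^ maxn (depth c1) (depth c2)
      & rep s' (if heval D h e != 0 then run D c1 h else run D c2 h)].
    case: ifP => _; [have := IH1 _ _ w1 rs|have := IH2 _ _ w2 rs];
      move=> [t [s' [ex le rs']]]; exists t, s'; split=> //; apply: leq_trans le _;
      by apply: le_pow; rewrite ?leq_maxl ?leq_maxr ?leq_addr ?leq_addl.
  exists (expr_cost (compile_expr e) + t).+1, s'; split=> //.
    by constructor; rewrite E.
  rewrite mulSn mulnDl -addn1 addnC leq_add ?Dpow // leq_add //.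
  by rewrite -{1}[expr_cost _]muln1 leq_mul.
case/and3P=> xc; rewrite inE negb_or => /andP[bx bc] wc rs.
pose body := fun h1 => let h2 := run D c h1 in setv h2 x (hvar h2 x).+1.
pose A := cost c * D ^ depth c + 10.
have loop k : forall s1 h1, rep s1 h1 -> hvar h1 b = hvar h1 x + k ->
    exists t s', [/\ exec w (While (Bin Lt (Reg x.+1) (Reg b.+1))
      (Seq (compile c) (Assign x.+1 (Bin Add (Reg x.+1) (Cst 1))))) s1 t s',
      t <= k * A + 4 & rep s' (iter k body h1)].
  elim: k => [|k IHk] s1 h1 rs1 hb.
    have [sD sv st hvD htD] := rs1.
    exists 4, s1; split=> //; apply: ExecWhileStop => /=.
    by rewrite !sv hb addn0 ltnn.
  have [sD sv st hvD htD] := rs1.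
  have [t1 [s2 [e1 le1 rs2]]] := IH _ _ wc rs1; have [sD2 sv2 st2 hvD2 htD2] := rs2.
  (* After the increment the counter is at most the loop bound, a value below [D], so the increment
     does not wrap around. *)
  have xD : (hvar (run D c h1) x).+1 < D.
    rewrite run_var //; apply: leq_ltn_trans (hvD b).
    by rewrite hb addnS ltnS leq_addr.
  have := rep_setv x rs2 xD; set s3 := State _ _ => rs3.
  have [|t2 [s4 [e2 le2 rs4]]] := IHk _ _ rs3.
    by rewrite /= /update eqxx (negbTE bx) !run_var // hb addSnnS.
  exists (3 + (t1 + 4).+1 + t2).+1, s4; rewrite iterSr; split=> //.
    apply: (ExecWhileStep (s2 := s3)) => //=.
      by rewrite !sv hb -ltn_psubLR ?subnn ?addnS ?ltnS ?leq_addr.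
    apply: ExecSeq; first exact: e1.
    have -> : s3 = State (update (regs s2) x.+1 (expr_eval w s2 (Bin Add (Reg x.+1) (Cst 1)))) (mem s2).
      rewrite /s3 /= sv2 (@modn_small 1) ?(@modn_small (_ + 1)) ?addn1 //.
        exact: ltn_trans xD D_lt.
      by apply: leq_ltn_trans D_lt.
    exact: (ExecAssign w x.+1 (Bin Add (Reg x.+1) (Cst 1)) s2).
  rewrite mulSn; move: le1 le2; rewrite {2}/A; move: (k * A) (cost c * _) => a1 a2; lia.
have rs0 := rep_setv x rs D_gt0; have [|t [s' [ex le rs']]] := loop (hvar h b) _ _ rs0.
  by rewrite /= /update eqxx (negbTE bx).
exists (2 + t).+1, s'; split=> //.
  apply: ExecSeq; last exact: ex.
  by have := ExecAssign w x.+1 (Cst 0) s; rewrite /= mod0n.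
have [sD sv st hvD htD] := rs.
have := hvD b; move: (hvar h b) le => N le ND.
apply: (@leq_trans (D * A + 7)).
  apply: leq_trans (_ : _ <= N * A + 7) _; first by lia.
  by rewrite leq_add2r leq_mul2r (ltnW ND) orbT.
rewrite expnS mulnCA mulnDl mulnDr /A mulnDr -addnA leq_add2l.
apply: (@leq_trans (D * 20)); first by move: D_ge3; lia.
by rewrite leq_mul2l -{1}[20]muln1 leq_mul2l Dpow !orbT.
Qed.

End Compilation.

(** * Matchings in the bipartite double cover *)

Section Matching.
Variables (m : nat) (g : rel nat).
Implicit Types (A : pred nat) (mr mc q vis par : nat -> nat).

Definition card_lt (P : pred nat) : nat := \sum_(i < m) P i.

Lemma sum_pred1S (P : pred nat) x :
  \sum_(c < m) ((x == c.+1) && P c : nat) = if x is c.+1 then (c < m) && P c else 0.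
Proof.
case: x => [|x]; first by rewrite big1.
case: (ltnP x m) => xm.
  rewrite (bigD1 (Ordinal xm)) //= eqxx big1 ?addn0 // => i.
  by rewrite -val_eqE /= eq_sym eqSS => /negbTE ->.
by rewrite big1 // => i _; rewrite eqSS gtn_eqF ?(leq_trans _ xm).
Qed.

(* Rows and columns are numbered from 0; a row [r] is matched with column [c] when
   [mr r = c.+1] and [mc c = r.+1], and the value 0 means unmatched. *)
Definition matching A mr mc : Prop :=
  [/\ forall r c, r < m -> c < m -> (mr r == c.+1) = (mc c == r.+1),
      forall r, r < m -> mr r = 0 \/
        exists c, [/\ c < m, mr r = c.+1, A r, A c & g r c]
    & forall c, c < m -> mc c = 0 \/ exists2 r, r < m & mc c = r.+1].

Definition matched mr : nat := card_lt (fun r => mr r != 0).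

(** A vertex of [A] outside [B] destroys at most two matched pairs, one as a row and one as a
    column. *)
Lemma matched_restrict A B mr mc : matching A mr mc ->
  matched mr <= card_lt (fun r => [&& mr r != 0, B r & B (mr r).-1])
    + (card_lt (fun r => A r && ~~ B r)).*2.
Proof.
case=> sym mrA _.
rewrite -addnn {2}/card_lt; have -> : \sum_(i < m) (A i && ~~ B i : nat) =
    card_lt (fun r => A r && ~~ B r) by [].
have le : \sum_(r < m) \sum_(c < m) ((mr r == c.+1) && (A c && ~~ B c) : nat) <=
    card_lt (fun r => A r && ~~ B r).
  rewrite exchange_big /=; apply: leq_sum => c _.
  rewrite (eq_bigr (fun r : 'I_m => (mc c == r.+1) && (A c && ~~ B c) : nat)).
    rewrite (sum_pred1S (fun=> A c && ~~ B c)); case: (mc c) => // r.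
    by case: (r < m).
  by move=> r _; rewrite sym.
apply: leq_trans (leq_add (leqnn _) (leq_add (leqnn _) le)).
rewrite /matched /card_lt -!big_split /=; apply: leq_sum => r _.
rewrite (sum_pred1S (fun c => A c && ~~ B c)).
case: (mrA r (ltn_ord r)) => [->|[c [cm -> Ar Ac gc]]] //=.
by rewrite cm Ar Ac /=; case: (B r); case: (B c).
Qed.

Definition independent (K : {set 'I_m}) := {in K &, forall r c : 'I_m, ~~ g r c}.

(** Weak duality: restricting the matching to an independent set leaves no pair, and each vertex
    given up accounts for at most two. *)
Lemma independent_matched A mr mc (K : {set 'I_m}) : matching A mr mc ->
  independent K -> {in K, forall r : 'I_m, A r} -> (#|K|).*2 + matched mr <= (card_lt A).*2.
Proof.
move=> mm iK KA; pose B r := [exists k in K, val k == r].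
have BE (k : 'I_m) : B k = (k \in K).
  by apply/existsP/idP => [[k' /andP[Kk /eqP/val_inj<-]]//|Kk]; exists k; rewrite Kk /=.
have := matched_restrict B mm.
have -> : card_lt (fun r => [&& mr r != 0, B r & B (mr r).-1]) = 0.
  rewrite /card_lt big1 // => r _; case: mm => _ /(_ _ (ltn_ord r))[->//|].
  case=> c [cm -> _ _ grc] _ /=; rewrite -[c]/(val (Ordinal cm)) !BE.
  case: (boolP (r \in K)) => //= rK; case: (boolP (_ \in K)) => //= cK.
  by have := iK _ _ rK cK; rewrite grc.
have -> : card_lt A = #|K| + card_lt (fun r => A r && ~~ B r).
  rewrite /card_lt -sum1_card [in RHS]big_mkcond -big_split /=; apply: eq_bigr => r _.
  rewrite BE; case: (boolP (r \in K)) => [/KA->//|_]; by rewrite andbT.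
rewrite add0n doubleD; lia.
Qed.

Definition in_queue q qt r := [exists k : 'I_qt, q k == r].

Lemma in_queueP q qt r : reflect (exists2 k, k < qt & q k = r) (in_queue q qt r).
Proof.
apply: (iffP existsP) => [[k /eqP<-]|[k kq <-]]; first by exists k.
by exists (Ordinal kq).
Qed.

(* The alternating search from the unmatched rows: the rows reached so far are
   [q 0, ..., q qt.-1], [vis] marks the columns reached, [par c] is the index in
   [q] of the row from which column [c] was reached, and [fr] is an unmatched
   column reached (plus one). The first [kk] rows of the queue have been
   processed, and so have the first [cc] columns for row [q kk]. *)
Record search A mr mc q vis par qt fr kk cc : Prop := Search {
  queue_inj : forall i j, i < qt -> j < qt -> q i = q j -> i = j;
  queue_in : forall i, i < qt -> q i < m /\ A (q i);
  vis_par : forall c, c < m -> vis c != 0 -> [/\ A c, par c < qt & g (q (par c)) c];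
  queue_mr : forall i, i < qt -> mr (q i) = 0 \/
    exists c, [/\ c < m, mr (q i) = c.+1, vis c != 0 & par c < i];
  vis_mc : forall c, c < m -> vis c != 0 -> (mc c = 0 /\ fr != 0) \/
    exists2 i, i < qt & mc c = (q i).+1;
  found : fr = 0 \/ exists c, [/\ c < m, fr = c.+1, vis c != 0 & mc c = 0];
  free_queue : forall r, r < m -> A r -> mr r = 0 -> in_queue q qt r;
  closed : forall i c, i < qt -> c < m -> A c -> g (q i) c ->
    i < kk \/ (i = kk /\ c < cc) -> vis c != 0
}.

Lemma queue_size A mr mc q vis par qt fr kk cc :
  search A mr mc q vis par qt fr kk cc -> qt <= m.
Proof.
move=> s; have qm (i : 'I_qt) : q i < m by case: (queue_in s (ltn_ord i)).
have /leq_card : injective (fun i : 'I_qt => Ordinal (qm i)).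
  by move=> i j [/(queue_inj s)E]; apply: val_inj; apply: E.
by rewrite !card_ord.
Qed.

Lemma search_init A mr mc q qt vis par :
  (forall i j, i < qt -> j < qt -> q i = q j -> i = j) ->
  (forall i, i < qt -> [/\ q i < m, A (q i) & mr (q i) = 0]) ->
  (forall r, r < m -> A r -> mr r = 0 -> in_queue q qt r) ->
  (forall c, c < m -> vis c = 0) ->
  search A mr mc q vis par qt 0 0 0.
Proof.
move=> qi qA fr v0; split=> //; try by move=> c cm; rewrite v0.
- by move=> i /qA[].
- by move=> i /qA[]; left.
- by left.
- by move=> i c _ _ _ _ [|[_]].
Qed.

Lemma search_next_row A mr mc q vis par qt fr kk cc :
  search A mr mc q vis par qt fr kk cc -> qt <= kk \/ m <= cc ->
  search A mr mc q vis par qt fr kk.+1 0.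
Proof.
case=> s1 s2 s3 s4 s5 s6 s7 s8 h; split=> // i c iq cm Ac gc; rewrite ltn0 => -[|[]//].
rewrite ltnS leq_eqVlt => /orP[/eqP E|ik]; last exact: (s8 i c iq cm Ac gc (or_introl ik)).
apply: (s8 i c iq cm Ac gc); right; split=> //.
by case: h => [|/(leq_trans cm)//]; rewrite leqNgt -E iq.
Qed.

Lemma search_skip A mr mc q vis par qt fr kk cc :
  search A mr mc q vis par qt fr kk cc ->
  ~~ [&& A cc, g (q kk) cc & vis cc == 0] ->
  search A mr mc q vis par qt fr kk cc.+1.
Proof.
case=> s1 s2 s3 s4 s5 s6 s7 s8 h; split=> // i c iq cm Ac gc.
case=> [ik|[ik]]; first exact: (s8 i c iq cm Ac gc (or_introl ik)).
rewrite ltnS leq_eqVlt => /orP[/eqP E|ck].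
2: by apply: (s8 i c iq cm Ac gc); right.
by move: h; rewrite -ik -E Ac gc.
Qed.

Let visit_closed A q vis qt kk cc c :
  (forall i c, i < qt -> c < m -> A c -> g (q i) c ->
    i < kk \/ (i = kk /\ c < cc) -> vis c != 0) ->
  forall i, i < qt -> c < m -> A c -> g (q i) c ->
    i < kk \/ (i = kk /\ c < cc.+1) -> update vis cc 1 c != 0.
Proof.
move=> s8 i iq cm Ac gc h; rewrite /update; case: (eqVneq c cc) => // ne.
apply: (s8 i c iq cm Ac gc); case: h => [|[E]]; first by left.
by rewrite ltnS leq_eqVlt (negbTE ne) /=; right.
Qed.

Lemma search_found A mr mc q vis par qt fr kk cc :
  search A mr mc q vis par qt fr kk cc -> kk < qt -> cc < m ->
  A cc -> g (q kk) cc -> vis cc = 0 -> mc cc = 0 ->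
  search A mr mc q (update vis cc 1) (update par cc kk) qt cc.+1 kk cc.+1.
Proof.
case=> s1 s2 s3 s4 s5 s6 s7 s8 kq cm Acc gcc v0 mc0; split=> //.
- move=> c cm'; rewrite /update; case: (eqVneq c cc) => [-> _|_]; last exact: s3.
  by split.
- move=> i iq; case: (s4 _ iq) => [|[c [cm' E vc pc]]]; first by left.
  right; exists c; rewrite /update; case: (eqVneq c cc) => [E'|_] //.
  by rewrite E' v0 in vc.
- move=> c cm'; rewrite {1}/update; case: (eqVneq c cc) => [-> _|_ /(s5 c cm')]; first by left.
  by case=> [[]|]; [left|right].
- by right; exists cc; rewrite /update eqxx.
- by move=> i c iq cm' Ac gc; apply: visit_closed iq cm' Ac gc.
Qed.

Lemma search_push A mr mc q vis par qt fr kk cc r : matching A mr mc ->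
  search A mr mc q vis par qt fr kk cc -> kk < qt -> cc < m ->
  A cc -> g (q kk) cc -> vis cc = 0 -> mc cc = r.+1 ->
  search A mr mc (update q qt r) (update vis cc 1) (update par cc kk) qt.+1 fr kk cc.+1.
Proof.
move=> [sym mrA mcm] [s1 s2 s3 s4 s5 s6 s7 s8] kq cm Acc gcc v0 mcr.
have rm : r < m by case: (mcm _ cm) => [|[r' r'm]]; rewrite mcr // => -[->].
have mrr : mr r = cc.+1 by apply/eqP; rewrite sym // mcr.
have Ar : A r by case: (mrA _ rm) => [|[c []]]; rewrite mrr.
(* A matched row enters the queue only after its column has been reached, and [cc] had not been. *)
have nq i : i < qt -> q i != r.
  move=> iq; apply/eqP => E; case: (s4 _ iq) => [|[c [_]]]; rewrite E mrr // => -[<-].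
  by rewrite v0.
have qE i : i < qt -> update q qt r i = q i by rewrite /update => /ltn_eqF ->.
have qT : update q qt r qt = r by rewrite /update eqxx.
have case_q i : i < qt.+1 -> i = qt \/ i < qt.
  by rewrite ltnS leq_eqVlt => /orP[/eqP|]; [left|right].
have old c : vis c != 0 -> update vis cc 1 c != 0 /\ update par cc kk c = par c.
  by rewrite /update; case: (eqVneq c cc) => [->|//]; rewrite v0.
split.
- move=> i j /case_q[->|iq] /case_q[->|jq] //; rewrite ?qT ?qE //.
  + by move/esym/eqP; rewrite (negbTE (nq _ jq)).
  + by move/eqP; rewrite (negbTE (nq _ iq)).
  exact: s1.
- by move=> i /case_q[->|iq]; rewrite ?qT ?qE //; exact: s2.
- move=> c cm'; rewrite /update; case: (eqVneq c cc) => [->|_].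
    by move=> _; rewrite ltn_eqF // ltnS (ltnW kq).
  move=> vc; have [? pq ?] := s3 _ cm' vc; rewrite ltn_eqF //; split=> //; exact: ltnW.
- move=> i /case_q[->|iq]; rewrite ?qT ?qE //.
    by right; exists cc; rewrite /update eqxx.
  case: (s4 _ iq) => [|[c [cm' E vc pc]]]; [by left|right; exists c].
  by have [-> ->] := old _ vc.
- move=> c cm'; rewrite {1}/update; case: (eqVneq c cc) => [-> _|_ /(s5 c cm')].
    by right; exists qt; rewrite ?qT.
  by case=> [|[i iq ->]]; [left|right; exists i; rewrite ?qE // ltnS ltnW].
- case: s6 => [|[c [cm' E vc mc0]]]; [by left|right; exists c].
  by have [-> _] := old _ vc.
- move=> r' rm' Ar' mr0; have /in_queueP[i iq E] := s7 _ rm' Ar' mr0.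
  by apply/in_queueP; exists i; rewrite ?qE // ltnS ltnW.
move=> i c /case_q[->|iq] cm' Ac.
  rewrite qT => _ [|[E]]; first by move/(ltn_trans kq); rewrite ltnn.
  by rewrite E ltnn in kq.
by rewrite qE // => gc; apply: visit_closed iq cm' Ac gc.
Qed.

(** Koenig's vertex cover in counted form. The cover consists of the rows of [A] not reached and the
    columns reached. When no free column is reached, every reached column is matched with a reached
    row and every unreached row of [A] is matched, so the cover is as large as the matching. *)
Lemma search_cut A mr mc q vis par qt fr kk : matching A mr mc ->
  search A mr mc q vis par qt fr kk 0 -> m <= kk -> fr = 0 ->
  [/\ card_lt (in_queue q qt) + matched mr = card_lt A + card_lt (fun c => vis c != 0),
      forall r, in_queue q qt r -> A r &
      forall r c, in_queue q qt r -> c < m -> A c -> g r c -> vis c != 0].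
Proof.
move=> [sym mrA mcm] s mk fr0; have qm := queue_size s.
case: s => s1 s2 s3 s4 s5 s6 s7 s8.
have QA r : in_queue q qt r -> A r by case/in_queueP=> i iq <-; case: (s2 _ iq).
split=> //; last first.
  move=> r c /in_queueP[i iq <-] cm Ac gc; apply: (s8 i) => //; left.
  by apply: leq_trans mk; apply: leq_trans qm.
have -> : card_lt (fun c => vis c != 0) =
    \sum_(r < m) \sum_(c < m) ((mr r == c.+1) && in_queue q qt r : nat).
  rewrite exchange_big /=; apply: eq_bigr => c _.
  rewrite (eq_bigr (fun r : 'I_m => (mc c == r.+1) && in_queue q qt r : nat)); last first.
    by move=> r _; rewrite sym.
  rewrite sum_pred1S; case: (boolP (vis c != 0)) => vc.
    case: (s5 _ (ltn_ord c) vc) => [[]|[i iq ->]]; first by rewrite fr0.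
    case: (s2 _ iq) => -> _; symmetry; congr nat_of_bool.
    by apply/in_queueP; exists i.
  case E: (mc c) => [//|r]; case: ltnP => //= rm; case: in_queueP => //= -[i iq qi].
  have mrr : mr r = c.+1 by apply/eqP; rewrite sym // E.
  case: (s4 _ iq) => [|[c' [_]]]; rewrite qi mrr // => -[<-].
  by rewrite (negbTE vc).
rewrite /card_lt /matched /card_lt -!big_split /=; apply: eq_bigr => r _.
case: (mrA _ (ltn_ord r)) => [E|[c [cm -> Ar Ac gc]]].
  rewrite E /= big1 // !addn0; congr nat_of_bool.
  by apply/idP/idP => [/QA//|Ar]; apply: s7.
by rewrite (sum_pred1S (fun=> in_queue q qt r)) cm Ar /= addnC.
Qed.

(* The matching while an augmenting path is being flipped from its end: column
   [c.-1] still has to be given to the row it was reached from. *)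
Definition flipping A mr0 q vis par mr mc c k : Prop :=
  if c is d.+1 then
    [/\ d < m, vis d != 0, par d + k < m,
      forall i, i <= par d -> mr (q i) = mr0 (q i) &
    [/\ forall r e, r < m -> e < m -> e != d -> (mr r == e.+1) = (mc e == r.+1),
      forall r, r < m -> mr r != d.+1,
      forall r, r < m -> mr r = 0 \/
        exists c, [/\ c < m, mr r = c.+1, A r, A c & g r c],
      forall c, c < m -> mc c = 0 \/ exists2 r, r < m & mc c = r.+1
    & matched mr = matched mr0]]
  else matching A mr mc /\ matched mr = (matched mr0).+1.

Lemma flipping_init A mr mc q vis par qt fr kk cc : matching A mr mc ->
  search A mr mc q vis par qt fr kk cc -> fr != 0 ->
  flipping A mr q vis par mr mc fr 0.
Proof.
move=> [sym mrA mcm] s fr0; have qm := queue_size s.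
case: (found s) => [E|[c [cm -> vc mc0]]]; first by rewrite E in fr0.
have [_ pq _] := vis_par s cm vc; split=> //; first by rewrite addn0 (leq_trans pq).
by split=> // [r e rm em _|r rm]; rewrite ?sym // mc0.
Qed.

Lemma matched_update mr r c : r < m -> matched (update mr r c.+1) = matched mr + (mr r == 0).
Proof.
move=> rm; rewrite /matched /card_lt (bigD1 (Ordinal rm)) //= [in RHS](bigD1 (Ordinal rm)) //=.
rewrite /update eqxx /= addnAC; congr (_ + _); first by case: (mr r).
by apply: eq_bigr => i; rewrite -val_eqE /= => /negbTE ->.
Qed.

(** Row [r] takes column [d]. If it was free, the matching has gained a pair. Otherwise its former
    column must be served next; that column was reached from an earlier queue position, where the
    matching is still the old one. *)
Lemma flipping_step A mr0 mc0 q vis par qt fr kk cc mr mc d k :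
  search A mr0 mc0 q vis par qt fr kk cc ->
  flipping A mr0 q vis par mr mc d.+1 k ->
  let r := q (par d) in
  flipping A mr0 q vis par (update mr r d.+1) (update mc d r.+1) (mr r) k.+1.
Proof.
move=> s [dm vd pk same [sym nd mrA mcm sz]] r.
have [Ad pq gd] := vis_par s dm vd; have [rm Ar] := queue_in s pq.
have mrr := same _ (leqnn (par d)); rewrite -/r in mrr.
have mrA' r' : r' < m -> update mr r d.+1 r' = 0 \/
    exists c, [/\ c < m, update mr r d.+1 r' = c.+1, A r', A c & g r' c].
  by move=> rm'; rewrite /update; case: eqP => [->|_]; [right; exists d|exact: mrA].
have mcm' c : c < m -> update mc d r.+1 c = 0 \/ exists2 r', r' < m & update mc d r.+1 c = r'.+1.
  by move=> cm; rewrite /update; case: eqP => [_|_]; [right; exists r|exact: mcm].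
have symd r' : r' < m -> (update mr r d.+1 r' == d.+1) = (update mc d r.+1 d == r'.+1).
  move=> rm'; rewrite /update eqxx eqSS [r == r']eq_sym.
  by case: (r' == r); rewrite ?eqxx // (negbTE (nd _ rm')).
case E: (mr r) => [|d'].
  split; last by rewrite matched_update // E sz addn1.
  split=> // r' e rm' em; case: (eqVneq e d) => [->|ne]; first exact: symd.
  rewrite /update (negbTE ne); case: (eqVneq r' r) => [->|_]; last exact: sym.
  by rewrite -sym // E eqSS eq_sym (negbTE ne).
have [E0|[d2 [dm' E2 vd' pd']]] := queue_mr s pq; first by rewrite -/r -mrr E in E0.
have ? : d2 = d' by move: E2; rewrite -/r -mrr E => -[].
subst d2 => {E2}.
have dd : d' != d by apply/negP => /eqP dd; have := nd _ rm; rewrite E dd eqxx.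
split=> //; first by rewrite addnS; apply: leq_ltn_trans pk; rewrite -addSn leq_add2r.
  move=> i ip; have ilt : i < par d by apply: leq_ltn_trans ip pd'.
  rewrite /update; case: eqP => [/(queue_inj s)E'|_]; last by apply: same; apply: ltnW.
  by move: (ilt); rewrite E' ?ltnn // (ltn_trans ilt).
split=> // [r' e rm' em ne|r' rm'|].
- case: (eqVneq e d) => [->|ned]; first exact: symd.
  rewrite /update (negbTE ned); case: (eqVneq r' r) => [->|_]; last exact: sym.
  by rewrite -sym // E !eqSS eq_sym (negbTE ned) eq_sym (negbTE ne).
- rewrite /update; case: (eqVneq r' r) => [_|nr]; first by rewrite eqSS eq_sym.
  by rewrite sym //; have := sym r d' rm dm' dd; rewrite E eqxx => /esym/eqP->; rewrite eqSS eq_sym.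
by rewrite matched_update // E addn0.
Qed.

(** The queue position [par d] drops at every flip while [k] grows by one, so the bound on their sum
    leaves at most [m] rounds. *)
Lemma flipping_end A mr0 q vis par mr mc c k : m <= k ->
  flipping A mr0 q vis par mr mc c k -> c = 0.
Proof.
by case: c => // d mk [_ _ pk]; have := leq_ltn_trans (leq_addl (par d) k) pk; rewrite ltnNge mk.
Qed.

Lemma matching_restrict A B mr mc mr' mc' : matching A mr mc ->
  (forall r, r < m -> mr' r = if B r && B (mr r).-1 then mr r else 0) ->
  (forall c, c < m -> mc' c = if B c && B (mc c).-1 then mc c else 0) ->
  matching B mr' mc'.
Proof.
move=> [sym mrA mcm] r' c'; split.
- move=> r c rm cm; rewrite r' // c' //.
  case: (eqVneq (mr r) c.+1) => [E|ne].
    have E' : mc c = r.+1 by apply/eqP; rewrite -sym // E.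
    by rewrite E E' /= [B c && _]andbC; case: ifP; rewrite ?eqxx.
  have ne' : mc c != r.+1 by rewrite -sym.
  by case: ifP; case: ifP; rewrite ?(negbTE ne) ?(negbTE ne').
- move=> r rm; rewrite r' //; case: (mrA r rm) => [->|[c [cm -> Ar Ac gc]]].
    by left; case: ifP.
  by case: ifP => [/andP[Br Bc]|_]; [right; exists c|left].
move=> c cm; rewrite c' //; case: ifP => _; [exact: mcm|by left].
Qed.

Lemma matched_loss A B mr mc mr' : matching A mr mc ->
  (forall r, r < m -> mr' r = if B r && B (mr r).-1 then mr r else 0) ->
  matched mr <= matched mr' + (card_lt (fun r => A r && ~~ B r)).*2.
Proof.
move=> mm E; have -> : matched mr' = card_lt (fun r => [&& mr r != 0, B r & B (mr r).-1]).
  apply: eq_bigr => r _; rewrite E //; by case: (B r && _); rewrite ?andbF ?andbT.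
exact: matched_restrict mm.
Qed.

(** Weak duality bounds every independent set by |A| - M / 2. Two independent sets with sizes adding
    up to 2 |A| - M must both attain the bound, which also forces M to be even. *)
Lemma search_value A mr mc q vis par qt fr kk (P : pred 'I_m) :
  matching A mr mc -> search A mr mc q vis par qt fr kk 0 -> m <= kk -> fr = 0 ->
  (forall r c : 'I_m, A r -> A c -> P r = P c -> ~~ g r c) ->
  (forall r c, g r c = g c r) ->
  let v := card_lt A - matched mr %/ 2 in
  (forall K : {set 'I_m}, independent K -> {in K, forall r : 'I_m, A r} -> #|K| <= v) /\
  (exists K : {set 'I_m}, [/\ independent K, {in K, forall r : 'I_m, A r} & #|K| = v]).
Proof.
move=> mm s mk fr0 Pg gC v; have [cnt QA cl] := search_cut mm s mk fr0.
have up K iK KA := @independent_matched A mr mc K mm iK KA.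
split=> [K iK KA|]; first by have := up K iK KA; rewrite /v; lia.
pose Q := in_queue q qt.
(* Reached rows and unreached columns are independent in the double cover. Reading a vertex as a row
   on one class of [P] and as a column on the other gives [K1]; exchanging the classes gives
   [K2]. *)
pose K1 := [set r : 'I_m | A r & if P r then Q r else vis r == 0]%SET.
pose K2 := [set r : 'I_m | A r & if P r then vis r == 0 else Q r]%SET.
have QW r c : Q r -> A c -> c < m -> vis c == 0 -> ~~ g r c.
  by move=> Qr Ac cm v0; apply/negP => gc; have := cl _ _ Qr cm Ac gc; rewrite v0.
have i1 : independent K1.
  move=> r c; rewrite !inE; case: (boolP (P r)) => Pr; case: (boolP (P c)) => Pc
    /andP[Ar hr] /andP[Ac hc]; try by apply: Pg; rewrite ?Pr ?Pc ?(negbTE Pr) ?(negbTE Pc).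
    exact: QW.
  by rewrite gC; apply: QW.
have i2 : independent K2.
  move=> r c; rewrite !inE; case: (boolP (P r)) => Pr; case: (boolP (P c)) => Pc
    /andP[Ar hr] /andP[Ac hc]; try by apply: Pg; rewrite ?Pr ?Pc ?(negbTE Pr) ?(negbTE Pc).
    by rewrite gC; apply: QW.
  exact: QW.
have A1 : {in K1, forall r : 'I_m, A r} by move=> r; rewrite inE => /andP[].
have A2 : {in K2, forall r : 'I_m, A r} by move=> r; rewrite inE => /andP[].
have sum12 : #|K1| + #|K2| + card_lt (fun c => vis c != 0) = card_lt Q + card_lt A.
  rewrite /card_lt -!sum1_card ![\sum_(i in _) 1]big_mkcond -!big_split /=.
  apply: eq_bigr => r _; rewrite !inE.
  case: (boolP (A r)) => Ar /=; first by case: (P r); case: (Q r); case: (vis r).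
  have -> : Q r = false by apply/negbTE/negP => /QA; rewrite (negbTE Ar).
  case: eqP => //= /eqP v0; case: (vis_par s (ltn_ord r) v0).
  by rewrite (negbTE Ar).
exists K1; split=> //; have := up _ i1 A1; have := up _ i2 A2; move: cnt sum12.
rewrite /Q /v; move: (card_lt A) (matched mr) (card_lt _) (card_lt _) #|K1| #|K2|.
by move=> a b c d e f; lia.
Qed.

End Matching.

(** * The program *)

Notation "a ;; b" := (HSeq a b) (at level 85, right associativity).

Notation vBest := 0 (only parsing).
Notation vN := 1 (only parsing).
Notation vM := 2 (only parsing).
Notation vEdges := 3 (only parsing).
Notation vSteps := 4 (only parsing).
Notation vPi := 5 (only parsing).
Notation vPj := 6 (only parsing).
Notation vK := 7 (only parsing).
Notation vR := 8 (only parsing).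
Notation vLen := 9 (only parsing).
Notation vA := 10 (only parsing).
Notation vJ := 11 (only parsing).
Notation vI := 12 (only parsing).
Notation vX := 13 (only parsing).
Notation vY := 14 (only parsing).
Notation vQT := 15 (only parsing).
Notation vFR := 16 (only parsing).
Notation vKK := 17 (only parsing).
Notation vCC := 18 (only parsing).
Notation vC := 19 (only parsing).
Notation vT := 20 (only parsing).
Notation vCA := 21 (only parsing).
Notation vCB := 22 (only parsing).
Notation vRR := 23 (only parsing).
Notation vV := 24 (only parsing).
Notation vU := 25 (only parsing).
Notation vD := 26 (only parsing).

(** Vectors occupy row 0 of their table. [tS], [tSP], [tTM], [tT] hold s_r, s_r^+, t_r^-, t_r;
    [tES], [tFS] the half-trees relative to vertex 0, and [tE], [tF] the half-trees E_r and F_r;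
    [tNA] is non-interference, [tAct] the current R_xy, [tMR] and [tMC] the matching. *)
Notation tIn := 0 (only parsing).
Notation tU := 1 (only parsing).
Notation tV := 2 (only parsing).
Notation tS := 3 (only parsing).
Notation tSP := 4 (only parsing).
Notation tTM := 5 (only parsing).
Notation tT := 6 (only parsing).
Notation tSeen := 7 (only parsing).
Notation tNext := 8 (only parsing).
Notation tES := 9 (only parsing).
Notation tFS := 10 (only parsing).
Notation tNA := 11 (only parsing).
Notation tE := 12 (only parsing).
Notation tF := 13 (only parsing).
Notation tMR := 14 (only parsing).
Notation tMC := 15 (only parsing).
Notation tAct := 16 (only parsing).
Notation tQ := 17 (only parsing).
Notation tVis := 18 (only parsing).
Notation tPar := 19 (only parsing).

Definition row0 (q : nat) (j : hexpr) : hexpr := HT q (HC 0) j.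
Definition put0 (q : nat) (j e : hexpr) : hcmd := HPut q (HC 0) j e.
Definition incr (x : nat) : hcmd := HSet x (HB Add (HV x) (HC 1)).
Definition hnot (a : hexpr) : hexpr := HB Eq a (HC 0).
Definition hand (a b : hexpr) : hexpr := HB Mul (hnot (hnot a)) (hnot (hnot b)).
Definition hneq (a b : hexpr) : hexpr := hnot (HB Eq a b).

Definition read_cur : hexpr := HT tIn (HV vPi) (HV vPj).

(* The pointer into the input is a pair of base-[D] digits; the low digit wraps
   around to 0 because [Add] is modulo [D]. *)
Definition advance : hcmd := incr vPj ;; HIf (HV vPj) HSkip (incr vPi).

Definition read_header : hcmd :=
  HSet vN (HT tIn (HC 0) (HC 0)) ;; HSet vM (HT tIn (HC 0) (HC 1)) ;;
  HSet vEdges (HB Sub (HV vN) (HC 1)) ;; HSet vSteps (HB Add (HV vN) (HV vM)) ;;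
  HSet vPj (HC 2).

Definition read_edges : hcmd :=
  HFor vK vEdges (put0 tU (HV vK) read_cur ;; advance ;;
                  put0 tV (HV vK) read_cur ;; advance).

(** [vA] still holds the previous vertex when it is stored, so that [tTM] ends up with the
    penultimate one; the first turn also records the second vertex. *)
Definition read_vertex : hcmd :=
  put0 tTM (HV vR) (HV vA) ;; HSet vA read_cur ;;
  HIf (HV vJ) HSkip (put0 tSP (HV vR) (HV vA)) ;; advance.

Definition read_request : hcmd :=
  HSet vLen (HB Sub read_cur (HC 1)) ;; advance ;;
  HSet vA read_cur ;; put0 tS (HV vR) (HV vA) ;; advance ;;
  HFor vJ vLen read_vertex ;; put0 tT (HV vR) (HV vA).

Definition read_requests : hcmd := HFor vR vM read_request.

Definition hsame (q1 q2 : nat) (u v : hexpr) : hexpr :=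
  let a := row0 q1 (HV vR) in let b := row0 q2 (HV vR) in
  hnot (hand (hnot (hand (HB Eq u a) (HB Eq v b)))
             (hnot (hand (HB Eq u b) (HB Eq v a)))).

(** The value at [v] differs from the value at a neighbour [u] exactly when uv is the edge of the
    request's arc. *)
Definition extend_side (q q1 q2 u v : nat) : hcmd :=
  HFor vR vM (HPut q (HV vR) (HV v)
    (hneq (HT q (HV vR) (HV u)) (hsame q1 q2 (HV u) (HV v)))).

Definition insert_vertex (u v : nat) : hcmd :=
  put0 tSeen (HV v) (HC 1) ;; put0 tNext (HV v) (row0 tNext (HV u)) ;;
  put0 tNext (HV u) (HV v) ;;
  extend_side tES tS tSP u v ;; extend_side tFS tTM tT u v.

Definition try_insert (u v : nat) : hcmd :=
  HIf (hand (row0 tSeen (HV u)) (hnot (row0 tSeen (HV v)))) (insert_vertex u v) HSkip.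

Definition sweep : hcmd :=
  HFor vK vEdges (HSet vU (row0 tU (HV vK)) ;; HSet vV (row0 tV (HV vK)) ;;
    try_insert vU vV ;; try_insert vV vU).

(** After k sweeps all vertices at distance at most k from vertex 0 are listed, whatever the order
    of the edges; hence n sweeps suffice. *)
Definition grow_list : hcmd := put0 tSeen (HC 0) (HC 1) ;; HFor vI vN sweep.

(** The values relative to vertex 0 become absolute by comparison with a vertex known to lie
    outside: s_r for E_r, and t_r^- for F_r. *)
Definition fill_sides : hcmd :=
  HFor vR vM (HFor vX vN (
    HPut tE (HV vR) (HV vX) (hneq (HT tES (HV vR) (HV vX)) (HT tES (HV vR) (row0 tS (HV vR)))) ;;
    HPut tF (HV vR) (HV vX) (hneq (HT tFS (HV vR) (HV vX)) (HT tFS (HV vR) (row0 tTM (HV vR)))))).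

Definition hinterferes (r c : nat) : hexpr :=
  hand (HT tE (HV r) (row0 tT (HV c))) (hnot (HT tF (HV c) (row0 tS (HV r)))).

Definition fill_nonadj : hcmd :=
  HFor vR vM (HFor vCC vM (HPut tNA (HV vR) (HV vCC)
    (hand (hnot (hinterferes vR vCC)) (hnot (hinterferes vCC vR))))).

Definition fill_active : hcmd :=
  HFor vR vM (put0 tAct (HV vR)
    (hand (HT tE (HV vR) (HV vX)) (hnot (HT tF (HV vR) (HV vY))))).

(** On an unmatched entry 0 the truncated subtraction tests request 0; this is harmless, as the
    entry is 0 after either branch. *)
Definition unmatch (q : nat) : hcmd :=
  HFor vR vM (HIf (hand (row0 tAct (HV vR)) (row0 tAct (HB Sub (row0 q (HV vR)) (HC 1))))
    HSkip (put0 q (HV vR) (HC 0))).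

Definition refresh : hcmd := fill_active ;; unmatch tMR ;; unmatch tMC.

Definition clear_visited : hcmd := HFor vCC vM (put0 tVis (HV vCC) (HC 0)).

Definition enqueue (e : hexpr) : hcmd := put0 tQ (HV vQT) e ;; incr vQT.

Definition load_free : hcmd :=
  HFor vR vM (HIf (hand (row0 tAct (HV vR)) (hnot (row0 tMR (HV vR))))
    (enqueue (HV vR)) HSkip).

Definition scan_column : hcmd :=
  HIf (hand (hand (row0 tAct (HV vCC)) (HT tNA (HV vRR) (HV vCC))) (hnot (row0 tVis (HV vCC))))
    (put0 tVis (HV vCC) (HC 1) ;; put0 tPar (HV vCC) (HV vKK) ;;
     HIf (row0 tMC (HV vCC)) (enqueue (HB Sub (row0 tMC (HV vCC)) (HC 1)))
       (HSet vFR (HB Add (HV vCC) (HC 1))))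
    HSkip.

(** A bounded loop cannot stop when the queue is exhausted, and the queue grows meanwhile. The loop
    runs through all [m] possible positions and skips those not filled. *)
Definition scan_rows : hcmd :=
  HFor vKK vM (HIf (HB Lt (HV vKK) (HV vQT))
    (HSet vRR (row0 tQ (HV vKK)) ;; HFor vCC vM scan_column) HSkip).

Definition search_path : hcmd :=
  HSet vQT (HC 0) ;; HSet vFR (HC 0) ;; clear_visited ;; load_free ;; scan_rows.

Definition flip_column : hcmd :=
  HIf (HV vC) (HSet vD (HB Sub (HV vC) (HC 1)) ;;
    HSet vRR (row0 tQ (row0 tPar (HV vD))) ;; HSet vC (row0 tMR (HV vRR)) ;;
    put0 tMR (HV vRR) (HB Add (HV vD) (HC 1)) ;; put0 tMC (HV vD) (HB Add (HV vRR) (HC 1)))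
    HSkip.

Definition flip_path : hcmd := HSet vC (HV vFR) ;; HFor vKK vM flip_column.

Definition count_sizes : hcmd :=
  HFor vR vM (HIf (row0 tAct (HV vR)) (incr vCA) HSkip ;;
              HIf (row0 tMR (HV vR)) (incr vCB) HSkip).

Definition record_value : hcmd :=
  HSet vCA (HC 0) ;; HSet vCB (HC 0) ;; count_sizes ;;
  HSet vA (HB Sub (HV vCA) (HB Div (HV vCB) (HC 2))) ;;
  HIf (HB Lt (HV vBest) (HV vA)) (HSet vBest (HV vA)) HSkip.

Definition next_vertex : hcmd :=
  HSet vY (row0 tNext (HV vY)) ;; incr vI ;; refresh.

(** One search per step: on success the matching is augmented, on failure it is maximum for the
    current pair, its value is recorded and y moves on. Steps after the last vertex do nothing. *)
Definition step : hcmd :=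
  HIf (HB Lt (HV vI) (HV vN))
    (search_path ;; HIf (HV vFR) flip_path (record_value ;; next_vertex)) HSkip.

Definition steps : hcmd := HFor vT vSteps step.

Definition clear_matching : hcmd :=
  HFor vR vM (put0 tMR (HV vR) (HC 0) ;; put0 tMC (HV vR) (HC 0)).

(** The 6 * (n + m) steps come in six loops because a loop bound must be a value below [D], such as
    n + m. *)
Definition sweep_y : hcmd :=
  HSet vY (HC 0) ;; HSet vI (HC 0) ;; clear_matching ;; refresh ;;
  steps ;; steps ;; steps ;; steps ;; steps ;; steps.

Definition all_pairs : hcmd := HFor vX vN sweep_y.

Definition clique_prog : hcmd :=
  read_header ;; read_edges ;; read_requests ;; grow_list ;; fill_sides ;;
  fill_nonadj ;; all_pairs.

Lemma clique_prog_wf : wf clique_prog.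
Proof. by []. Qed.

(** The exponent of the time bound; the deepest nest runs over x, the steps, the queue and the
    columns. *)
Lemma clique_prog_depth : depth clique_prog = 4.
Proof. by []. Qed.

Lemma runS D c1 c2 h : run D (c1 ;; c2) h = run D c2 (run D c1 h).
Proof. by []. Qed.

Lemma runIf D e c1 c2 h :
  run D (HIf e c1 c2) h = if heval D h e != 0 then run D c1 h else run D c2 h.
Proof. by []. Qed.

Lemma runIfb D e c1 c2 h (b : bool) : heval D h e = b ->
  run D (HIf e c1 c2) h = if b then run D c1 h else run D c2 h.
Proof. by rewrite runIf => ->; case: b. Qed.

Lemma htab_setv h x a q : htab (setv h x a) q = htab h q.
Proof. by []. Qed.

Lemma heval_hnot D h a : heval D h (hnot a) = (heval D h a == 0).
Proof. by []. Qed.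

Lemma heval_hand D h a b : 1 < D ->
  heval D h (hand a b) = (heval D h a != 0) && (heval D h b != 0).
Proof.
move=> D1; rewrite /= !eqb0 modn_small; first by rewrite mulnb.
by rewrite mulnb (leq_ltn_trans (leq_b1 _)).
Qed.

Lemma heval_hneq D h a b : heval D h (hneq a b) = (heval D h a != heval D h b).
Proof. by rewrite /= eqb0. Qed.

Lemma run_put0 D q j e h :
  htab (run D (put0 q j e) h) q 0 = update (htab h q 0) (heval D h j) (heval D h e).
Proof. by rewrite /= eqxx. Qed.

Lemma heval_hsame D h q1 q2 u v : 1 < D ->
  heval D h (hsame q1 q2 u v) = same_edge
    (htab h q1 0 (hvar h vR)) (htab h q2 0 (hvar h vR)) (heval D h u) (heval D h v).
Proof.
move=> D1; rewrite /hsame heval_hnot heval_hand // !heval_hnot !heval_hand //.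
by rewrite /= !eqb0 !negbK -negb_or negbK.
Qed.

(** * Correctness of the main loop *)

Section Loops.
Variables (D n m : nat) (gE gF : nat -> nat -> bool) (g : rel nat) (L : nat -> nat).
Hypothesis D_big : n + m + 2 <= D.

Let D_gt1 : 1 < D. Proof. by move: D_big; lia. Qed.

(** The data that the main loop reads and never modifies. *)
Record ctx (h : hstate) : Prop := Ctx {
  ctx_n : hvar h vN = n;
  ctx_m : hvar h vM = m;
  ctx_steps : hvar h vSteps = n + m;
  ctx_E : forall r x, r < m -> x < n -> htab h tE r x = gE r x;
  ctx_F : forall r x, r < m -> x < n -> htab h tF r x = gF r x;
  ctx_g : forall r c, r < m -> c < m -> htab h tNA r c = g r c;
  ctx_next : forall i, i.+1 < n -> htab h tNext 0 (L i) = L i.+1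
}.

Lemma ctx_frame c h h' : all [pred x | x \notin assigned c] [:: vN; vM; vSteps] ->
  all [pred q | q \notin written c] [:: tE; tF; tNA; tNext] ->
  frame c h h' -> ctx h -> ctx h'.
Proof.
case/and4P=> v1 v2 v3 _ /and5P[q1 q2 q3 q4 _] [fv ft] [cn cm cs cE cF cg cx].
by split; rewrite ?fv ?ft.
Qed.

Definition act (h : hstate) : pred nat := fun r => htab h tAct 0 r != 0.
Notation mr h := (htab h tMR 0).
Notation mc h := (htab h tMC 0).

Lemma run_fill_active h r : hvar h vM = m -> r < m ->
  act (run D fill_active h) r = (htab h tE r (hvar h vX) != 0) && (htab h tF r (hvar h vY) == 0).
Proof.
move=> hm; move: r; apply: (for_ind (N := m) (P := fun k h1 => forall r, r < k -> act h1 r =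
  (htab h tE r (hvar h vX) != 0) && (htab h tF r (hvar h vY) == 0))) => // i h1 im hi fr IH r.
rewrite ltnS leq_eqVlt /act [htab _ _ _]run_put0 heval_hand // heval_hnot /update.
rewrite [heval _ _ (HV _)]/= hi; case: eqVneq => [-> _|nri] /=; last exact: IH.
by rewrite eqb0 negbK eqb0 negbK hi (fr.1 vX isT) (fr.1 vY isT) (fr.2 tE isT) (fr.2 tF isT).
Qed.

Lemma run_unmatch q h r : q != tAct -> hvar h vM = m -> r < m ->
  htab (run D (unmatch q) h) q 0 r =
  if act h r && act h (htab h q 0 r).-1 then htab h q 0 r else 0.
Proof.
move=> qA hm; pose new r := if act h r && act h (htab h q 0 r).-1 then htab h q 0 r else 0.
pose P i h1 := forall r, r < m -> htab h1 q 0 r = if r < i then new r else htab h q 0 r.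
suff H : P m (run D (unmatch q) h) by move=> rm; rewrite H // rm.
apply: (for_ind (N := m)) => // i h1 im hi fr IH {}r rm.
have fA : htab h1 tAct = htab h tAct by apply: fr.2; rewrite /= inE eq_sym.
rewrite runIf heval_hand //= fA hi (IH i im) ltnn subn1.
rewrite ltnS leq_eqVlt; case: (eqVneq r i) => [->|ri] /=.
  rewrite /new /act; case: (_ && _) => /=; first by rewrite IH // ltnn.
  by rewrite eqxx /= eqxx.
by case: (_ && _) => /=; rewrite ?eqxx /= ?(negbTE ri) IH.
Qed.

Lemma run_refresh A h : hvar h vM = m -> matching m g A (mr h) (mc h) ->
  let h' := run D refresh h in
  [/\ matching m g (act h') (mr h') (mc h'),
      matched m (mr h) <= matched m (mr h') + (card_lt m (fun r => A r && ~~ act h' r)).*2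
    & forall r, r < m -> act h' r =
        (htab h tE r (hvar h vX) != 0) && (htab h tF r (hvar h vY) == 0)].
Proof.
move=> hm mm; rewrite /refresh 2!runS; set h1 := run D fill_active h.
set h2 := run D (unmatch tMR) h1; set h' := run D (unmatch tMC) h2.
have f1 : frame fill_active h h1 by apply: run_frame.
have f2 : frame (unmatch tMR) h1 h2 by apply: run_frame.
have f3 : frame (unmatch tMC) h2 h' by apply: run_frame.
have hm1 : hvar h1 vM = m by rewrite (f1.1 vM isT).
have hm2 : hvar h2 vM = m by rewrite (f2.1 vM isT).
have a2 : act h2 = act h1 by rewrite /act (f2.2 tAct isT).
have a3 : act h' = act h1 by rewrite /act (f3.2 tAct isT) (f2.2 tAct isT).
have E r : r < m -> mr h' r = if act h' r && act h' (mr h r).-1 then mr h r else 0.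
  by move=> rm; rewrite a3 (f3.2 tMR isT) run_unmatch // (f1.2 tMR isT).
have E' r : r < m -> mc h' r = if act h' r && act h' (mc h r).-1 then mc h r else 0.
  by move=> rm; rewrite a3 run_unmatch // a2 (f2.2 tMC isT) (f1.2 tMC isT).
split; [exact: matching_restrict mm E E'|exact: matched_loss mm E|].
by move=> r rm; rewrite a3 run_fill_active.
Qed.

Lemma run_load_free h : hvar h vM = m -> hvar h vQT = 0 ->
  let h' := run D load_free h in
  let q := htab h' tQ 0 in let qt := hvar h' vQT in
  [/\ qt <= m, forall i j, i < qt -> j < qt -> q i = q j -> i = j,
      forall i, i < qt -> [/\ q i < m, act h (q i) & mr h (q i) = 0] &
      forall r, r < m -> act h r -> mr h r = 0 -> in_queue q qt r].
Proof.
move=> hm h0.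
apply: (for_ind (N := m) (P := fun k h' => let q := htab h' tQ 0 in let qt := hvar h' vQT in
  [/\ qt <= k, forall i j, i < qt -> j < qt -> q i = q j -> i = j,
      forall i, i < qt -> [/\ q i < k, act h (q i) & mr h (q i) = 0] &
      forall r, r < k -> act h r -> mr h r = 0 -> in_queue q qt r])) => //.
  by rewrite /= /update /= h0; split.
move=> i h1 im hi fr [qm qi qA fq].
have fA : act h1 = act h by rewrite /act (fr.2 tAct isT).
have fM : mr h1 = mr h by rewrite (fr.2 tMR isT).
have old r : r < i.+1 -> r != i -> r < i by rewrite ltnS leq_eqVlt => /orP[->|].
rewrite runIf heval_hand // [heval D h1 (row0 tAct _)]/= heval_hnot [heval D h1 (row0 _ _)]/= hi.
rewrite -/(act h1 i) eqb0 negbK fM fA.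
case: ifP => [c|/negbT c].
  have [Ai mi] : act h i /\ mr h i = 0 by move: c; rewrite eqb0 negbK => /andP[-> /eqP].
  set qt := hvar h1 vQT in qm qi qA fq; set q := htab h1 tQ 0 in qi qA fq.
  have qt1 : (qt + 1) %% D = qt.+1 by rewrite addn1 modn_small //; move: D_big qm im; lia.
  rewrite /= /update /= -/qt qt1 hi -/q.
  have qE k : k < qt -> (if k == qt then i else q k) = q k by move=> /ltn_eqF->.
  have lt_qt k : k < qt.+1 -> k = qt \/ k < qt.
    by rewrite ltnS leq_eqVlt => /orP[/eqP|]; [left|right].
  split=> //.
  - move=> k l /lt_qt[->|kq] /lt_qt[->|lq] //; rewrite ?eqxx ?qE //.
    + by move=> E; have [] := qA _ lq; rewrite -E ltnn.
    + by move=> E; have [] := qA _ kq; rewrite E ltnn.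
    exact: qi.
  - move=> k /lt_qt[->|kq]; first by rewrite eqxx.
    by rewrite qE //; have [lt ? ?] := qA _ kq; split=> //; apply: ltnW.
  move=> r ri Ar mr0; apply/in_queueP; case: (eqVneq r i) => [->|ne].
    by exists qt; rewrite ?eqxx.
  have /in_queueP[k kq <-] := fq r (old _ ri ne) Ar mr0.
  by exists k; rewrite ?qE // ltnS ltnW.
rewrite /= /update /=; split=> //; first exact: leq_trans qm (leqnSn _).
  by move=> k /qA[lt ? ?]; split=> //; apply: leq_trans lt _.
move=> r ri Ar mr0; apply: fq => //; apply: old => //; apply: contraNneq c => ri'.
by move: Ar mr0; rewrite ri' => -> ->.
Qed.

Definition searching (A : pred nat) h kk cc := search m g A (mr h) (mc h)
  (htab h tQ 0) (htab h tVis 0) (htab h tPar 0) (hvar h vQT) (hvar h vFR) kk cc.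

Lemma run_scan_column h kk cc : ctx h -> matching m g (act h) (mr h) (mc h) ->
  searching (act h) h kk cc -> kk < hvar h vQT -> cc < m ->
  hvar h vKK = kk -> hvar h vCC = cc -> hvar h vRR = htab h tQ 0 kk ->
  let h' := run D scan_column h in
  searching (act h) h' kk cc.+1 /\ (kk < hvar h' vQT /\ hvar h vRR = htab h' tQ 0 kk).
Proof.
move=> cx mm s kq cm hk hc hr; have qm := queue_size s.
rewrite /scan_column runIf !heval_hand // heval_hnot [heval D h (row0 tAct _)]/=.
rewrite [heval D h (HT _ _ _)]/= [heval D h (row0 tVis _)]/= hc hr !eqb0 !negbK.
have [rm Ar] := queue_in s kq; rewrite (ctx_g cx) // eqb0 negbK -/(act h cc).
case: ifP => [/andP[/andP[Ac gc] /eqP v0]|/negbT c]; last first.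
  by split=> //; apply: search_skip s _; rewrite andbA.
rewrite !runS runIf; set h1 := run D (put0 tVis _ _) h; set h2 := run D (put0 tPar _ _) h1.
have -> : heval D h2 (row0 tMC (HV vCC)) = mc h cc by rewrite /= hc.
case E: (mc h cc) => [|r] /=.
  have c1 : (cc + 1) %% D = cc.+1 by rewrite addn1 modn_small //; move: D_big cm; lia.
  rewrite hc c1 -hr; split=> //; rewrite /searching /= /update /= hc hk.
  exact: search_found s kq cm Ac gc v0 E.
have q1 : (hvar h vQT + 1) %% D = (hvar h vQT).+1.
  by rewrite addn1 modn_small //; move: D_big qm; lia.
rewrite hc E subn1 q1 /=; split; last by rewrite ltn_eqF // -hr; split=> //; rewrite ltnS ltnW.
rewrite /searching /= /update /= hc hk.
exact: search_push mm s kq cm Ac gc v0 E.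
Qed.

Lemma run_scan_rows h : ctx h -> matching m g (act h) (mr h) (mc h) ->
  searching (act h) h 0 0 -> searching (act h) (run D scan_rows h) m 0.
Proof.
move=> cx mm s0; apply: (for_ind (N := m) (P := fun k h1 => searching (act h) h1 k 0)) => //.
  exact: ctx_m.
move=> k h1 km hk fr s.
have cx1 : ctx h1 by apply: ctx_frame fr cx.
have fA : act h1 = act h by rewrite /act (fr.2 tAct isT).
have mm1 : matching m g (act h1) (mr h1) (mc h1).
  by rewrite fA (fr.2 tMR isT) (fr.2 tMC isT).
rewrite runIf [heval _ _ _]/= hk; case: (ltnP k (hvar h1 vQT)) => [kq|qk]; last first.
  by apply: (search_next_row s); left.
rewrite runS; set h2 := run D (HSet vRR _) h1.
have h2r : hvar h2 vRR = htab h2 tQ 0 k by rewrite /= hk.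
have [] : searching (act h) (run D (HFor vCC vM scan_column) h2) k m /\
  (k < hvar (run D (HFor vCC vM scan_column) h2) vQT /\
   hvar h2 vRR = htab (run D (HFor vCC vM scan_column) h2) tQ 0 k).
  apply: (for_ind (N := m) (P := fun c h3 => searching (act h) h3 k c /\
    (k < hvar h3 vQT /\ hvar h2 vRR = htab h3 tQ 0 k))).
  - by [].
  - exact: ctx_m cx1.
  - by split.
  move=> c h3 cm hc fr3 [s3 [kq3 r3]].
  have fA3 : act h3 = act h by rewrite -fA /act (fr3.2 tAct isT).
  have cx3 : ctx h3 by apply: ctx_frame fr3 _ => //; case: cx1.
  have k3 : hvar h3 vKK = k by rewrite (fr3.1 vKK isT).
  have mm3 : matching m g (act h3) (mr h3) (mc h3).
    by rewrite fA3 -fA (fr3.2 tMR isT) (fr3.2 tMC isT).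
  rewrite -fA3 in s3; have [] := run_scan_column cx3 mm3 s3 kq3 cm k3 hc _.
    by rewrite (fr3.1 vRR isT).
  by rewrite fA3 (fr3.1 vRR isT).
by move=> s' _; apply: (search_next_row s'); right.
Qed.

Lemma run_search h : ctx h -> matching m g (act h) (mr h) (mc h) ->
  searching (act h) (run D search_path h) m 0.
Proof.
move=> cx mm; rewrite /search_path 4!runS.
set h1 := run D (HSet vQT _) h; set h2 := run D (HSet vFR _) h1.
set h3 := run D clear_visited h2; set h4 := run D load_free h3.
have cx2 : ctx h2 by case: cx.
have f3 : frame clear_visited h2 h3 by apply: run_frame.
have f4 : frame load_free h3 h4 by apply: run_frame.
have cx3 : ctx h3 by apply: ctx_frame f3 cx2.
have cx4 : ctx h4 by apply: ctx_frame f4 cx3.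
have v0 c : c < m -> htab h4 tVis 0 c = 0.
  rewrite (f4.2 tVis isT); move: c; apply: (for_ind (N := m) (P := fun k h1 =>
    forall c, c < k -> htab h1 tVis 0 c = 0)) => //; first exact: ctx_m cx2.
  move=> i hh im hi _ IH c; rewrite ltnS leq_eqVlt /= hi; case: (eqVneq c i) => //= _.
  exact: IH.
have [|_ qi qA fq] := run_load_free (ctx_m cx3); first by rewrite (f3.1 vQT isT).
have a3 : act h3 = act h by rewrite /act (f3.2 tAct isT).
have a4 : act h4 = act h by rewrite /act (f4.2 tAct isT) (f3.2 tAct isT).
have m3 : mr h3 = mr h by rewrite (f3.2 tMR isT).
rewrite -a4; apply: run_scan_rows => //.
  by rewrite a4 (f4.2 tMR isT) (f3.2 tMR isT) (f4.2 tMC isT) (f3.2 tMC isT).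
rewrite a3 m3 in qA fq; rewrite a4 /searching (f4.2 tMR isT) (f4.2 tMC isT) m3.
have -> : hvar h4 vFR = 0 by rewrite (f4.1 vFR isT) (f3.1 vFR isT).
exact: search_init.
Qed.

Lemma run_flip h : ctx h -> matching m g (act h) (mr h) (mc h) ->
  searching (act h) h m 0 -> hvar h vFR != 0 ->
  let h' := run D flip_path h in
  matching m g (act h) (mr h') (mc h') /\ matched m (mr h') = (matched m (mr h)).+1.
Proof.
move=> cx mm s fr0; rewrite /flip_path runS; set h1 := run D (HSet vC _) h.
pose P k h2 := flipping m g (act h) (mr h) (htab h tQ 0) (htab h tVis 0) (htab h tPar 0)
  (mr h2) (mc h2) (hvar h2 vC) k.
have : P m (run D (HFor vKK vM flip_column) h1).
  apply: (for_ind (N := m)) => //; first exact: ctx_m cx.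
    by apply: flipping_init mm s fr0.
  move=> k h2 km hk fr; rewrite /P runIf; case E: (hvar h2 vC) => [|d].
    by rewrite [heval _ _ _]/= E /= /update /= E.
  move=> fl; have [dm vd _ _ _] := fl; have [_ pq _] := vis_par s dm vd.
  have [rm _] := queue_in s pq.
  have fQ : htab h2 tQ = htab h tQ by rewrite (fr.2 tQ isT).
  have fP : htab h2 tPar = htab h tPar by rewrite (fr.2 tPar isT).
  have d1 : (d + 1) %% D = d.+1 by rewrite addn1 modn_small //; move: D_big dm; lia.
  have r1 : (htab h tQ 0 (htab h tPar 0 d) + 1) %% D = (htab h tQ 0 (htab h tPar 0 d)).+1.
    by rewrite addn1 modn_small //; move: D_big rm; lia.
  rewrite [heval _ _ _]/= E /= /update /= E subn1 fQ fP d1 r1 /=.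
  exact: (flipping_step s fl).
rewrite /P => fl; have E := flipping_end (leqnn m) fl.
by move: fl; rewrite E.
Qed.

Lemma card_ltS P k : card_lt k.+1 P = card_lt k P + P k.
Proof. by rewrite /card_lt big_ord_recr. Qed.

Lemma card_lt_le P k : card_lt k P <= k.
Proof. by elim: k => [|k IH]; rewrite ?card_ltS ?/card_lt ?big_ord0 // -addn1 leq_add // leq_b1. Qed.

Lemma run_record h : ctx h -> hvar (run D record_value h) vBest =
  maxn (hvar h vBest) (card_lt m (act h) - matched m (mr h) %/ 2).
Proof.
move=> cx; rewrite /record_value 4!runS.
set h1 := run D (HSet vCA _) h; set h2 := run D (HSet vCB _) h1.
set h3 := run D count_sizes h2; set h4 := run D (HSet vA _) h3.
have f3 : frame count_sizes h2 h3 by apply: run_frame.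
have cx2 : ctx h2 by case: cx.
have [ca cb] : hvar h3 vCA = card_lt m (act h) /\ hvar h3 vCB = matched m (mr h).
  apply: (for_ind (N := m) (P := fun i hh => hvar hh vCA = card_lt i (act h) /\
    hvar hh vCB = card_lt i (fun r => mr h r != 0))) => //; first exact: ctx_m cx2.
    by rewrite /card_lt !big_ord0.
  move=> i hh im hi fr [ca cb]; rewrite runS !runIf !card_ltS.
  have -> : heval D hh (row0 tAct (HV vR)) = htab h tAct 0 i by rewrite /= hi (fr.2 tAct isT).
  rewrite -/(act h i); set hh' := if act h i then _ else _.
  have [ca' cb' tb' i'] : [/\ hvar hh' vCA = card_lt i (act h) + act h i,
      hvar hh' vCB = card_lt i (fun r => mr h r != 0), htab hh' = htab hh & hvar hh' vR = i].
    rewrite /hh'; case: ifP => _ /=; rewrite /update /= ?addn0 //; split=> //.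
    rewrite ca modn_small //; have := card_lt_le (act h) i; move: D_big im; lia.
  have -> : heval D hh' (row0 tMR (HV vR)) = mr h i by rewrite /= i' tb' (fr.2 tMR isT).
  case: ifP => _ /=; rewrite /update /= ?addn0 //.
  split=> //; rewrite cb' modn_small //.
  by have := card_lt_le (fun r => mr h r != 0) i; move: D_big im; lia.
have E4 : hvar h4 vA = card_lt m (act h) - matched m (mr h) %/ 2 by rewrite /= ca cb.
have B4 : hvar h4 vBest = hvar h vBest by rewrite /h4 /= /update /= (f3.1 vBest isT).
rewrite runIf.
have -> : heval D h4 (HB Lt (HV vBest) (HV vA)) = (hvar h4 vBest < hvar h4 vA) by [].
rewrite -E4 -B4 maxnE; case: ltnP => lt.
  by rewrite subnKC ?(ltnW lt) //= /update /=.
by move: lt; rewrite -subn_eq0 => /eqP->; rewrite addn0.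
Qed.

(** * Amortised analysis of the sweep over y *)

Hypotheses (n_gt0 : 0 < n) (L_lt : forall i, i < n -> L i < n) (L_0 : L 0 = 0).
Hypothesis g_sym : forall r c, g r c = g c r.
Hypothesis two_classes : forall x y, x < n -> y < n ->
  exists P : pred 'I_m, forall r c : 'I_m, gE r x -> gE c x -> ~~ gF r y -> ~~ gF c y ->
    P r = P c -> ~~ g r c.
Hypothesis few_entries : forall r i, r < m -> i < n ->
  \sum_(j < i) (~~ gF r (L j) && gF r (L j.+1)) <= 2.

Definition selected (x y : nat) : pred nat := fun r => gE r x && ~~ gF r y.

(** [S] holds the pairs already treated: a vertex x and the position of y in the list. The clique
    attaining [b] need not be selected by such a pair, so the empty set serves for the initial value
    0. *)
Definition best_for (S : nat -> nat -> Prop) (b : nat) : Prop :=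
  (exists K : {set 'I_m}, independent g K /\ #|K| = b) /\
  forall x i, S x i -> forall K : {set 'I_m}, independent g K ->
    {in K, forall r : 'I_m, selected x (L i) r} -> #|K| <= b.

Definition losses (i : nat) : nat :=
  \sum_(j < i) card_lt m (fun r => ~~ gF r (L j) && gF r (L j.+1)).

Lemma losses_le i : i < n -> losses i <= m.*2.
Proof.
move=> i_n; rewrite /losses /card_lt exchange_big /=.
apply: leq_trans (_ : \sum_(r < m) 2 <= _); first by apply: leq_sum => r _; exact: few_entries.
by rewrite sum_nat_const card_ord muln2.
Qed.

(* Each step either enlarges the matching or moves [y] one vertex further, and a
   move costs two matched edges per request leaving the selection; since a
   request leaves it at most twice, [6 * (n + m)] steps suffice. *)
Record sweeping (x t : nat) (h : hstate) : Prop := Sweeping {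
  sw_ctx : ctx h;
  sw_x : hvar h vX = x;
  sw_i : hvar h vI <= n;
  sw_match : matching m g (act h) (mr h) (mc h);
  sw_y : hvar h vI < n -> hvar h vY = L (hvar h vI) /\
    forall r, r < m -> act h r = selected x (L (hvar h vI)) r;
  sw_t : hvar h vI < n -> t <= hvar h vI + matched m (mr h) + (losses (hvar h vI)).*2;
  sw_best : best_for (fun x' i => i < n /\ (x' < x \/ x' = x /\ i < hvar h vI)) (hvar h vBest)
}.

(** The potential, position plus matching size plus twice the losses, rises by at least one: the
    position advances, and the pairs lost are at most twice the new departures. *)
Lemma run_next_vertex h x t : x < n -> ctx h -> hvar h vX = x -> hvar h vI < n ->
  matching m g (act h) (mr h) (mc h) -> hvar h vY = L (hvar h vI) ->
  (forall r, r < m -> act h r = selected x (L (hvar h vI)) r) ->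
  t <= hvar h vI + matched m (mr h) + (losses (hvar h vI)).*2 ->
  best_for (fun x' i => i < n /\ (x' < x \/ x' = x /\ i <= hvar h vI)) (hvar h vBest) ->
  sweeping x t.+1 (run D next_vertex h).
Proof.
move=> xn cx hx i_n mm hy hA ht bst; rewrite /next_vertex 2!runS.
set h1 := run D (HSet vY _) h; set h2 := run D (incr vI) h1; set h3 := run D refresh h2.
have f3 : frame refresh h2 h3 by apply: run_frame.
have cx2 : ctx h2 by case: cx.
have i2 : hvar h2 vI = (hvar h vI).+1.
  by rewrite /h2 /= /update /= addn1 modn_small //; move: D_big i_n; lia.
have y2 : hvar h2 vY = htab h tNext 0 (L (hvar h vI)) by rewrite -hy.
have [mm3 loss act3] := run_refresh (ctx_m cx2) (mm : matching m g (act h) (mr h2) (mc h2)).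
rewrite -/h3 in mm3 loss act3.
have sel r : r < m -> (hvar h vI).+1 < n -> act h3 r = selected x (L (hvar h vI).+1) r.
  move=> rm i1n; rewrite act3 // y2 (ctx_next cx i1n) -[hvar h2 vX]/(hvar h vX) hx.
  by rewrite (ctx_E cx2) // (ctx_F cx2) ?L_lt // eqb0 negbK eqb0.
split=> //; rewrite ?(f3.1 vI isT) ?(f3.1 vX isT) ?(f3.1 vBest isT) ?(f3.1 vY isT) ?i2 //.
- exact: ctx_frame f3 cx2.
- move=> i1n; rewrite y2 (ctx_next cx i1n); split=> // r rm; exact: sel.
- move=> i1n; rewrite /losses big_ord_recr /= -/(losses (hvar h vI)).
  have le : card_lt m (fun r => act h r && ~~ act h3 r) <=
      card_lt m (fun r => ~~ gF r (L (hvar h vI)) && gF r (L (hvar h vI).+1)).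
    apply: leq_sum => r _; rewrite hA // sel // /selected; move: (gF r _) (gF r _) (gE r x).
    by do 3!case.
  move: loss; rewrite -[mr h2]/(mr h); move: le ht.
  move: (card_lt _ _) (card_lt _ _) (losses _) (matched _ _) (matched _ _) => a b c d e'.
  by rewrite !doubleD; lia.
Qed.

Lemma run_step x t h : x < n -> sweeping x t h -> sweeping x t.+1 (run D step h).
Proof.
move=> xn sw; have [cx hx hi mm hy ht bst] := sw.
have ei : heval D h (HB Lt (HV vI) (HV vN)) = (hvar h vI < n) by rewrite /= (ctx_n cx).
rewrite (runIfb _ _ ei); case: (ltnP (hvar h vI) n) => i_n; last first.
  by split=> //; rewrite ltnNge i_n.
have [hY hA] := hy i_n; have {}ht := ht i_n.
rewrite runS; set h1 := run D search_path h.
have f1 : frame search_path h h1 by apply: run_frame.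
have cx1 : ctx h1 by apply: ctx_frame f1 cx.
have a1 : act h1 = act h by rewrite /act (f1.2 tAct isT).
have mm1 : matching m g (act h1) (mr h1) (mc h1).
  by rewrite a1 (f1.2 tMR isT) (f1.2 tMC isT).
have s : searching (act h1) h1 m 0 by rewrite a1; exact: run_search.
have i1 : hvar h1 vI = hvar h vI by rewrite (f1.1 vI isT).
rewrite runIf [heval _ _ _]/=; case: ifP => [fr|/negbFE/eqP fr].
  set h2 := run D flip_path h1.
  have f2 : frame flip_path h1 h2 by apply: run_frame.
  have a2 : act h2 = act h by rewrite /act (f2.2 tAct isT).
  have [mm2 sz] := run_flip cx1 mm1 s fr.
  rewrite -/h2 a1 in mm2 sz.
  split=> //; rewrite ?a2 ?(f2.1 vI isT) ?(f2.1 vX isT) ?(f2.1 vBest isT) ?(f2.1 vY isT)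
    ?i1 ?(f1.1 vX isT) ?(f1.1 vBest isT) ?(f1.1 vY isT) //.
    exact: ctx_frame f2 cx1.
  by move=> _; rewrite sz (f1.2 tMR isT) addnS addSn.
rewrite runS; set h2 := run D record_value h1.
have f2 : frame record_value h1 h2 by apply: run_frame.
have i2 : hvar h2 vI = hvar h vI by rewrite (f2.1 vI isT).
have a2 : act h2 = act h by rewrite /act (f2.2 tAct isT).
have m2 : mr h2 = mr h by rewrite (f2.2 tMR isT) (f1.2 tMR isT).
apply: run_next_vertex => //; rewrite ?i2 ?a2 ?m2 //.
- exact: ctx_frame f2 cx1.
- by rewrite (f2.1 vX isT) (f1.1 vX isT).
- by rewrite (f2.2 tMC isT) (f1.2 tMC isT).
- by rewrite (f2.1 vY isT) (f1.1 vY isT).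
have [P HP] := two_classes xn (L_lt i_n).
have [|up [K [iK KA sK]]] := search_value (P := P) mm1 s (leqnn m) fr _ g_sym.
  by move=> r c; rewrite a1 !hA // => /andP[rE rF] /andP[cE cF]; apply: HP.
rewrite run_record // (f1.1 vBest isT); case: bst => [[K0 [iK0 sK0]] up0]; split.
  rewrite /maxn; case: ifP => _; [exists K|exists K0]; split=> //.
move=> x' i [lt S] K' iK' K'S; rewrite leq_max.
have [S'|[Ex Ei]] : (x' < x \/ x' = x /\ i < hvar h vI) \/ (x' = x /\ i = hvar h vI).
- case: S => [|[->]]; first by left; left.
  by rewrite leq_eqVlt => /orP[/eqP|]; [right|left; right].
- by rewrite (up0 x' i).
by rewrite up ?orbT // => r Kr; rewrite a1 hA // -Ei -Ex; exact: K'S.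
Qed.

Lemma run_steps x t h : x < n -> sweeping x t h -> sweeping x (t + (n + m)) (run D steps h).
Proof.
move=> xn sw; apply: (for_ind (N := n + m) (P := fun k h1 => sweeping x (t + k) h1)) => //.
- by case: (sw_ctx sw).
- by rewrite addn0; case: sw => -[*]; split.
move=> k h1 _ _ _ sw1; rewrite addnS; case: (run_step xn sw1) => -[*]; split=> //.
Qed.

Lemma run_sweep_y x h : x < n -> ctx h -> hvar h vX = x ->
  best_for (fun x' i => i < n /\ x' < x) (hvar h vBest) ->
  best_for (fun x' i => i < n /\ x' < x.+1) (hvar (run D sweep_y h) vBest).
Proof.
move=> xn cx hx bst; rewrite /sweep_y 9!runS.
set h1 := run D (HSet vY _) h; set h2 := run D (HSet vI _) h1.
set h3 := run D clear_matching h2; set h4 := run D refresh h3.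
have f3 : frame clear_matching h2 h3 by apply: run_frame.
have f4 : frame refresh h3 h4 by apply: run_frame.
have cx2 : ctx h2 by case: cx.
have cx3 : ctx h3 by apply: ctx_frame f3 cx2.
have cx4 : ctx h4 by apply: ctx_frame f4 cx3.
have z3 : forall r, r < m -> mr h3 r = 0 /\ mc h3 r = 0.
  apply: (for_ind (N := m) (P := fun k hh => forall r, r < k -> mr hh r = 0 /\ mc hh r = 0)) => //.
    exact: ctx_m cx2.
  move=> i hh im hi _ IH r; rewrite ltnS leq_eqVlt /= hi; case: (eqVneq r i) => //= _.
  exact: IH.
have mm3 : matching m g pred0 (mr h3) (mc h3).
  split=> [r c rm cm|r rm|c cm]; last by left; case: (z3 c cm).
    2: by left; case: (z3 r rm).
  by have [-> _] := z3 r rm; have [_ ->] := z3 c cm.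
have [mm4 _ act4] := run_refresh (ctx_m cx3) mm3.
rewrite -/h4 in mm4 act4.
have i4 : hvar h4 vI = 0 by rewrite (f4.1 vI isT) (f3.1 vI isT).
have x3 : hvar h3 vX = x by rewrite (f3.1 vX isT).
have y3 : hvar h3 vY = 0 by rewrite (f3.1 vY isT).
have b4 : hvar h4 vBest = hvar h vBest by rewrite (f4.1 vBest isT) (f3.1 vBest isT).
have sw4 : sweeping x 0 h4.
  split=> //; rewrite ?i4 //.
  - by rewrite (f4.1 vX isT).
  - rewrite (f4.1 vY isT) y3 L_0; split=> // r rm.
    by rewrite act4 // x3 y3 (ctx_E cx3) // (ctx_F cx3) // eqb0 negbK eqb0.
  rewrite b4; case: bst => ex up; split=> // x' i [lt S]; apply: (up x' i); split=> //.
  by case: S => // -[].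
have := run_steps xn (run_steps xn (run_steps xn (run_steps xn (run_steps xn (run_steps xn sw4))))).
set h5 := run D steps _ => sw5.
(* With y still inside the list the potential would be below n + m + 4 m, less than the 6 * (n + m)
   steps made. *)
have i5 : hvar h5 vI = n.
  apply/eqP; rewrite eqn_leq (sw_i sw5) leqNgt; apply/negP => i_n.
  have := sw_t sw5 i_n; have := losses_le i_n; have := card_lt_le (fun r => mr h5 r != 0) m.
  rewrite -/(matched m (mr h5)); move: (losses _) (matched _ _) => a b; move: i_n.
  move: (hvar h5 vI) => c; lia.
have [ex up] := sw_best sw5; split=> // x' i [lt S]; apply: up; rewrite i5; split=> //.
by move: S; rewrite ltnS leq_eqVlt => /orP[/eqP|]; [right|left].
Qed.

Lemma run_all_pairs h : ctx h -> hvar h vBest = 0 ->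
  best_for (fun x i => i < n /\ x < n) (hvar (run D all_pairs h) vBest).
Proof.
move=> cx h0; apply: (for_ind (N := n) (P := fun x h1 =>
  best_for (fun x' i => i < n /\ x' < x) (hvar h1 vBest))) => //.
- exact: ctx_n.
- rewrite /= /update /= h0; split; last by move=> x i [].
  by exists finset.set0; rewrite cards0; split=> // r c; rewrite inE.
move=> x h1 xn hx fr IH; apply: run_sweep_y => //.
by apply: ctx_frame fr cx.
Qed.
End Loops.

(** * Correctness of the input and precomputation phases *)

Section Reading.
Variables (D : nat) (inp : seq nat).
Hypotheses (D_gt1 : 1 < D) (inp_small : size inp < D * D).

Record reading (h : hstate) (rest : seq nat) : Prop := Reading {
  rd_tab : forall i j, i < D -> j < D -> htab h tIn i j = nth 0 inp (i * D + j);
  rd_pj : hvar h vPj < D;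
  rd_pos : hvar h vPi * D + hvar h vPj <= size inp;
  rd_rest : drop (hvar h vPi * D + hvar h vPj) inp = rest
}.

Lemma reading_frame c h h' rest : vPi \notin assigned c -> vPj \notin assigned c ->
  tIn \notin written c -> frame c h h' -> reading h rest -> reading h' rest.
Proof.
by move=> i1 i2 i3 [fv ft] [t1 t2 t3 t4]; split; rewrite ?fv ?ft.
Qed.

Lemma run_advance h x rest : reading h (x :: rest) ->
  heval D h read_cur = x /\ reading (run D advance h) rest.
Proof.
case=> tb pj pos dr; move: dr; set p := hvar h vPi * D + hvar h vPj in pos * => dr.
have p_lt : p < size inp by rewrite ltnNge; apply/negP => /drop_oversize E; rewrite E in dr.
have pi : hvar h vPi < D.
  rewrite -(ltn_pmul2r (ltnW D_gt1)); apply: leq_ltn_trans inp_small.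
  by apply: leq_trans pos; rewrite leq_addr.
move: dr; rewrite (drop_nth 0) // => -[Ex Er]; split; first by rewrite /= tb.
rewrite runS runIf; set h1 := run D (incr vPj) h.
have E1 : heval D h1 (HV vPj) = (hvar h vPj + 1) %% D by [].
rewrite E1; move: pj; rewrite leq_eqVlt => /orP[/eqP pjD|pj].
  rewrite addn1 pjD modnn /=.
  have pD : p.+1 = (hvar h vPi).+1 * D by rewrite /p -addnS pjD mulSn addnC.
  have pi1 : (hvar h vPi).+1 < D.
    by rewrite -(ltn_pmul2r (ltnW D_gt1)) -pD; apply: leq_ltn_trans inp_small.
  split=> //=; rewrite /update /= ?addn1 ?pjD ?modnn ?(modn_small pi1) ?addn0 -?pD //.
  exact: ltnW.
rewrite addn1 (modn_small pj) /=; split=> //=; rewrite /update /= addn1 (modn_small pj) //.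
  by rewrite addnS.
by rewrite addnS.
Qed.

Lemma run_read_edges h (l : seq (nat * nat)) rest :
  hvar h vEdges = size l ->
  reading h (flatten [seq [:: a.1; a.2] | a <- l] ++ rest) ->
  let h' := run D read_edges h in
  reading h' rest /\ forall k, k < size l ->
    htab h' tU 0 k = (nth (0, 0) l k).1 /\ htab h' tV 0 k = (nth (0, 0) l k).2.
Proof.
move=> hl rd.
suff [] : reading (run D read_edges h) (flatten [seq [:: a.1; a.2] | a <- drop (size l) l] ++ rest) /\
    forall k, k < size l -> htab (run D read_edges h) tU 0 k = (nth (0, 0) l k).1 /\
      htab (run D read_edges h) tV 0 k = (nth (0, 0) l k).2.
  by rewrite drop_size.
apply: (for_ind (N := size l) (P := fun k h1 =>
  reading h1 (flatten [seq [:: a.1; a.2] | a <- drop k l] ++ rest) /\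
  forall j, j < k -> htab h1 tU 0 j = (nth (0, 0) l j).1 /\ htab h1 tV 0 j = (nth (0, 0) l j).2)) => //.
  by rewrite drop0; split=> //; case: rd => *; split.
move=> k h1 kl hk fr [rd1 tab1].
rewrite (drop_nth (0, 0)) //= in rd1; rewrite 3!runS.
set h2 := run D (put0 tU _ _) h1; set h3 := run D advance h2.
set h4 := run D (put0 tV _ _) h3; set h5 := run D advance h4.
have [E1 _] := run_advance rd1.
have rd2 := reading_frame (c := put0 tU (HV vK) read_cur) isT isT isT (run_frame D _ _) rd1.
have [_ rd3] := run_advance rd2; have [E3 _] := run_advance rd3.
have rd4 := reading_frame (c := put0 tV (HV vK) read_cur) isT isT isT (run_frame D _ _) rd3.
have [_ rd5] := run_advance rd4.
have f5 : frame advance h4 h5 by apply: run_frame.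
have f3 : frame advance h2 h3 by apply: run_frame.
have f4 : frame (put0 tV (HV vK) read_cur) h3 h4 by apply: run_frame.
split; first by case: rd5 => *; split.
move=> j; rewrite ltnS leq_eqVlt => jk.
have k3 : hvar h3 vK = k by rewrite (f3.1 vK isT).
have -> : htab (setv h5 vK k.+1) tU 0 = update (htab h1 tU 0) k (nth (0, 0) l k).1.
  rewrite htab_setv (f5.2 tU isT) (f4.2 tU isT) (f3.2 tU isT).
  by rewrite /h2 run_put0 E1 /= hk.
have -> : htab (setv h5 vK k.+1) tV 0 = update (htab h1 tV 0) k (nth (0, 0) l k).2.
  rewrite htab_setv (f5.2 tV isT) /h4 run_put0 E3 (f3.2 tV isT).
  by rewrite /heval k3.
rewrite /update; case: (eqVneq j k) jk => [->|nj] //=; exact: tab1.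
Qed.

Definition request_tables h (r : nat) (q : vseq nat) : Prop :=
  [/\ htab h tS 0 r = source q, htab h tSP 0 r = second q,
      htab h tTM 0 r = penult q & htab h tT 0 r = target q].

Definition same_rows h h' r : Prop :=
  forall q r', r' != r -> htab h' q 0 r' = htab h q 0 r'.

Lemma run_read_request h x p rest : 0 < size p ->
  reading h ((size p).+1 :: x :: p ++ rest) ->
  let r := hvar h vR in let h' := run D read_request h in
  [/\ reading h' rest, request_tables h' r (x, p) & same_rows h h' r].
Proof.
move=> p_gt0 rd r; rewrite /read_request 6!runS.
set h1 := run D (HSet vLen _) h; set h2 := run D advance h1.
set h3 := run D (HSet vA _) h2; set h4 := run D (put0 tS _ _) h3; set h5 := run D advance h4.
set h6 := run D (HFor _ _ _) h5.
have [E1 _] := run_advance rd.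
have rd1 : reading h1 ((size p).+1 :: x :: p ++ rest) by case: rd => *; split.
have [_ rd2] := run_advance rd1; have [E2 _] := run_advance rd2.
have rd3 : reading h3 (x :: p ++ rest) by case: rd2 => *; split.
have rd4 := reading_frame (c := put0 tS (HV vR) (HV vA)) isT isT isT (run_frame D _ _) rd3.
have [_ rd5] := run_advance rd4.
have f2 : frame advance h1 h2 by apply: run_frame.
have f5 : frame advance h4 h5 by apply: run_frame.
have len5 : hvar h5 vLen = size p.
  rewrite (f5.1 vLen isT) -[hvar h4 vLen]/(hvar h2 vLen) (f2.1 vLen isT).
  by rewrite -[hvar h1 vLen]/(heval D h read_cur - 1) E1 subn1.
have r5 : hvar h5 vR = r by rewrite (f5.1 vR isT) -[hvar h4 vR]/(hvar h2 vR) (f2.1 vR isT).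
have A5 : hvar h5 vA = x by rewrite (f5.1 vA isT) -[hvar h4 vA]/(heval D h2 read_cur).
have tS5 : htab h5 tS 0 = update (htab h tS 0) r x.
  rewrite (f5.2 tS isT) run_put0 -[heval _ _ (HV vA)]/(heval D h2 read_cur) E2.
  rewrite -[heval _ _ (HV vR)]/(hvar h2 vR) (f2.1 vR isT).
  by rewrite -[htab h3]/(htab h2) (f2.2 tS isT).
have t5 q : q != tS -> htab h5 q = htab h q.
  move=> /negbTE nq; rewrite (f5.2 q isT) /h4 /= nq (f2.2 q isT) //.
(* After [j] vertices beyond the source, [vA] is the last vertex read and [tTM] holds the one before
   it. *)
pose P j hh := [/\ reading hh (drop j p ++ rest), hvar hh vA = nth x (x :: p) j,
  0 < j -> htab hh tSP 0 r = second (x, p) /\ htab hh tTM 0 r = nth x (x :: p) j.-1,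
  htab hh tS = htab h5 tS & same_rows h5 hh r].
have [rd6 A6 tm6 S6 sr6] : P (size p) h6.
  apply: (for_ind (N := size p)) => //.
    rewrite /P drop0; split=> //; first by case: rd5 => *; split.
  move=> j hh jp hj fr [rdj Aj tmj Sj srj].
  have rj : hvar hh vR = r by rewrite (fr.1 vR isT).
  rewrite (drop_nth x) //= in rdj; rewrite /read_vertex 3!runS.
  set g1 := run D (put0 tTM _ _) hh; set g2 := run D (HSet vA _) g1.
  set g3 := run D (HIf _ _ _) g2; set g4 := run D advance g3.
  have rdg1 := reading_frame (c := put0 tTM (HV vR) (HV vA)) isT isT isT (run_frame D _ _) rdj.
  have [Eg1 _] := run_advance rdg1.
  have rdg2 : reading g2 (nth x p j :: drop j.+1 p ++ rest) by case: rdg1 => *; split.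
  have fg2 : frame (HSet vA read_cur) g1 g2 by apply: run_frame.
  have fg3 : frame (HIf (HV vJ) HSkip (put0 tSP (HV vR) (HV vA))) g2 g3 by apply: run_frame.
  have rdg3 := reading_frame (c := HIf (HV vJ) HSkip (put0 tSP (HV vR) (HV vA))) isT isT isT fg3 rdg2.
  have [_ rdg4] := run_advance rdg3.
  have fg4 : frame advance g3 g4 by apply: run_frame.
  have Ag : hvar g4 vA = nth x p j by rewrite (fg4.1 vA isT) (fg3.1 vA isT).
  have rg : hvar g2 vR = r by [].
  have jg : heval D g2 (HV vJ) = j by [].
  have TMg : htab g4 tTM 0 = update (htab hh tTM 0) r (nth x (x :: p) j).
    rewrite (fg4.2 tTM isT) (fg3.2 tTM isT) (fg2.2 tTM isT) /g1 run_put0.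
    by rewrite -Aj -rj.
  have SPg : htab g4 tSP 0 = if j == 0 then update (htab hh tSP 0) r (nth x p j)
      else htab hh tSP 0.
    rewrite (fg4.2 tSP isT) /g3 runIf jg; case: (j == 0) => //.
    by rewrite run_put0 -[heval _ _ (HV vR)]/(hvar hh vR) rj -Eg1 (fg2.2 tSP isT).
  have og q : q != tTM -> q != tSP -> htab g4 q = htab hh q.
    move=> q1 q2; rewrite (fg4.2 q isT) (fg3.2 q) ?inE //.
    by rewrite (fg2.2 q isT) /g1 /= (negbTE q1).
  split=> //.
  - by case: rdg4 => *; split.
  - move=> _; rewrite !htab_setv TMg SPg.
    rewrite /update eqxx; split=> //; case: (posnP j) => [->|j0]; first by rewrite eqxx.
    by case: (tmj j0).
  - by rewrite htab_setv og.
  move=> q r' nr; rewrite htab_setv.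
  case: (eqVneq q tTM) => [->|q1]; first by rewrite TMg /update (negbTE nr) srj.
  case: (eqVneq q tSP) => [->|q2]; last by rewrite og // srj.
  by rewrite SPg; case: eqP => _; rewrite /update ?(negbTE nr) srj.
have f6 : frame (HFor vJ vLen read_vertex) h5 h6 by apply: run_frame.
have r6 : hvar h6 vR = r by rewrite (f6.1 vR isT).
have T7 : htab (run D (put0 tT (HV vR) (HV vA)) h6) tT 0 = update (htab h6 tT 0) r (last x p).
  rewrite run_put0 -[heval _ _ (HV vA)]/(hvar h6 vA) A6 -[heval _ _ (HV vR)]/(hvar h6 vR) r6.
  by rewrite (last_nth x).
have o7 q : q != tT -> htab (run D (put0 tT (HV vR) (HV vA)) h6) q = htab h6 q.
  by move=> /negbTE nq; rewrite /= nq.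
have [SP6 TM6] := tm6 p_gt0.
split.
- rewrite drop_size in rd6.
  exact: (reading_frame (c := put0 tT (HV vR) (HV vA)) isT isT isT (run_frame D _ _) rd6).
- split; first by rewrite o7 // S6 tS5 /update eqxx.
  + by rewrite o7.
  + by rewrite o7.
  by rewrite T7 /update eqxx.
move=> q r' nr; case: (eqVneq q tT) => [->|nq].
  by rewrite T7 /update (negbTE nr) sr6 // t5.
rewrite o7 // sr6 //; case: (eqVneq q tS) => [->|nq']; last by rewrite t5.
by rewrite tS5 /update (negbTE nr).
Qed.

Lemma run_read_requests h (l : seq (vseq nat)) : hvar h vM = size l ->
  (forall q, q \in l -> 0 < size q.2) ->
  reading h (flatten [seq (size (verts q)) :: verts q | q <- l]) ->
  forall r, r < size l -> request_tables (run D read_requests h) r (nth (0, [::]) l r).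
Proof.
move=> hl l_gt0 rd.
pose P k h1 := reading h1 (flatten [seq (size (verts q)) :: verts q | q <- drop k l]) /\
  forall r, r < k -> request_tables h1 r (nth (0, [::]) l r).
suff [] : P (size l) (run D read_requests h) by [].
apply: (for_ind (N := size l)) => //.
  by rewrite /P drop0; split=> //; case: rd => *; split.
move=> k h1 kl hk fr [rd1 tab1]; rewrite (drop_nth (0, [::])) //= in rd1.
case Ek: (nth (0, [::]) l k) (mem_nth (0, [::]) kl) rd1 => [x p] /l_gt0 p0 rd1.
have [rd2 rt sr] := run_read_request p0 rd1.
split; first by case: rd2 => *; split.
move=> r; rewrite ltnS leq_eqVlt; case: (eqVneq r k) => [-> _|nr]; last rewrite orFb => /tab1[t1 t2 t3 t4].
  by rewrite Ek; move: rt; rewrite hk; case=> *; split.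
by rewrite -hk in nr; split; rewrite htab_setv (sr _ _ nr).
Qed.

End Reading.

(** * The program on a given instance *)

Section Instance.
Variables (n' : nat) (e : rel 'I_n'.+1) (es : seq ('I_n'.+1 * 'I_n'.+1)).
Variables (rs : seq (vseq 'I_n'.+1)) (D : nat).
Hypotheses (tree_e : tree e) (es_e : edge_list e es) (rs_req : all (request e) rs).
Hypothesis D_big : n'.+1 + size rs + 2 <= D.

Notation n := n'.+1.
Notation m := (size rs).

Let D_gt1 : 1 < D. Proof. by move: D_big; lia. Qed.

Definition nth_request (r : nat) : vseq 'I_n := nth (ord0, [::]) rs r.

Let rq_request r : r < m -> request e (nth_request r).
Proof. by move=> rm; apply: (allP rs_req); apply: mem_nth. Qed.

Record parsed (h : hstate) : Prop := Parsed {
  pr_n : hvar h vN = n;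
  pr_m : hvar h vM = m;
  pr_edges : hvar h vEdges = size es;
  pr_steps : hvar h vSteps = n + m;
  pr_best : hvar h vBest = 0;
  pr_U : forall k, k < size es -> htab h tU 0 k = (nth (ord0, ord0) es k).1;
  pr_V : forall k, k < size es -> htab h tV 0 k = (nth (ord0, ord0) es k).2;
  pr_S : forall r, r < m -> htab h tS 0 r = source (nth_request r);
  pr_SP : forall r, r < m -> htab h tSP 0 r = second (nth_request r);
  pr_TM : forall r, r < m -> htab h tTM 0 r = penult (nth_request r);
  pr_T : forall r, r < m -> htab h tT 0 r = target (nth_request r)
}.

Lemma parsed_frame c h h' :
  all [pred x | x \notin assigned c] [:: vN; vM; vEdges; vSteps; vBest] ->
  all [pred q | q \notin written c] [:: tU; tV; tS; tSP; tTM; tT] ->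
  frame c h h' -> parsed h -> parsed h'.
Proof.
case/and5P=> v1 v2 v3 v4 /andP[v5 _] /and5P[q1 q2 q3 q4 /and3P[q5 q6 _]] [fv ft] [*].
by split; rewrite ?fv ?ft.
Qed.

(** Because the side tables are relative to vertex 0, all-zero tables are already correct for the
    list consisting of vertex 0. *)
Record grown (L : seq 'I_n) (h : hstate) : Prop := Grown {
  gr_spread : spread e ord0 ord0 L;
  gr_seen : forall v : 'I_n, htab h tSeen 0 v = (v \in L);
  gr_next : sorted (fun a b : 'I_n => htab h tNext 0 a == b) L;
  gr_E : forall r (v : 'I_n), r < m -> v \in L -> htab h tES r v =
    (E_side e (nth_request r) v != E_side e (nth_request r) ord0);
  gr_F : forall r (v : 'I_n), r < m -> v \in L -> htab h tFS r v =
    (F_side e (nth_request r) v != F_side e (nth_request r) ord0)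
}.

Lemma same_edge_val (u v a b : 'I_n) :
  same_edge (val u) (val v) (val a) (val b) = same_edge u v a b.
Proof. by rewrite /same_edge !val_eqE. Qed.

(** In a list without repetition only the links leaving [u] and [v] are affected. *)
Lemma sorted_insert_after (nx nx' : nat -> nat) (u v : 'I_n) (L : seq 'I_n) :
  uniq L -> v \notin L -> nx' v = nx u -> nx' u = v ->
  (forall z : 'I_n, z != u -> z != v -> nx' z = nx z) ->
  sorted (fun a b : 'I_n => nx a == b) L ->
  sorted (fun a b : 'I_n => nx' a == b) (insert_after u v L).
Proof.
move=> + + nv nu nz.
have old a l : (forall z, z \in a :: l -> z != u /\ z != v) ->
    path (fun a b : 'I_n => nx a == b) a l -> path (fun a b : 'I_n => nx' a == b) a l.
  elim: l a => // b l IH a H /andP[ab pth]; have [au av] := H a (mem_head _ _).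
  apply/andP; split; first by rewrite nz.
  by apply: IH => // z zl; apply: H; rewrite in_cons zl orbT.
have at_u l : u \notin l -> v \notin l -> path (fun a b : 'I_n => nx a == b) u l ->
    path (fun a b : 'I_n => nx' a == b) u (v :: l).
  case: l => [|b l] /=; rewrite nu eqxx // => ul vl /andP[ub pth].
  rewrite nv ub old // => z zl; split; [apply: contraNneq ul|apply: contraNneq vl] => <- //.
case: L => // a L; rewrite cons_uniq => /andP[aL uL]; rewrite in_cons negb_or.
move=> /andP[va vL]; rewrite [sorted _ _]/= [insert_after _ _ _]/= => so.
case: (eqVneq a u) => [au|au]; first by rewrite au in aL so *; apply: at_u.
rewrite [sorted _ _]/=; elim: L a va au aL uL vL so => // b L IH a va au.
rewrite !in_cons !negb_or cons_uniq [path _ _ (b :: L)]/= [insert_after _ _ _]/=.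
move=> /andP[ab aL] /andP[bL uL] /andP[vb vL] /andP[nab pth].
case: (eqVneq b u) => [bu|bu]; rewrite [path _ _ (b :: _)]/= nz ?[a == v]eq_sym // nab /=.
  by rewrite bu in bL pth *; apply: at_u.
exact: IH.
Qed.

Lemma run_extend_side q q1 q2 x y h r z : q != q1 -> q != q2 -> x != vR -> y != vR ->
  hvar h vM = m -> r < m ->
  htab (run D (extend_side q q1 q2 x y) h) q r z = if z == hvar h y then
    nat_of_bool (htab h q r (hvar h x) !=
      same_edge (htab h q1 0 r) (htab h q2 0 r) (hvar h x) (hvar h y))
  else htab h q r z.
Proof.
move=> qq1 qq2 xR yR hm rm.
pose new k := nat_of_bool (htab h q k (hvar h x) !=
  same_edge (htab h q1 0 k) (htab h q2 0 k) (hvar h x) (hvar h y)).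
pose P k hh := forall r z, htab hh q r z =
  if (r < k) && (z == hvar h y) then new r else htab h q r z.
suff H : P m (run D (extend_side q q1 q2 x y) h) by rewrite H rm.
apply: (for_ind (N := m)) => // k hh km hk fr IH {rm}r {}z.
have fx : hvar hh x = hvar h x by apply: fr.1; rewrite inE.
have fy : hvar hh y = hvar h y by apply: fr.1; rewrite inE.
have f1 : htab hh q1 = htab h q1 by apply: fr.2; rewrite inE eq_sym.
have f2 : htab hh q2 = htab h q2 by apply: fr.2; rewrite inE eq_sym.
rewrite htab_setv; set ex := hneq _ _.
have ev : heval D hh ex = new k.
  by rewrite heval_hneq heval_hsame // /new /= fx fy f1 f2 hk IH ltnn.
have -> : htab (run D (HPut q (HV vR) (HV y) ex) hh) q r z =
    if (r == k) && (z == hvar h y) then new k else htab hh q r z.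
  by rewrite -ev -fy -hk; move: ex {ev} => ex /=; rewrite eqxx.
rewrite IH [r < k.+1]ltnS [r <= k]leq_eqVlt; case: (eqVneq r k) => [->|_] //=.
by rewrite ltnn; case: (z == _).
Qed.

Lemma neqb_trans (a b c : bool) :
  (nat_of_bool (a != c) != nat_of_bool (a != b)) = (b != c).
Proof. by case: a; case: b; case: c. Qed.

Lemma run_insert_vertex L h (u v : 'I_n) (x y : nat) :
  parsed h -> grown L h -> u \in L -> v \notin L -> e u v ->
  x != vR -> y != vR -> hvar h x = u -> hvar h y = v ->
  grown (insert_after u v L) (run D (insert_vertex x y) h).
Proof.
move=> pr [sp seen nx gE gF] uL vL euv xR yR hx hy; rewrite /insert_vertex 4!runS.
set h1 := run D (put0 tSeen _ _) h; set h2 := run D (put0 tNext _ _) h1.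
set h3 := run D (put0 tNext _ _) h2; set h4 := run D (extend_side tES _ _ _ _) h3.
set h5 := run D (extend_side tFS _ _ _ _) h4.
have f4 : frame (extend_side tES tS tSP x y) h3 h4 by apply: run_frame.
have f5 : frame (extend_side tFS tTM tT x y) h4 h5 by apply: run_frame.
have mi := mem_insert_after v uL.
have m3 : hvar h3 vM = m by rewrite -[LHS]/(hvar h vM) (pr_m pr).
have m4 : hvar h4 vM = m by rewrite (f4.1 vM isT).
have x3 : hvar h3 x = u by [].
have y3 : hvar h3 y = v by [].
have x4 : hvar h4 x = u by rewrite f4.1 ?inE.
have y4 : hvar h4 y = v by rewrite f4.1 ?inE.
have T q : q \notin [:: tSeen; tNext] -> htab h3 q = htab h q.
  by rewrite !inE !negb_or /= => /andP[/negbTE q1 /negbTE q2]; rewrite q1 q2.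
have old z : z != v -> z \in insert_after u v L -> z \in L.
  by move=> /negbTE zv; rewrite mi inE zv.
have seen5 : htab h5 tSeen 0 = update (htab h tSeen 0) v 1.
  by rewrite (f5.2 tSeen isT) (f4.2 tSeen isT) -hy.
have next5 : htab h5 tNext 0 = update (update (htab h tNext 0) v (htab h tNext 0 u)) u v.
  by rewrite (f5.2 tNext isT) (f4.2 tNext isT) -hy -hx.
have nuv : val u == val v = false by apply/negbTE; apply: contraNneq vL => /val_inj <-.
split.
- exact: spread_insert.
- move=> z; rewrite seen5 mi inE /update; case: eqVneq => [/val_inj->|nz]; first by rewrite eqxx.
  by rewrite seen val_eqE in nz *; rewrite (negbTE nz).
- case: (sp) => uniqL _ _ _; apply: sorted_insert_after nx => //; rewrite ?next5 /update.
  + by rewrite eq_sym nuv eqxx.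
  + by rewrite eqxx.
  by move=> z zu zv; rewrite !val_eqE (negbTE zu) (negbTE zv).
- move=> r z rm zL; have rq := rq_request rm; have [er _ _ _] := request_arcs rq.
  rewrite (f5.2 tES isT) run_extend_side // x3 y3 !T // val_eqE.
  case: (eqVneq z v) => [->|zv]; last by apply: gE => //; apply: old.
  rewrite gE // (pr_S pr) // (pr_SP pr) // same_edge_val -(side_edge tree_e er euv).
  by rewrite -/(E_side e (nth_request r) u) -/(E_side e (nth_request r) v) neqb_trans.
move=> r z rm zL; have rq := rq_request rm; have [_ er _ _] := request_arcs rq.
rewrite run_extend_side // x4 y4 (f4.2 tTM isT) (f4.2 tT isT) (f4.2 tFS isT) !T // val_eqE.
case: (eqVneq z v) => [->|zv]; last by apply: gF => //; apply: old.
rewrite gF // (pr_TM pr) // (pr_T pr) // same_edge_val -(side_edge tree_e er euv).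
by rewrite -/(F_side e (nth_request r) u) -/(F_side e (nth_request r) v) neqb_trans.
Qed.

Lemma run_try_insert L h (u v : 'I_n) (x y : nat) :
  parsed h -> grown L h -> e u v -> x != vR -> y != vR -> hvar h x = u -> hvar h y = v ->
  exists L', [/\ grown L' (run D (try_insert x y) h), {subset L <= L'} & u \in L -> v \in L'].
Proof.
move=> pr gr euv xR yR hx hy; rewrite /try_insert.
have ev : heval D h (hand (row0 tSeen (HV x)) (hnot (row0 tSeen (HV y)))) =
    (u \in L) && (v \notin L).
  by rewrite heval_hand // heval_hnot /= hx hy !(gr_seen gr) !eqb0 !negbK.
rewrite (runIfb _ _ ev); case: ifP => [/andP[uL vL]|/negbT no].
  exists (insert_after u v L); split; first exact: run_insert_vertex.
    by move=> z zL; rewrite mem_insert_after // inE zL orbT.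
  by rewrite mem_insert_after // inE eqxx.
exists L; split=> // uL; by move: no; rewrite uL negbK.
Qed.

Lemma parsed_setv h x a : x \notin [:: vN; vM; vEdges; vSteps; vBest] -> parsed h ->
  parsed (setv h x a).
Proof.
rewrite !inE !negb_or => /and5P[n1 n2 n3 n4 n5] [*].
by split; rewrite ?htab_setv //= /update eq_sym ?(negbTE n1) ?(negbTE n2) ?(negbTE n3)
  ?(negbTE n4) ?(negbTE n5) // eq_sym.
Qed.

Lemma run_sweep L h : parsed h -> grown L h ->
  exists L', [/\ grown L' (run D sweep h), {subset L <= L'} &
    forall u v, u \in L -> e u v -> v \in L'].
Proof.
move=> pr gr.
suff [L' [gr' sub new]] : exists L', [/\ grown L' (run D sweep h), {subset L <= L'} &
    forall k, k < size es -> let: (a, b) := nth (ord0, ord0) es k in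
      (a \in L -> b \in L') /\ (b \in L -> a \in L')].
  exists L'; split=> // u v uL; case: es_e => eE _ _; rewrite eE => /orP[] i;
    have := new _ (_ : index _ es < size es); [move=> /(_ (u, v))|move=> /(_ (v, u))];
    by rewrite index_mem => /(_ i); rewrite nth_index // => -[]; auto.
apply: (for_ind (N := size es) (P := fun k hh => exists L', [/\ grown L' hh, {subset L <= L'} &
    forall j, j < k -> let: (a, b) := nth (ord0, ord0) es j in
      (a \in L -> b \in L') /\ (b \in L -> a \in L')])) => //; first exact: pr_edges.
  by exists L; split=> //; case: gr => *; split.
move=> k hh km hk fr [L1 [gr1 sub1 new1]].
have prh : parsed hh by apply: parsed_frame fr pr.
case Ek: (nth (ord0, ord0) es k) (mem_nth (ord0, ord0) km) => [a b] ab.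
have eab : e a b by case: es_e => -> _ _; rewrite ab.
have eba : e b a by case: (tree_e) => _ -> _ _ _.
rewrite 3!runS; set h1 := run D (HSet vU _) hh; set h2 := run D (HSet vV _) h1.
set h3 := run D (try_insert vU vV) h2; set h4 := run D (try_insert vV vU) h3.
have f3 : frame (try_insert vU vV) h2 h3 by apply: run_frame.
have pr2 : parsed h2 by do 2!apply: parsed_setv => //.
have gr2 : grown L1 h2 by case: gr1 => *; split.
have u2 : hvar h2 vU = a by rewrite -[LHS]/(htab hh tU 0 (hvar hh vK)) hk (pr_U prh) // Ek.
have v2 : hvar h2 vV = b by rewrite -[LHS]/(htab hh tV 0 (hvar hh vK)) hk (pr_V prh) // Ek.
have [L2 [gr3 sub2 new2]] := run_try_insert (x := vU) (y := vV) pr2 gr2 eab isT isT u2 v2.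
have pr3 : parsed h3 by apply: parsed_frame f3 pr2.
have u3 : hvar h3 vU = a by rewrite (f3.1 vU isT).
have v3 : hvar h3 vV = b by rewrite (f3.1 vV isT).
have [L3 [gr4 sub3 new3]] := run_try_insert (x := vV) (y := vU) pr3 gr3 eba isT isT v3 u3.
exists L3; split; first by case: gr4 => *; split.
  by move=> z /sub1/sub2/sub3.
move=> j; rewrite ltnS leq_eqVlt; case: (eqVneq j k) => [-> _|_ /= jk].
  rewrite Ek; split=> [/sub1/new2/sub3//|/sub1/sub2/new3//].
have := new1 j jk; case: (nth _ es j) => c d [cd dc].
by split=> [/cd/sub2/sub3|/dc/sub2/sub3].
Qed.

Lemma run_grow_list h : parsed h ->
  (forall q i j, q \in [:: tSeen; tES; tFS] -> htab h q i j = 0) ->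
  exists L, grown L (run D grow_list h) /\ forall v, v \in L.
Proof.
move=> pr zero; rewrite /grow_list runS; set h1 := run D (put0 tSeen _ _) h.
have pr1 : parsed h1 by apply: parsed_frame (run_frame D (put0 tSeen (HC 0) (HC 1)) h) pr.
have gr1 : grown [:: ord0] h1.
  split=> //.
  - exact: (spread_path tree_e (y := ord0) (p := [::])).
  - move=> v; rewrite run_put0 /update inE /=.
    by rewrite -val_eqE /=; case: (val v == 0) => //; rewrite zero.
  - by move=> r v rm; rewrite inE => /eqP->; rewrite eqxx -[LHS]/(htab h tES r ord0) zero.
  by move=> r v rm; rewrite inE => /eqP->; rewrite eqxx -[LHS]/(htab h tFS r ord0) zero.
suff [L [gr all_L]] : exists L, grown L (run D (HFor vI vN sweep) h1) /\
    forall p, path e ord0 p -> size p <= n -> last ord0 p \in L.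
  exists L; split=> // v; have [_ _ _ conn _] := tree_e.
  case/connectP: (conn ord0 v) => p0 pth0 ->; case/shortenP: pth0 => p pth up _.
  apply: all_L => //; have := uniq_leq_size up (fun z _ => mem_enum 'I_n z).
  by rewrite size_enum_ord => /ltnW.
apply: (for_ind (N := n) (P := fun k hh => exists L, grown L hh /\
    forall p, path e ord0 p -> size p <= k -> last ord0 p \in L)) => //; first exact: pr_n pr1.
  exists [:: ord0]; split; first by case: gr1 => *; split.
  by case=> // _ _; rewrite inE.
move=> k hh kn hk fr [L [gr reach]].
have prh : parsed hh by apply: parsed_frame fr pr1.
have [L' [gr' sub new]] := run_sweep prh gr.
exists L'; split; first by case: gr' => *; split.
case/lastP => [_ _|p z]; first by apply: sub; apply: (reach [::]).
rewrite rcons_path size_rcons last_rcons ltnS => /andP[pth ez] sz.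
by apply: new ez; apply: reach.
Qed.

Lemma neqb_cancel (a b c : bool) :
  (nat_of_bool (a != c) != nat_of_bool (b != c)) = (a != b).
Proof. by case: a; case: b; case: c. Qed.

Definition gE (r x : nat) : bool := E_side e (nth_request r) (inord x).
Definition gF (r x : nat) : bool := F_side e (nth_request r) (inord x).
(** False on the diagonal for requests, since a request interferes on itself; independent sets of
    [gNA] are therefore exactly the cliques of the interference graph. *)
Definition gNA (r c : nat) : bool := ~~ interfere e (nth_request r) (nth_request c).

Lemma run_fill_sides L h : parsed h -> grown L h -> (forall v, v \in L) ->
  forall r x, r < m -> x < n -> htab (run D fill_sides h) tE r x = gE r x /\
    htab (run D fill_sides h) tF r x = gF r x.
Proof.
move=> pr gr all_L.
pose P k hh := forall r x, r < k -> x < n -> htab hh tE r x = gE r x /\ htab hh tF r x = gF r x.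
suff : P m (run D fill_sides h) by [].
apply: (for_ind (N := m)) => //; first exact: pr_m.
move=> k hh km hk fr IH.
have prh : parsed hh by apply: parsed_frame fr pr.
have rq := rq_request km; have [ek fk _ _] := request_arcs rq.
pose Q j g := forall r x, x < n -> (r < k) || ((r == k) && (x < j)) ->
  htab g tE r x = gE r x /\ htab g tF r x = gF r x.
suff H : Q n (run D (HFor vX vN (
    HPut tE (HV vR) (HV vX) (hneq (HT tES (HV vR) (HV vX)) (HT tES (HV vR) (row0 tS (HV vR)))) ;;
    HPut tF (HV vR) (HV vX) (hneq (HT tFS (HV vR) (HV vX)) (HT tFS (HV vR) (row0 tTM (HV vR)))))) hh).
  by move=> r x; rewrite ltnS leq_eqVlt !htab_setv => rk xn; apply: H => //; rewrite xn andbT orbC.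
apply: (for_ind (N := n)) => //; first exact: pr_n prh.
  by move=> r x xn; rewrite andbF orbF => rk; apply: IH.
move=> j g jn hj fr2 IH2.
have prg : parsed g by apply: parsed_frame fr2 prh.
have gk : hvar g vR = k by rewrite (fr2.1 vR isT).
have tS_g : htab g tES = htab h tES by rewrite (fr2.2 tES isT) (fr.2 tES isT).
have tF_g : htab g tFS = htab h tFS by rewrite (fr2.2 tFS isT) (fr.2 tFS isT).
rewrite runS; set e2 := hneq _ _; set e1 := hneq _ _; set g1 := run D (HPut tE _ _ e1) g.
have v1 : heval D g e1 = gE k j.
  rewrite heval_hneq [heval _ _ _]/= [heval _ _ (HT _ _ (row0 _ _))]/= gk hj tS_g (pr_S prg) //.
  rewrite -{1}(inordK jn) !(gr_E gr) // neqb_cancel (E_source tree_e rq).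
  by rewrite eqbF_neg negbK.
have v2 : heval D g1 e2 = gF k j.
  rewrite heval_hneq [heval _ _ _]/= [heval _ _ (HT _ _ (row0 _ _))]/= gk hj tF_g (pr_TM prg) //.
  rewrite -{1}(inordK jn) !(gr_F gr) // neqb_cancel.
  rewrite [F_side e (nth_request k) (penult _)](side_tail tree_e fk).
  by rewrite eqbF_neg negbK.
have E1 r x : htab (run D (HPut tF (HV vR) (HV vX) e2) g1) tE r x =
    if (r == k) && (x == j) then gE k j : nat else htab g tE r x.
  by rewrite -v1 -gk -hj.
have E2 r x : htab (run D (HPut tF (HV vR) (HV vX) e2) g1) tF r x =
    if (r == k) && (x == j) then gF k j : nat else htab g tF r x.
  by rewrite -v2 -gk -hj.
move=> r x xn h1; rewrite !htab_setv E1 E2; case: ifP => [/andP[/eqP-> /eqP->]//|ne].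
apply: IH2 => //; case/orP: h1 => [->//|/andP[rk]]; move: ne; rewrite rk /= => ne.
by rewrite ltnS leq_eqVlt ne /= => ->; rewrite orbT.
Qed.

Lemma gNA_E r c : r < m -> c < m -> gNA r c =
  ~~ (gE r (target (nth_request c)) && ~~ gF c (source (nth_request r))) &&
  ~~ (gE c (target (nth_request r)) && ~~ gF r (source (nth_request c))).
Proof.
move=> rm cm; rewrite /gNA /interfere negb_or.
by rewrite !(interferes_onE tree_e) ?rq_request // /gE /gF !inord_val.
Qed.

Lemma run_fill_nonadj h : parsed h ->
  (forall r x, r < m -> x < n -> htab h tE r x = gE r x /\ htab h tF r x = gF r x) ->
  forall r c, r < m -> c < m -> htab (run D fill_nonadj h) tNA r c = gNA r c.
Proof.
move=> pr EF.
pose P k hh := forall r c, r < k -> c < m -> htab hh tNA r c = gNA r c.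
suff : P m (run D fill_nonadj h) by [].
apply: (for_ind (N := m)) => //; first exact: pr_m.
move=> k hh km hk fr IH.
have prh : parsed hh by apply: parsed_frame fr pr.
pose Q j g := forall r c, c < m -> (r < k) || ((r == k) && (c < j)) -> htab g tNA r c = gNA r c.
suff H : Q m (run D (HFor vCC vM (HPut tNA (HV vR) (HV vCC)
    (hand (hnot (hinterferes vR vCC)) (hnot (hinterferes vCC vR))))) hh).
  by move=> r c; rewrite ltnS leq_eqVlt htab_setv => rk cm; apply: H => //; rewrite cm andbT orbC.
apply: (for_ind (N := m)) => //; first exact: pr_m prh.
  by move=> r c cm; rewrite andbF orbF => rk; apply: IH.
move=> j g jm hj fr2 IH2.
have prg : parsed g by apply: parsed_frame fr2 prh.
have gk : hvar g vR = k by rewrite (fr2.1 vR isT).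
have tE_g : htab g tE = htab h tE by rewrite (fr2.2 tE isT) (fr.2 tE isT).
have tF_g : htab g tF = htab h tF by rewrite (fr2.2 tF isT) (fr.2 tF isT).
set ex := hand _ _.
have v1 : heval D g ex = gNA k j.
  rewrite heval_hand // !heval_hnot /hinterferes !heval_hand // !heval_hnot /=.
  rewrite gk hj tE_g tF_g !(pr_T prg) // !(pr_S prg) // !(fun r x rm xn => (EF r x rm xn).1) //.
  rewrite !(fun r x rm xn => (EF r x rm xn).2) // !eqb0 !negbK gNA_E //.
have E1 r c : htab (run D (HPut tNA (HV vR) (HV vCC) ex) g) tNA r c =
    if (r == k) && (c == j) then gNA k j : nat else htab g tNA r c.
  by rewrite -v1 -gk -hj.
move=> r c cm h1; rewrite htab_setv E1; case: ifP => [/andP[/eqP-> /eqP->]//|ne].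
apply: IH2 => //; case/orP: h1 => [->//|/andP[rk]]; move: ne; rewrite rk /= => ne.
by rewrite ltnS leq_eqVlt ne /= => ->; rewrite orbT.
Qed.

Lemma size_full (L : seq 'I_n) : uniq L -> (forall v, v \in L) -> size L = n.
Proof.
move=> uL all_L; have := card_uniqP uL.
rewrite (eq_card (B := predT)); first by rewrite card_ord.
by move=> v; rewrite all_L.
Qed.

Definition list_vertex (L : seq 'I_n) (i : nat) : nat := nth ord0 L i.

Lemma run_pairs L h : parsed h -> grown L h -> (forall v, v \in L) ->
  best_for m gE gF gNA (list_vertex L) (fun x i => i < n /\ x < n)
    (hvar (run D (fill_sides ;; fill_nonadj ;; all_pairs) h) vBest).
Proof.
move=> pr gr all_L; rewrite 2!runS; set h1 := run D fill_sides h.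
set h2 := run D fill_nonadj h1.
have f1 : frame fill_sides h h1 by apply: run_frame.
have f2 : frame fill_nonadj h1 h2 by apply: run_frame.
have pr1 : parsed h1 by apply: parsed_frame f1 pr.
have pr2 : parsed h2 by apply: parsed_frame f2 pr1.
have [uL _ hL _] := gr_spread gr.
have szL := size_full uL all_L.
have EF := run_fill_sides pr gr all_L; rewrite -/h1 in EF.
apply: run_all_pairs => //.
- by move=> i _; exact: ltn_ord.
- by rewrite /list_vertex nth0; case: (L) hL => //= a l ->.
- by move=> r c; rewrite /gNA /interfere orbC.
- move=> x y xn yn; have [P HP] := two_cliques tree_e (inord x) (inord y).
  exists (fun r : 'I_m => P (nth_request r)) => r c Er Ec Fr Fc PP.
  by rewrite /gNA negbK; apply: HP => //; apply: rq_request.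
(* Every entry of y into F_r is a change of side along the list, and a spread list allows two. *)
- move=> r i rm i_n; have [_ er _ _] := request_arcs (rq_request rm).
  apply: leq_trans (spread_changes (gr_spread gr) er); rewrite (changes_sum ord0) szL /=.
  rewrite -(big_mkord xpredT (fun j => ~~ gF r (list_vertex L j) && gF r (list_vertex L j.+1) : nat)).
  rewrite [X in _ <= X](big_cat_nat (n := i)) //=; apply: leq_trans (leq_addr _ _).
  apply: leq_sum => j _; rewrite /gF /list_vertex !inord_val /F_side.
  by case: side; case: side.
- split; rewrite ?(pr_n pr2) ?(pr_m pr2) ?(pr_steps pr2) //.
  + by move=> r x rm xn; rewrite (f2.2 tE isT); case: (EF r x rm xn).
  + by move=> r x rm xn; rewrite (f2.2 tF isT); case: (EF r x rm xn).
  + exact: run_fill_nonadj.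
  move=> i i_n; rewrite (f2.2 tNext isT) (f1.2 tNext isT).
  by have /(sortedP ord0)/(_ i) := gr_next gr; rewrite szL => /(_ i_n)/eqP.
exact: pr_best pr2.
Qed.

Lemma best_for_omega L b : uniq rs -> (forall v, v \in L) -> uniq L ->
  best_for m gE gF gNA (list_vertex L) (fun x i => i < n /\ x < n) b -> omega e rs = b.
Proof.
move=> urs all_L uL [[K0 [iK0 sK0]] up].
have idxP (s : seq_sub rs) : index (ssval s) rs < m by rewrite index_mem (ssvalP s).
pose idx s := Ordinal (idxP s).
have nth_idx s : nth_request (idx s) = ssval s by rewrite /nth_request nth_index // (ssvalP s).
have idx_inj : injective idx.
  by move=> s t st; apply: val_inj; rewrite -[val s]nth_idx st nth_idx.
have rqP (s : seq_sub rs) : request e (ssval s) by apply: (allP rs_req); apply: ssvalP.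
apply/eqP; rewrite eqn_leq; apply/andP; split.
  apply/bigmax_leqP => K cK.
  have iK : {in K &, forall s t, interfere e (ssval s) (ssval t)}.
    move=> s t sK tK; case: (eqVneq s t) => [->|st].
      by rewrite /interfere interferes_on_refl.
    move/forall_inP: cK => /(_ s sK)/forall_inP/(_ t tK).
    by rewrite st => /andP[].
  (* The Helly vertices of the clique form one of the pairs treated by the program, and that pair
     selects the whole clique. *)
  have [x [y Hxy]] := clique_sides tree_e (fun s _ => rqP s) iK.
  rewrite -(card_imset _ idx_inj); apply: (up (val x) (index y L)).
  - split; last exact: ltn_ord.
    by have := all_L y; rewrite -index_mem size_full.
  - move=> r c /imsetP[s sK ->] /imsetP[t tK ->].
    by rewrite /gNA negbK !nth_idx; apply: iK.
  move=> r /imsetP[s sK ->]; rewrite /selected /gE /gF /list_vertex nth_idx nth_index //.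
  by rewrite !inord_val; apply: Hxy.
have backP (r : 'I_m) : nth_request r \in rs by apply: mem_nth.
pose back (r : 'I_m) : seq_sub rs := SeqSub (backP r).
have back_inj : injective back.
  move=> r c /(congr1 (@ssval _ _)) /= /eqP; rewrite /nth_request nth_uniq // => /eqP.
  exact: val_inj.
rewrite -sK0 -(card_imset _ back_inj).
apply: (@leq_bigmax_cond _ _ (fun K : {set seq_sub rs} => #|K|)).
apply/forall_inP => s /imsetP[r rK ->]; apply/forall_inP => t /imsetP[c cK ->].
apply/implyP => ne; rewrite /interference_graph ne /=.
by have := iK0 _ _ rK cK; rewrite /gNA negbK.
Qed.

Notation inp := (encode_instance es rs).

Lemma size_flatten_edges (l : seq ('I_n * 'I_n)) :
  size (flatten [seq encode_edge a | a <- l]) = (size l).*2.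
Proof. by elim: l => //= a l ->. Qed.

Lemma size_flatten_requests (l : seq (vseq 'I_n)) : all (request e) l ->
  (size l).*2 <= size (flatten [seq encode_request r | r <- l]) <= size l * n.+1.
Proof.
elim: l => //= -[x p] l IH /andP[/andP[/andP[_ ux] p0] /IH/andP[lo hi]].
have px : size p < n.
  by have := uniq_leq_size ux (fun z _ => mem_enum 'I_n z); rewrite size_enum_ord.
rewrite size_cat size_map mulSn doubleS; move: lo hi p0 px.
by move: (size (flatten _)) (size l * _) => a b /=; lia.
Qed.

(** The lower bound ties the word length, given through the input size, to [D]; the upper bound
    makes the input fit in table [tIn]. *)
Lemma size_inp : size es = n.-1 -> n + m < size inp < D * D.
Proof.
move=> ses; have /andP[lo hi] := size_flatten_requests rs_req.
rewrite /encode_instance /= size_cat size_flatten_edges ses /=; apply/andP; split.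
  by move: lo; rewrite -!addnn; lia.
have : (n + m + 2) * (n + m + 2) <= D * D by apply: leq_mul.
apply: leq_trans; apply: (@leq_ltn_trans (n'.*2 + m * n.+1).+2); first by rewrite !ltnS leq_add2l.
rewrite -addnn; nia.
Qed.

Lemma inp_lt x : x \in inp -> x < D.
Proof.
have small y : y <= n + m -> y < D by move=> h; apply: leq_trans D_big; lia.
have vsmall (v : 'I_n) : v < D by apply: small; apply: leq_trans (ltnW (ltn_ord v)) (leq_addr _ _).
rewrite /encode_instance !inE mem_cat => /or3P[/eqP->|/eqP->|/orP[]].
- by apply: small; rewrite leq_addr.
- by apply: small; rewrite leq_addl.
- by case/flattenP=> s /mapP[a _ ->]; rewrite !inE => /orP[] /eqP->; apply: vsmall.
case/flattenP=> s /mapP[[y p] /(allP rs_req) /andP[/andP[_ up] _] ->].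
rewrite in_cons => /orP[/eqP->|/mapP[v _ ->]]; last exact: vsmall.
apply: small; apply: leq_trans (leq_addr _ _).
by have := uniq_leq_size up (fun z _ => mem_enum 'I_n z); rewrite size_enum_ord.
Qed.

Definition initial_hstate : hstate := HState (fun=> 0)
  (fun q i j => if [&& q == tIn, i < D & j < D] then nth 0 inp (i * D + j) else 0).

Definition nat_request (r : vseq 'I_n) : vseq nat := (val r.1, [seq val x | x <- r.2]).

Lemma nat_requestE r : request e r ->
  [/\ source (nat_request r) = source r, second (nat_request r) = second r,
      penult (nat_request r) = penult r & target (nat_request r) = target r].
Proof.
case: r => x [|y p] // _; rewrite /nat_request /source /second /penult /target /=.
split=> //; last by rewrite last_map.
by rewrite size_map /verts /= -map_cons -map_cons (nth_map x) // ltnS leqnSn.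
Qed.

Lemma clique_progP : uniq rs -> hvar (run D clique_prog initial_hstate) vBest = omega e rs.
Proof.
move=> urs; have ses : size es = n.-1 by rewrite (card_edge_list tree_e es_e) card_ord.
have /andP[_ small] := size_inp ses.
rewrite /clique_prog 4!runS.
set h1 := run D read_header initial_hstate; set h2 := run D read_edges h1.
set h3 := run D read_requests h2; set h4 := run D grow_list h3.
have f2 : frame read_edges h1 h2 by apply: run_frame.
have f3 : frame read_requests h2 h3 by apply: run_frame.
have D0 : 0 < D by apply: ltnW.
have D2 : 2 < D by move: D_big; lia.
have n1 : hvar h1 vN = n by rewrite /h1 /= /update /= D0 /=.
have m1 : hvar h1 vM = m by rewrite /h1 /= /update /= D0 D_gt1 /=.
have e1 : hvar h1 vEdges = size es.
  by rewrite ses -n1 /h1 /= /update /= D0 /= subn1.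
have s1 : hvar h1 vSteps = n + m.
  rewrite /h1 /= /update /= D0 D_gt1 /= modn_small //; move: D_big; lia.
have rd1 : reading D inp h1 (flatten [seq encode_edge a | a <- es] ++
    flatten [seq encode_request r | r <- rs]).
  by split=> //= [i j iD jD|]; rewrite ?iD ?jD ?drop0.
pose l1 := [seq (val a.1, val a.2) | a <- es].
pose l2 := [seq nat_request r | r <- rs].
have E1 : flatten [seq encode_edge a | a <- es] = flatten [seq [:: a.1; a.2] | a <- l1].
  by rewrite -map_comp.
have E2 : flatten [seq encode_request r | r <- rs] =
    flatten [seq (size (verts q)) :: verts q | q <- l2].
  by rewrite -map_comp; congr flatten; apply: eq_map => -[x p]; rewrite /encode_request /= size_map.
rewrite E1 E2 in rd1.
have [|rd2 tab2] := run_read_edges D_gt1 small _ rd1; first by rewrite size_map.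
have m2 : hvar h2 vM = size l2 by rewrite (f2.1 vM isT) m1 size_map.
have tab3 r : r < m -> request_tables h3 r (nth (0, [::]) l2 r).
  move=> rm; apply: (run_read_requests D_gt1 small m2) => //; last by rewrite size_map.
  by move=> q /mapP[[x p] /(allP rs_req)/andP[_ p0] ->]; rewrite /= size_map.
have nth2 r : r < m -> nth (0, [::]) l2 r = nat_request (nth_request r).
  by move=> rm; rewrite (nth_map (ord0, [::])).
have pr3 : parsed h3.
  split.
  - by rewrite (f3.1 vN isT) (f2.1 vN isT).
  - by rewrite (f3.1 vM isT) (f2.1 vM isT).
  - by rewrite (f3.1 vEdges isT) (f2.1 vEdges isT).
  - by rewrite (f3.1 vSteps isT) (f2.1 vSteps isT).
  - by rewrite (f3.1 vBest isT) (f2.1 vBest isT).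
  - move=> k ke; rewrite (f3.2 tU isT); have [|-> _] := tab2 k; first by rewrite size_map.
    by rewrite (nth_map (ord0, ord0)).
  - move=> k ke; rewrite (f3.2 tV isT); have [|_ ->] := tab2 k; first by rewrite size_map.
    by rewrite (nth_map (ord0, ord0)).
  - by move=> r rm; have [-> _ _ _] := tab3 r rm; rewrite nth2 //; case: (nat_requestE (rq_request rm)).
  - by move=> r rm; have [_ -> _ _] := tab3 r rm; rewrite nth2 //; case: (nat_requestE (rq_request rm)).
  - by move=> r rm; have [_ _ -> _] := tab3 r rm; rewrite nth2 //; case: (nat_requestE (rq_request rm)).
  by move=> r rm; have [_ _ _ ->] := tab3 r rm; rewrite nth2 //; case: (nat_requestE (rq_request rm)).
have zero q i j : q \in [:: tSeen; tES; tFS] -> htab h3 q i j = 0.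
  rewrite !inE => /or3P[] /eqP->; first by rewrite (f3.2 tSeen isT) (f2.2 tSeen isT).
    by rewrite (f3.2 tES isT) (f2.2 tES isT).
  by rewrite (f3.2 tFS isT) (f2.2 tFS isT).
have [L [gr4 all_L]] := run_grow_list pr3 zero.
have f4 : frame grow_list h3 h4 by apply: run_frame.
have pr4 : parsed h4 by apply: parsed_frame f4 pr3.
have [uL _ _ _] := gr_spread gr4.
by symmetry; apply: (best_for_omega urs all_L uL); apply: run_pairs.
Qed.

End Instance.

(** * The machine program and its running time *)

(** Register 0 first receives the modulus n + m + 2, from the first two input words, and finally the
    content of register 1, where [vBest] lives. *)
Definition clique_cmd : cmd :=
  Seq (Assign 0 (Bin Add (Bin Add (Read (Cst 0)) (Read (Cst 1))) (Cst 2)))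
    (Seq (compile clique_prog) (Assign 0 (Reg 1))).

(** The tree has at most 2 m edges, so that n + m + 2 is at most 3 m + 3; the 12 pays for setting
    the modulus and returning the result. *)
Definition clique_time (m : nat) : nat :=
  cost clique_prog * (3 * m + 3) ^ 4 + 12.

Lemma clique_cmdP n (e : rel 'I_n) (es : seq ('I_n * 'I_n)) (rs : seq (vseq 'I_n)) w :
  tree e -> edge_list e es -> uniq rs -> all (request e) rs -> every_edge_used e rs ->
  9 * up_log 2 (size (encode_instance es rs)) <= w ->
  computes_within w clique_cmd (encode_instance es rs) (clique_time (size rs)) (omega e rs).
Proof.
case: n e es rs => [|n'] e es rs; first by case; rewrite card_ord.
move=> te ee urs rq used le_w; set m := size rs; set inp := encode_instance es rs.
pose D := n'.+1 + m + 2.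
have ses : size es = n' by rewrite (card_edge_list te ee) card_ord.
have Dle : D <= 3 * m + 3.
  have := size_edge_list ee rq used; rewrite ses -/m /D -addnn; lia.
have /andP[D_inp inp_D] := size_inp rq (leqnn D) ses.
(* Origin of the factor 9 in the word length: D is at most 2 S, so the 20 tables need at most 80 S^2
   words, which is below 2^7 S^2 and hence at most S^9, as S is at least 2. *)
have Dw : nb_tables * D * D <= 2 ^ w.
  set S := size inp in le_w D_inp.
  have S2 : 2 <= S by move: D_inp; rewrite -/m; lia.
  have DS : D <= 2 * S by move: D_inp S2; rewrite -/m /D; lia.
  have S9 : S ^ 9 <= 2 ^ w.
    apply: leq_trans (_ : 2 ^ (9 * up_log 2 S) <= _); last by rewrite leq_exp2l.
    by rewrite mulnC expnM leq_exp2r // up_logP.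
  apply: leq_trans S9; rewrite (_ : 9 = 7 + 2) // expnD.
  apply: (@leq_trans (2 ^ 7 * S ^ 2)); last by rewrite leq_mul2r leq_exp2r ?S2 ?orbT.
  apply: (@leq_trans (nb_tables * (2 * S) * (2 * S))); first by rewrite leq_mul // leq_mul2l DS.
  by rewrite -mulnn (_ : 2 ^ 7 = 128) // /nb_tables; nia.
have D3 : 2 < D by rewrite /D; lia.
have Dlt : D < 2 ^ w by apply: leq_trans Dw; rewrite /nb_tables; nia.
pose s1 := State (update (fun=> 0) 0 D) (nth 0 inp).
have ex1 : exec w (Assign 0 (Bin Add (Bin Add (Read (Cst 0)) (Read (Cst 1))) (Cst 2)))
    (initial_state inp) 8 s1.
  have := ExecAssign w 0 (Bin Add (Bin Add (Read (Cst 0)) (Read (Cst 1))) (Cst 2)) (initial_state inp).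
  rewrite /= (@modn_small 1) ?(@modn_small 2) ?mod0n /=; try by apply: leq_trans Dlt; rewrite /D; lia.
  by rewrite (@modn_small (n'.+1 + m)) ?(modn_small Dlt) //; apply: leq_trans Dlt; rewrite /D; lia.
have rep1 : rep D s1 (initial_hstate es rs D).
  have inpD k : nth 0 inp k < D.
    case: (ltnP k (size inp)) => ks; last by rewrite nth_default // (leq_trans _ D3).
    by apply: (inp_lt (es := es) rq (leqnn D)); apply: mem_nth.
  split=> //; try by move=> *; apply: leq_trans D3.
  - move=> q i j _ iD jD.
    have -> : htab (initial_hstate es rs D) q i j = if q == 0 then nth 0 inp (i * D + j) else 0.
      by rewrite /initial_hstate [LHS]/= iD jD !andbT.
    rewrite -[LHS]/(nth 0 inp ((q * D + i) * D + j)).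
    case: (eqVneq q 0) => [->|q0]; first by rewrite mul0n.
    (* The tables other than [tIn] start at address D * D, beyond the end of the input, where the
       initial memory is 0. *)
    rewrite nth_default //; apply: leq_trans (ltnW inp_D) _.
    apply: leq_trans (leq_addr _ _); rewrite leq_mul2r; apply/orP; right.
    by apply: leq_trans (leq_addr _ _); rewrite leq_pmull // lt0n.
  by move=> q i j /=; case: ifP => // _; apply: leq_trans D3.
have [t [s2 [ex2 le2 rep2]]] := compileP D3 Dw clique_prog_wf rep1.
have [_ sv _ _ _] := rep2.
exists (8 + (t + 2).+1).+1, (State (update (regs s2) 0 (regs s2 1)) (mem s2)); split.
- by apply: ExecSeq ex1 _; apply: ExecSeq ex2 _; exact: (ExecAssign w 0 (Reg 1) s2).
- rewrite clique_prog_depth in le2; rewrite /clique_time.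
  have : t <= cost clique_prog * (3 * m + 3) ^ 4.
    by apply: leq_trans le2 _; rewrite leq_mul2l leq_exp2r ?Dle ?orbT.
  by move: (cost _ * _) => a; lia.
by rewrite /= /update /= sv; apply: clique_progP.
Qed.

Import Order.TTheory GRing.Theory Num.Theory.
Local Open Scope classical_set_scope.

(** The exponent 4 achieved by the program is below 9/2, so comparing powers of [m] for [m] at least
    1 is enough. *)
Lemma pow4_bigO (K : realType) (c d : nat) :
  ((fun m : nat => (c * (3 * m + 3) ^ 4 + d)%:R : K^o) =O_\oo
     (fun m : nat => (m%:R `^ (9%:R / 2%:R)) : K^o))%R.
Proof.
apply/eqOP; near=> k; near=> m.
have m1 : (1 <= m)%N by near: m; exists 1%N.
have m1K : (1 <= m%:R :> K)%R by rewrite ler1n.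
rewrite normr_nat [X in (_ <= _ * X)%R]ger0_norm ?powR_ge0 //.
(* For [m] at least 1, 3 m + 3 is at most 6 m and [d] is at most d m^4. *)
apply: (@le_trans _ _ ((c * 6 ^ 4 + d)%:R * m%:R ^+ 4)%R).
  rewrite -natrX -natrM ler_nat.
  have : (3 * m + 3 <= 6 * m)%N by lia.
  rewrite -(leq_exp2r _ _ (isT : 0 < 4)%N) expnMn => h.
  have m4 : (0 < m ^ 4)%N by rewrite expn_gt0 m1.
  rewrite mulnDl leq_add //; last by rewrite leq_pmulr.
  by rewrite -mulnA leq_mul2l h orbT.
apply: ler_pM; rewrite ?ler0n ?exprn_ge0 //.
rewrite -powR_mulrn //; apply: ler_powR => //.
by rewrite ler_pdivlMr // -natrM ler_nat.
Unshelve. all: by end_near.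
Qed.

Theorem theorem8 (K : realType) :
  exists (prog : cmd) (k : nat) (time : nat -> nat),
    ((fun m : nat => (time m)%:R : K^o) =O_\oo
       (fun m : nat => (m%:R `^ (9%:R / 2%:R)) : K^o))%R /\
    forall (n : nat) (e : rel 'I_n) (es : seq ('I_n * 'I_n))
      (rs : seq (vseq 'I_n)),
      tree e -> edge_list e es ->
      uniq rs -> all (request e) rs -> every_edge_used e rs ->
      forall w : nat, k * up_log 2 (size (encode_instance es rs)) <= w ->
        computes_within w prog (encode_instance es rs)
          (time (size rs)) (omega e rs).
Proof.
exists clique_cmd, 9, clique_time; split; first exact: pow4_bigO.
by move=> n e es rs te ee urs rq used w le; apply: clique_cmdP.
Qed.
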